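(* Let $d \geq 2$, $1 \leq k \leq d-1$, let $\mathcal{G}=(\mathcal{V},\mathcal{E})$ be a quasi-strongly connected directed graph on $\mathcal{V}=\{1,\ldots,n\}$, and let $a_{ij}>0$ for $(i,j)\in\mathcal{E}$ be constants. Suppose that each agent $i$ evolves according to $\frac{d}{dt}Q_i(t,d) = Q_i(t,d)U_i(t,d)$ with $U_i(t,d)\in\mathsf{so}(d)$ and $Q_i(0,d)\in\mathsf{SO}(d)$, and that the signals $Q_i(t,k)$ and $R_i(t,k)$ are produced by the distributed control algorithm (closed-loop system) described in the context. Then the set $\mathcal{D}_{QR,\text{full}}(k)$ is open, and the set $\mathcal{D}_{QR}(k) - \mathcal{D}_{QR,\text{full}}(k)$ has measure zero and is nowhere dense in $\mathcal{D}_{QR}(k)$.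
   Context: Sets. $\mathsf{SO}(d)=\{Q\in\mathbb{R}^{d\times d}: Q^TQ=I_d,\ \det Q=1\}$; $\mathsf{so}(d)=\{\Omega\in\mathbb{R}^{d\times d}:\Omega^T=-\Omega\}$; $\mathsf{GL}(k)$ is the set of invertible matrices in $\mathbb{R}^{k\times k}$; $\mathcal{R}^+(k)$ is the set of upper triangular matrices in $\mathbb{R}^{k\times k}$ with positive diagonal elements. $[I_k,0]^T$ denotes the $d\times k$ matrix whose top $k\times k$ block is $I_k$ and whose remaining rows are zero. Graph. $\mathcal{G}=(\mathcal{V},\mathcal{E})$ with $\mathcal{E}\subset\mathcal{V}\times\mathcal{V}$ is quasi-strongly connected if there is one node to which there is a directed path from every other node; a directed path is a sequence of nodes such that any two consecutive nodes form an edge. $\mathcal{N}_i=\{j\in\mathcal{V}:(i,j)\in\mathcal{E}\}$. Notation. $Q_i(t)=Q_i(t,d)\in\mathsf{SO}(d)$, and $Q_i(t,k)\in\mathbb{R}^{d\times k}$ consists of the first $k$ columns of $Q_i(t,d)$. $R_i(t,k)\in\mathbb{R}^{k\times k}$ are auxiliary variables. $Q_{ij}(t,k)=Q_i^T(t,d)Q_j(t,k)$, and $R_{ij}(t,k)=R_i(t,k)R_j^{-1}(t,k)$ when $R_j(t,k)$ is invertible (so $R_{ji}(t,k)=R_j(t,k)R_i^{-1}(t,k)$). $Q(t,k)=[Q_1^T(t,k),\ldots,Q_n^T(t,k)]^T\in\mathbb{R}^{nd\times k}$ and $R(t,k)=[R_1^T(t,k),\ldots,R_n^T(t,k)]^T\in\mathbb{R}^{nk\times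 k}$. For a matrix $M\in\mathbb{R}^{m_1\times m_2}$ with $m_1\ge m_2$: $\text{low}(M)\in\mathbb{R}^{m_1\times m_2}$ has $(i,j)$-element equal to that of $M$ if $i>j$ and $0$ if $i\le j$; $\text{up}(M)\in\mathbb{R}^{m_2\times m_2}$ has $(i,j)$-element equal to that of $M$ if $i\le j$ and $0$ if $i>j$. Control algorithm (closed-loop system). At time $0$, $R_i(0,k)$ is upper triangular with positive diagonal elements and $Q_i(0,d)\in\mathsf{SO}(d)$. For $t\ge0$, whenever the $R_i(t,k)$ are in $\mathsf{GL}(k)$, for all $i$: $$V_i(t,k)=\sum_{j\in\mathcal{N}_i}a_{ij}\big(Q_{ij}(t,k)R_{ji}(t,k)-[I_k,0]^T\big)\in\mathbb{R}^{d\times k},$$ $$U_i(t,d)=[\text{low}(V_i(t,k)),0]-[\text{low}(V_i(t,k)),0]^T\in\mathbb{R}^{d\times d},$$ $$\dot R_i(t,k)=\text{up}\big((V_i(t,k)-U_i(t,k))R_i(t,k)\big),$$ where $U_i(t,k)=\text{low}(V_i(t,k))-[I_k,0]^T\big(\text{low}(V_i(t,k))^T[I_k,0]^T\big)$ comprises the first $k$ columns of $U_i(t,d)$, i.e. $U_i(t,k)=U_i(t,d)[I_k,0]^T$; and $\frac{d}{dt}Q_i(t,d)=Q_i(t,d)U_i(t,d)$, so in particular $\frac{d}{dt}Q_i(t,k)=Q_i(t,d)U_i(t,k)$. Sets of initial points. $$\mathcal{D}_{QR}(k)=(\mathsf{SO}(d)[I_k,0]^T)^n\times(\mathcal{R}^+(k))^n,$$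 i.e. the set of pairs $[Q,R]$ with $Q=[Q_1^T,\ldots,Q_n^T]^T$, $R=[R_1^T,\ldots,R_n^T]^T$, each $Q_i$ being the first $k$ columns of a matrix in $\mathsf{SO}(d)$ and each $R_i\in\mathcal{R}^+(k)$. $\mathcal{D}_{QR,\text{full}}(k)$ is the set of initial points $[Q(0,k),R(0,k)]$ such that, for the closed-loop system started there, (1) $[Q(t,k),R(t,k)]\in\mathcal{D}_{QR}(k)$ for all $t\ge0$ (in particular the solution exists for all $t\geq 0$), and (2) there exist $\bar Q\in\mathsf{SO}(d)$ and $\bar R\in\mathsf{GL}(k)$ such that $\lim_{t\to\infty}[Q_i(t,k),R_i(t,k)]=[\bar Q[I_k,0]^T,\bar R]$ for all $i$. Here $Q_i(0,d)\in\mathsf{SO}(d)$ is any matrix whose first $k$ columns are $Q_i(0,k)$; the evolution of $(Q(t,k),R(t,k))$ does not depend on this choice. Topology and measure. $\mathcal{D}_{QR}(k)$ carries its subspace topology and its structure as a smooth embedded submanifold of Euclidean space; ''open'' means open in $\mathcal{D}_{QR}(k)$ and ''measure zero'' is in the sense of smooth manifolds (zero Lebesgue measure in charts). *)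

(* Defs.v *)
From HB Require Import structures.
From mathcomp Require Import all_boot all_order all_algebra.
From mathcomp Require Import all_classical all_reals all_analysis.
Import Order.TTheory GRing.Theory Num.Theory.
Import numFieldNormedType.Exports.
Set Implicit Arguments.
Unset Strict Implicit.
Unset Printing Implicit Defensive.
Local Open Scope classical_set_scope.
Local Open Scope ring_scope.

Definition quasi_strongly_connected (n : nat) (E : rel 'I_n) : Prop :=
  exists r : 'I_n, forall i : 'I_n, connect E i r.

Section Matrices.
Variable R : realType.

Definition SO (d : nat) : set 'M[R]_d :=
  [set Q | Q^T *m Q = 1%:M /\ \det Q = 1].

Definition so (d : nat) : set 'M[R]_d := [set W | W^T = - W].

Definition upper_pos (k : nat) : set 'M[R]_k :=
  [set T | (forall i j : 'I_k, (j < i)%N -> T i j = 0)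
         /\ (forall i : 'I_k, 0 < T i i)].

(* The d x k matrix [I_k, 0]^T, for k <= d: right multiplication by it keeps
   the first k columns, left multiplication by its transpose keeps the top k
   rows, and right multiplication by its transpose pads with d - k zero
   columns. *)
Definition Itop (d k : nat) : 'M[R]_(d, k) := pid_mx k.

Definition low (d k : nat) (M : 'M[R]_(d, k)) : 'M[R]_(d, k) :=
  \matrix_(i < d, j < k) if (j < i)%N then M i j else 0.

Definition up (d k : nat) (M : 'M[R]_(d, k)) : 'M[R]_k :=
  \matrix_(i < k, j < k) if (i <= j)%N then ((Itop d k)^T *m M) i j else 0.

Definition input (d k : nat) (V : 'M[R]_(d, k)) : 'M[R]_d :=
  low V *m (Itop d k)^T - (low V *m (Itop d k)^T)^T.

Lemma input_so (d k : nat) (V : 'M[R]_(d, k)) : so (input V).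
Proof. by rewrite /so/= /input linearB/= trmxK opprB. Qed.

End Matrices.

Section ClosedLoop.
Variables (R : realType) (n d k : nat) (E : rel 'I_n) (a : 'I_n -> 'I_n -> R).

Definition Vctrl (Q : 'I_n -> 'M[R]_d) (T : 'I_n -> 'M[R]_k) (i : 'I_n)
    : 'M[R]_(d, k) :=
  \sum_(j < n | E i j)
    a i j *: (((Q i)^T *m (Q j *m Itop R d k)) *m (T j *m invmx (T i))
              - Itop R d k).

(* Solutions on [0, +oo[ with Q t i = Q_i(t,d) and T t i = R_i(t,k). Values at
   negative times are unconstrained, so that the two-sided derivative at t = 0
   amounts to a one-sided one: a curve differentiable from the right at 0
   extends affinely to the left. *)
Definition closed_loop (Q : R -> 'I_n -> 'M[R]_d) (T : R -> 'I_n -> 'M[R]_k)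
    : Prop :=
  [/\ forall i, SO (Q 0 i),
      forall i, upper_pos (T 0 i)
    & forall t : R, 0 <= t -> forall i : 'I_n,
      let V := Vctrl (Q t) (T t) i in
      let U := input V in
      [/\ T t i \in unitmx,
          is_derive t (1 : R) (fun s => T s i)
            (up ((V - U *m Itop R d k) *m T t i))
        & is_derive t (1 : R) (fun s => Q s i) (Q t i *m U)]].

Definition ambient : normedModType R :=
  ('M[R]_(\sum_(i < n) d, k) * 'M[R]_(\sum_(i < n) k, k))%type.

Definition D_QR : set ambient :=
  [set p | (forall i : 'I_n, exists2 Q : 'M[R]_d,
              SO Q & submxcol p.1 i = Q *m Itop R d k)
         /\ (forall i : 'I_n, upper_pos (submxcol p.2 i))].

Definition state (Q : 'I_n -> 'M[R]_d) (T : 'I_n -> 'M[R]_k) : ambient :=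
  (\mxcol_(i < n) (Q i *m Itop R d k), \mxcol_(i < n) T i).

(* The completion Q0 i of the first k columns of each initial rotation is
   arbitrary. *)
Definition D_QR_full : set ambient :=
  [set p | D_QR p /\
    forall Q0 : 'I_n -> 'M[R]_d,
      (forall i, SO (Q0 i)) ->
      (forall i, Q0 i *m Itop R d k = submxcol p.1 i) ->
      exists (Q : R -> 'I_n -> 'M[R]_d) (T : R -> 'I_n -> 'M[R]_k),
        [/\ closed_loop Q T,
            forall i, Q 0 i = Q0 i,
            forall i, T 0 i = submxcol p.2 i,
            forall t : R, 0 <= t -> D_QR (state (Q t) (T t))
          & exists (Qbar : 'M[R]_d) (Tbar : 'M[R]_k),
            [/\ SO Qbar, Tbar \in unitmx
              & forall i,
                ((fun t : R => Q t i *m Itop R d k) @ +oo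
                   --> Qbar *m Itop R d k)
                /\ ((fun t : R => T t i) @ +oo --> Tbar)]]].

End ClosedLoop.

Section Submanifolds.
Variable R : realType.

Fixpoint class_C (r : nat) (V W : normedModType R) (U : set V) (f : V -> W)
    : Prop :=
  if r is r'.+1 then
    (forall x, U x -> differentiable f x)
    /\ (forall v : V, class_C r' U (fun x => 'D_v f x))
  else forall x, U x -> {for x, continuous f}.

Definition smooth_on (V W : normedModType R) (U : set V) (f : V -> W) : Prop :=
  forall r, class_C r U f.

(* f : U -> M is the inverse of a chart of the embedded submanifold M of W: a
   smooth immersion that is a homeomorphism onto a relatively open subset of
   M. *)
Definition local_param (m : nat) (W : normedModType R) (M : set W)
    (U : set 'rV[R]_m) (f : 'rV[R]_m -> W) : Prop :=
  [/\ open U /\ f @` U `<=` M,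
      smooth_on U f,
      forall x, U x -> injective ('d f x),
      {in U &, injective f}
    & forall U' : set 'rV[R]_m, open U' -> U' `<=` U ->
        @open (subspace M) (f @` U')].

Definition box (m : nat) (l h : 'rV[R]_m) : set 'rV[R]_m :=
  [set x | forall i : 'I_m, l 0 i <= x 0 i <= h 0 i].

(* Zero outer Lebesgue measure on R^m. The family of boxes is indexed by a
   subset of nat so that the empty set is also null when m = 0, where a box is
   a point of volume 1. *)
Definition lebesgue_null (m : nat) (A : set 'rV[R]_m) : Prop :=
  forall eps : R, 0 < eps ->
    exists (J : set nat) (l h : nat -> 'rV[R]_m),
      [/\ forall j, J j -> forall i : 'I_m, l j 0 i <= h j 0 i,
          A `<=` \bigcup_(j in J) box (l j) (h j)
        & (\esum_(j in J) (\prod_(i < m) (h j 0 i - l j 0 i))%:E <= eps%:E)%E].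

(* No dimension has to be supplied: if M is a submanifold of dimension m', a
   local parametrization with nonempty domain exists only for m = m'. *)
Definition measure_zero_in (W : normedModType R) (M A : set W) : Prop :=
  forall (m : nat) (U : set 'rV[R]_m) (f : 'rV[R]_m -> W),
    local_param M U f -> lebesgue_null (U `&` f @^-1` A).

Definition open_in (W : normedModType R) (M A : set W) : Prop :=
  A `<=` M /\ @open (subspace M) A.

Definition nowhere_dense_in (W : normedModType R) (M A : set W) : Prop :=
  A `<=` M /\ @interior (subspace M) (@closure (subspace M) A) = set0.

End Submanifolds.

(* Main.v *)
Require Import Defs.
From HB Require Import structures.
From mathcomp Require Import all_boot all_order all_algebra.
From mathcomp Require Import all_classical all_reals all_analysis.
From mathcomp Require Import perm ring lra.
Import Order.TTheory GRing.Theory Num.Theory.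
Import numFieldNormedType.Exports.
Set Implicit Arguments.
Unset Strict Implicit.
Unset Printing Implicit Defensive.
Local Open Scope classical_set_scope.
Local Open Scope ring_scope.

(** Put Z_i = Q_i(t, k) R_i(t, k). Along the closed loop the nonlinear terms
    cancel and the Z_i solve the linear consensus equation
    Z_i' = sum_j a_ij (Z_j - Z_i) ([closed_loop_consensus]), whose flow is
    Z_i(t) = sum_j Phi_ij(t) Z_j(0) with Phi(t) row stochastic and
    Phi_ij(t) --> q_j ([consensus_flow]). Conversely Q_i(t, k) and R_i(t, k) are
    the factors of the QR factorization of Z_i(t), and the solution exists as
    long as all Z_i(t) have rank k ([frame_tracking]). So an initial point of
    D_QR belongs to D_QR_full if and only if every combination
    sum_j c_j Z_j(0), where c is a row of some Phi(t), t >= 0, or the limit q,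
    has full rank ([D_QR_full_regular], [regular_D_QR_full]).

    Openness: full rank is an open condition, and the curves t |-> Phi_ij(t)
    together with their limits are compact ([regular_near]).

    Measure zero: matrices of size d x k and rank less than k have codimension
    d - k + 1 >= 2, and the time t adds one dimension only. Hence the tuples Z
    with a rank-deficient combination form a countable union of Lipschitz images
    of sets of dimension n d k - 1 ([piece_lipschitz]). Since QR factorization is
    locally bi-Lipschitz ([D_QR_lipschitz]), every chart of D_QR carries these
    tuples to a null set ([lipschitz_null], [deficient_null]); that charts have
    dimension at least n d k follows by counting the points of a grid
    ([lipschitz_not_cube], [parametrization_dim]).

    Nowhere density: by the same counting argument a single piece contains no
    cube, so the condition up to time T holds on an open dense set, and Baire's
    theorem applies ([never_deficient_dense]); the section [D_QR_section] carries
    density back to D_QR. *)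

(** * Calculus on the half-line *)

Lemma is_derive_continuous (R : realType) (f : R -> R) (t l : R) :
  is_derive t (1 : R) f l -> {for t, continuous f}.
Proof.
case=> df _; apply: differentiable_continuous.
by apply/derivable1_diffP.
Qed.

Lemma derive_ge0_nondecreasing (R : realType) (h h' : R -> R) :
  (forall t : R, 0 <= t -> is_derive t (1 : R) h (h' t)) ->
  (forall t : R, 0 <= t -> 0 <= h' t) ->
  forall s t : R, 0 <= s -> s <= t -> h s <= h t.
Proof.
move=> dh h'0 s t s0 st.
have [||c] := @MVT_segment R h h' s t st.
- move=> x; rewrite in_itv/= => /andP[sx _].
  by apply: dh; rewrite (le_trans s0)// ltW.
- apply: continuous_in_subspaceT => x; rewrite inE/= in_itv/= => /andP[sx _].
  by apply: is_derive_continuous; apply: dh; rewrite (le_trans s0).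
rewrite in_itv/= => /andP[sc ct] e.
by rewrite -subr_ge0 e mulr_ge0 ?subr_ge0// h'0// (le_trans s0).
Qed.

Lemma derive_dominated (R : realType) (f f' g g' : R -> R) :
  (forall t : R, 0 <= t -> is_derive t (1 : R) f (f' t)) ->
  (forall t : R, 0 <= t -> is_derive t (1 : R) g (g' t)) ->
  (forall t : R, 0 <= t -> `|f' t| <= g' t) ->
  forall s t : R, 0 <= s -> s <= t -> `|f t - f s| <= g t - g s.
Proof.
move=> df dg fg s t s0 st; rewrite ler_norml; apply/andP; split.
- suff : g s + f s <= g t + f t by lra.
  apply: (@derive_ge0_nondecreasing R (fun x => g x + f x)
    (fun x => g' x + f' x)) => //.
  + by move=> x x0; apply: is_deriveD; [exact: dg|exact: df].
  + by move=> x x0; have := fg _ x0; rewrite ler_norml => /andP[]; lra.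
- suff : g s - f s <= g t - f t by lra.
  apply: (@derive_ge0_nondecreasing R (fun x => g x - f x)
    (fun x => g' x - f' x)) => //.
  + by move=> x x0; apply: is_deriveB; [exact: dg|exact: df].
  + by move=> x x0; have := fg _ x0; rewrite ler_norml => /andP[]; lra.
Qed.

Lemma derive_eq0_cst (R : realType) (f : R -> R) :
  (forall t : R, 0 <= t -> is_derive t (1 : R) f 0) ->
  forall t : R, 0 <= t -> f t = f 0.
Proof.
move=> df t t0; apply/eqP; rewrite -subr_eq0 -normr_le0.
have dc (x : R) : is_derive x (1 : R) (fun=> (0 : R)) 0 by exact: is_derive_cst.
have := @derive_dominated R f (fun=> 0) (fun=> 0) (fun=> 0) df
  (fun x _ => dc x) _ 0 t (lexx _) t0.
by rewrite subrr; apply => x _; rewrite normr0.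
Qed.

Section Primitive.
Variable R : realType.
Notation mu := (@lebesgue_measure R).

(** The lower bound -1 makes 0 an interior point, so that the derivative at 0 is
    two-sided. *)
Definition primitive (f : R -> R) (t : R) : R :=
  (\int[mu]_(s in `[(-1)%R, t]) f s - \int[mu]_(s in `[(-1)%R, 0%R]) f s)%R.

Lemma primitive0 f : primitive f 0 = 0.
Proof. by rewrite /primitive subrr. Qed.

Lemma is_derive_primitive f : continuous f ->
  forall t : R, 0 <= t -> is_derive t (1 : R) (primitive f) (f t).
Proof.
move=> cf t t0.
have [] := @continuous_FTC1_closed R f (-1) t (t + 1) _ _ _ _.
- by rewrite ltrDl.
- apply: continuous_compact_integrable; first exact: segment_compact.
  exact: continuous_subspaceT.
- by rewrite (lt_le_trans _ t0)// ltrN10.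
- exact: cf.
move=> dF F'; rewrite -[f t]subr0.
apply: is_deriveB.
by split; [exact: dF|rewrite -derive1E F'].
Qed.

End Primitive.

(** The intervals [u n - 2 C / 2 ^ n, u n + 2 C / 2 ^ n] are nested. *)
Lemma geometric_limit (R : realType) (u : nat -> R) (C : R) :
  (forall n, `|u n.+1 - u n| <= C / 2 ^+ n) ->
  exists l, forall n, `|l - u n| <= 2 * C / 2 ^+ n.
Proof.
move=> uC.
have C0 : 0 <= C.
  by have := uC 0%N; rewrite expr0 divr1; apply: le_trans; exact: normr_ge0.
have h n : C / 2 ^+ n = 2 * C / 2 ^+ n.+1.
  by rewrite exprS invfM; field; rewrite expf_neq0.
pose v n := u n - 2 * C / 2 ^+ n.
pose w n := u n + 2 * C / 2 ^+ n.
have vS n : v n <= v n.+1.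
  by rewrite /v -h; have := uC n; rewrite ler_norml -!mulrA => /andP[]; lra.
have wS n : w n.+1 <= w n.
  by rewrite /w -h; have := uC n; rewrite ler_norml -!mulrA => /andP[]; lra.
have vm : {homo v : i j / (i <= j)%N >-> i <= j} by apply: homo_leq => //; exact: le_trans.
have wm : {homo w : i j / (i <= j)%N >-> j <= i}.
  by apply: homo_leq => // a b c ab bc; exact: le_trans bc ab.
have vw i j : v i <= w j.
  apply: (le_trans (vm _ _ (leq_maxl i j))).
  apply: le_trans (wm _ _ (leq_maxr i j)).
  have : 0 <= 2 * C / 2 ^+ maxn i j by rewrite divr_ge0 ?mulr_ge0 ?exprn_ge0.
  by rewrite /v /w; lra.
exists (sup (range v)) => n.
have H1 : v n <= sup (range v).
  apply: ub_le_sup; last by exists n.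
  by exists (w 0%N) => _ [i _ <-].
have H2 : sup (range v) <= w n.
  by apply: ge_sup; [by exists (v 0%N), 0%N|by move=> _ [i _ <-]].
by rewrite ler_norml; move: H1 H2; rewrite /v /w; lra.
Qed.

Lemma geometric_small (R : realType) (C e : R) : 0 < e ->
  exists n : nat, C / 2 ^+ n <= e.
Proof.
move=> e0; exists (Num.truncn (C / e)).+1.
rewrite ler_pdivrMr ?exprn_gt0// mulrC -ler_pdivrMr//.
apply: (@le_trans _ _ (Num.truncn (C / e)).+1%:R).
  by apply: ltW; exact: truncnS_gt.
by rewrite -natrX ler_nat ltnW// ltn_expl.
Qed.

Lemma geometric_eq0 (R : realType) (a C : R) :
  (forall n : nat, `|a| <= C / 2 ^+ n) -> a = 0.
Proof.
move=> H; apply/eqP; rewrite -normr_le0 leNgt; apply/negP => a0.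
have a20 : 0 < `|a| / 2 by rewrite divr_gt0.
have [n Hn] := geometric_small C a20.
by have := le_trans (H n) Hn; lra.
Qed.

Lemma cvg_sumr (R : realType) (I T : Type) (F : set_system T) (r : seq I)
    (P : pred I) (f : I -> T -> R) (l : I -> R) : Filter F ->
  (forall i, P i -> f i x @[x --> F] --> l i) ->
  \sum_(i <- r | P i) f i x @[x --> F] --> \sum_(i <- r | P i) l i.
Proof. by move=> FF fl; apply: cvg_big => //; exact: add_continuous. Qed.

(** * Linear differential equations *)

Section LinearODE.
Variables (R : realType) (m p : nat) (A : R -> 'M[R]_m) (X0 : 'M[R]_(m, p)).
Hypothesis cA : forall t : R, 0 <= t ->
  forall i j, {for t, continuous (fun s => A s i j)}.

(* Everything is evaluated at max(t, 0), because nothing is known about the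
   coefficients at negative times. *)
Let pos (t : R) : R := Num.max t 0.

Let pos_ge0 t : 0 <= pos t. Proof. by rewrite le_max lexx orbT. Qed.

Let posE (t : R) : 0 <= t -> pos t = t. Proof. by move=> t0; apply/max_idPl. Qed.

Let continuous_pos (f : R -> R) :
  (forall t : R, 0 <= t -> {for t, continuous f}) -> continuous (f \o pos).
Proof.
move=> cf t; apply: continuous_comp; last exact: cf.
by apply: continuous_max; [exact: cvg_id|exact: cvg_cst].
Qed.

Let A' (t : R) := A (pos t).

Let cA' i j : continuous (fun s => A' s i j).
Proof. by apply: (@continuous_pos (fun s => A s i j)) => t t0; exact: cA. Qed.

Let step (X : R -> 'M[R]_(m, p)) (t : R) : 'M[R]_(m, p) :=
  \matrix_(i, j)
    (X0 i j + primitive (fun s => (A' s *m X (pos s)) i j) t).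

Let cts (X : R -> 'M[R]_(m, p)) := forall t : R, 0 <= t ->
  forall i j, {for t, continuous (fun s => X s i j)}.

Let is_derive_step X : cts X -> forall t : R, 0 <= t -> forall i j,
  is_derive t (1 : R) (fun s => step X s i j) ((A t *m X t) i j).
Proof.
move=> cX t t0 i j.
have -> : (fun s => step X s i j) =
    (fun s => X0 i j + primitive (fun s => (A' s *m X (pos s)) i j) s).
  by apply/funext => s; rewrite mxE.
rewrite -[(A t *m X t) i j]add0r; apply: is_deriveD.
have -> : (A t *m X t) i j = (A' t *m X (pos t)) i j by rewrite /A' posE.
apply: (@is_derive_primitive R (fun s => (A' s *m X (pos s)) i j)) => // {t0}t.
have -> : (fun s => (A' s *m X (pos s)) i j) =
    (fun s => \sum_l A' s i l * X (pos s) l j).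
  by apply/funext => s; rewrite mxE.
apply: cvg_sumr => l _; apply: cvgM; first exact: cA'.
by apply: (@continuous_pos (fun s => X s l j)) => s s0; exact: cX.
Qed.

Let step0 X : step X 0 = X0.
Proof. by apply/matrixP => i j; rewrite mxE primitive0 addr0. Qed.

Let cts_step X : cts X -> cts (step X).
Proof.
move=> cX t t0 i j; apply: is_derive_continuous; exact: is_derive_step.
Qed.

Let picard n := iter n step (fun=> X0).

Let cts_picard n : cts (picard n).
Proof.
by elim: n => [t _ i j|n IH]; [exact: cvg_cst|exact: cts_step].
Qed.

Let b (t : R) := \sum_i \sum_j `|A' t i j|.

Let b_ge0 t : 0 <= b t.
Proof. by rewrite sumr_ge0// => i _; rewrite sumr_ge0. Qed.

Let cb : continuous b.
Proof.
move=> t; apply: cvg_sumr => i _; apply: cvg_sumr => j _.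
by apply: cvg_norm; exact: cA'.
Qed.

Let beta := primitive b.

Let is_derive_beta (t : R) : 0 <= t -> is_derive t (1 : R) beta (b t).
Proof. exact: is_derive_primitive. Qed.

Let beta_ge0 (t : R) : 0 <= t -> 0 <= beta t.
Proof.
move=> t0; rewrite -(primitive0 b).
by apply: (@derive_ge0_nondecreasing R beta b).
Qed.

Let w (t : R) := expR (2 * beta t).

Let w_ge0 t : 0 <= w t. Proof. exact: expR_ge0. Qed.

Let w_ge1 (t : R) : 0 <= t -> 1 <= w t.
Proof. by move=> t0; rewrite -expR0 ler_expR mulr_ge0// beta_ge0. Qed.

Let is_derive_w (c t : R) : 0 <= t ->
  is_derive t (1 : R) (fun s => c * w s) (b t * (2 * c) * w t).
Proof.
move=> t0; have := is_derive_beta t0 => db.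
apply: is_derive_eq; rewrite /= /w.
by rewrite -!mulrA /GRing.scale/=; ring.
Qed.

(** In the norm weighted by w^-1 the Picard step halves distances: (c w)' is 2 c w
    times beta', and beta' bounds the coefficients. *)
Let step_contracts X Y (c : R) : cts X -> cts Y ->
  (forall t : R, 0 <= t -> forall i j, `|Y t i j - X t i j| <= 2 * c * w t) ->
  forall t : R, 0 <= t -> forall i j, `|step Y t i j - step X t i j| <= c * w t.
Proof.
move=> cX cY XY t t0 i j.
have := @derive_dominated R (fun s => step Y s i j - step X s i j)
  (fun s => (A s *m Y s) i j - (A s *m X s) i j)
  (fun s => c * w s) (fun s => b s * (2 * c) * w s).
move=> /(_ _ _ _ 0 t (lexx 0) t0).
rewrite !step0 subrr subr0 => H.
have c0 : 0 <= c.
  have := le_trans (normr_ge0 _) (XY 0 (lexx _) i j).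
  by rewrite pmulr_lge0 ?pmulr_rge0// (lt_le_trans ltr01)// w_ge1.
apply: le_trans (H _ _ _) _.
- by move=> s s0; apply: is_deriveB; exact: is_derive_step.
- by move=> s s0; exact: is_derive_w.
- move=> s s0; have -> : (A s *m Y s) i j - (A s *m X s) i j =
     \sum_l A' s i l * (Y s l j - X s l j).
    by rewrite !mxE -sumrB /A' posE//; apply: eq_bigr => l _; rewrite mulrBr.
  apply: le_trans (ler_norm_sum _ _ _) _.
  rewrite -mulrA /b mulr_suml [leRHS](bigD1 i)//= -[leLHS]addr0.
  apply: lerD; last first.
    rewrite sumr_ge0// => l _; rewrite mulr_ge0 ?sumr_ge0//.
    by rewrite mulr_ge0 ?w_ge0// mulr_ge0.
  rewrite mulr_suml; apply: ler_sum => l _; rewrite normrM.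
  by rewrite ler_wpM2l// XY.
- by rewrite gerBl mulr_ge0 ?w_ge0.
Qed.

Let c0 : R := \sum_i \sum_j `|X0 i j|.

Let c0_ge0 : 0 <= c0.
Proof. by rewrite sumr_ge0// => i _; rewrite sumr_ge0. Qed.

Let c0_max i j : `|X0 i j| <= c0.
Proof.
rewrite /c0 (bigD1 i)//= (bigD1 j)//= -addrA lerDl addr_ge0 ?sumr_ge0//.
by move=> l _; rewrite sumr_ge0.
Qed.

Let zero_picard n (t : R) : 0 <= t -> forall i j,
  `|picard n.+1 t i j - picard n t i j| <= c0 * w t / 2 ^+ n.
Proof.
rewrite /picard; move=> t0 i j; rewrite mulrAC.
elim: n t t0 i j => [|n IH] t t0 i j.
- rewrite expr0 divr1.
  have cz : cts (fun=> 0) by move=> ? _ ? ?; exact: cvg_cst.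
  have := @step_contracts (fun=> 0) (fun=> X0) c0 cz _ _ t t0 i j.
  have -> : step (fun=> 0) t i j = X0 i j.
    rewrite mxE (_ : (fun _ => _) = fun=> 0); last first.
      by apply/funext => s; rewrite mulmx0 mxE.
    by rewrite /primitive /Rintegral !integral0 subrr addr0.
  apply; first by move=> ? _ ? ?; exact: cvg_cst.
  move=> s s0 i' j'; rewrite mxE subr0 (le_trans (c0_max i' j'))//.
  rewrite -[leLHS]mulr1 ler_pM//; last exact: w_ge1.
  by rewrite ler_peMl// ler1n.
- have := @step_contracts (picard n) (picard n.+1) (c0 / 2 ^+ n.+1)
    (@cts_picard n) (@cts_picard n.+1) _ t t0 i j.
  apply => {i j t0}t t0 i j; apply: le_trans (IH t t0 i j) _.
  rewrite le_eqVlt; apply/orP; left; apply/eqP; congr (_ * _).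
  by rewrite exprS invfM; field; rewrite expf_neq0.
Qed.

(** Picard iteration converges geometrically in the weighted norm
    sup_t |X t| e^(- 2 beta t), where beta' dominates the coefficients: no
    bound on the interval is needed. *)
Theorem linear_ode_exists : exists X : R -> 'M[R]_(m, p),
  [/\ X 0 = X0,
      forall t : R, 0 <= t -> forall i j,
        is_derive t (1 : R) (fun s => X s i j) ((A t *m X t) i j)
    & (forall t : R, 0 <= t -> forall i j, 0 <= A t i j) ->
      (forall i j, 0 <= X0 i j) ->
      forall t : R, 0 <= t -> forall i j, 0 <= X t i j].
Proof.
have lim_ex (tij : R * 'I_m * 'I_p) : exists l, 0 <= tij.1.1 -> forall n,
    `|l - picard n tij.1.1 tij.1.2 tij.2| <= 2 * (c0 * w tij.1.1) / 2 ^+ n.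
  case: tij => -[t i] j /=.
  have [t0|t0] := leP 0 t; last by exists 0.
  have [l Hl] := @geometric_limit R (fun n => picard n t i j) (c0 * w t)
    (fun n => zero_picard n t0 i j).
  by exists l.
have [l Hl] := choice lim_ex.
pose X t : 'M[R]_(m, p) := \matrix_(i, j) l (t, i, j).
have HX n (t : R) : 0 <= t -> forall i j,
    `|X t i j - picard n t i j| <= 2 * (c0 * w t) / 2 ^+ n.
  by move=> t0 i j; rewrite mxE; exact: (Hl (t, i, j)).
have cX : cts (fun t => X (pos t)).
  move=> t t0 i j; apply/cvgrPdist_le => /= e e0.
  have cw : {for t, continuous w}.
    apply: is_derive_continuous; have := is_derive_w 1 t0.
    by rewrite (_ : (fun s => 1 * w s) = w)//; apply/funext => s; rewrite mul1r.
  have [n Hn] := @geometric_small R (2 * (c0 * (w t + 1))) (e / 3)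
    (divr_gt0 e0 (ltr0n _ 3)).
  have w_near : \forall s \near t, w (pos s) < w t + 1.
    have cwp : {for t, continuous (w \o pos)}.
      apply: continuous_comp; last by rewrite posE.
      by apply: continuous_max; [exact: cvg_id|exact: cvg_cst].
    have := (@cvgr_lt _ _ _ _ _ _ cwp); rewrite /= posE//; apply.
    by rewrite ltrDl.
  have small (s : R) : 0 <= s -> w s <= w t + 1 -> forall i j,
      `|X s i j - picard n s i j| <= e / 3.
    move=> s0 ws i' j'; apply: le_trans (HX n s s0 i' j') _.
    apply: le_trans Hn; rewrite ler_wpM2r ?invr_ge0 ?exprn_ge0//.
    by rewrite ler_wpM2l// ler_wpM2l.
  near=> s.
  have S1 := small t t0 (ltW (ltr_pwDr ltr01 (lexx _))) i j.
  have S2 : `|X (pos s) i j - picard n (pos s) i j| <= e / 3.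
    by apply: small => //; apply: ltW; near: s; exact: w_near.
  have S3 : `|picard n t i j - picard n (pos s) i j| <= e / 3.
    near: s.
    have cpp : {for t, continuous ((fun s => picard n s i j) \o pos)}.
      by apply: continuous_pos => u u0; exact: cts_picard.
    have := (@cvgrPdist_le _ _ _ _ _ _ _).1 cpp (e / 3).
    by rewrite /= posE//; apply; rewrite divr_gt0.
  rewrite posE//.
  by move: S1 S2 S3; rewrite !ler_norml; lra.
pose Y := step (fun t => X (pos t)).
have YX (t : R) : 0 <= t -> Y t = X t.
  move=> t0; apply/matrixP => i j; apply/eqP; rewrite -subr_eq0; apply/eqP.
  apply: (@geometric_eq0 R _ (2 * (c0 * w t))) => n.
  have := @step_contracts (picard n) (fun t => X (pos t)) (c0 / 2 ^+ n)
    (@cts_picard n) cX _ t t0 i j.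
  move=> /(_ _)/le_trans H.
  have H1 : `|Y t i j - picard n.+1 t i j| <= c0 / 2 ^+ n * w t.
    apply: H => // s s0 i' j'; rewrite posE//.
    by apply: le_trans (HX n s s0 i' j') _; rewrite !mulrA mulrAC.
  have H2 := HX n.+1 t t0 i j.
  have E : 2 * (c0 * w t) / 2 ^+ n.+1 = c0 / 2 ^+ n * w t.
    by rewrite exprS invfM; field; rewrite expf_neq0.
  rewrite E in H2.
  have -> : 2 * (c0 * w t) / 2 ^+ n = c0 / 2 ^+ n * w t + c0 / 2 ^+ n * w t.
    by field; rewrite expf_neq0.
  by move: H1 H2; rewrite !ler_norml; lra.
exists Y; split.
- exact: step0.
- move=> t t0 i j; have := is_derive_step cX t0 i j.
  by rewrite posE// YX.
- move=> A0 X00 t t0 i j; rewrite YX//.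
  have P0 n (s : R) : 0 <= s -> forall i j, 0 <= picard n s i j.
    elim: n s => [|n IH] s s0 i' j'; first exact: X00.
    apply: le_trans (X00 i' j') _.
    rewrite -{1}(step0 (picard n)).
    have ds := is_derive_step (@cts_picard n).
    apply: (@derive_ge0_nondecreasing R (fun s => step (picard n) s i' j') _
      (fun u u0 => ds u u0 i' j')) => // u u0.
    by rewrite mxE sumr_ge0// => l' _; rewrite mulr_ge0 ?A0 ?IH.
  rewrite leNgt; apply/negP => X0'.
  have e0 : 0 < - X t i j / 2 by rewrite divr_gt0// oppr_gt0.
  have [n Hn] := @geometric_small R (2 * (c0 * w t)) _ e0.
  have := le_trans (HX n t t0 i j) Hn.
  have := P0 n t t0 i j.
  by rewrite ler_norml; lra.
Unshelve. all: by end_near. Qed.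

End LinearODE.

Lemma is_derive_sumr (R : realType) (n : nat) (f : 'I_n -> R -> R)
    (l : 'I_n -> R) (t : R) :
  (forall i, is_derive t (1 : R) (f i) (l i)) ->
  is_derive t (1 : R) (fun s => \sum_i f i s) (\sum_i l i).
Proof.
move=> fl; rewrite (_ : (fun s => _) = \sum_i f i); first exact: is_derive_sum.
by apply/funext => s; rewrite fct_sumE.
Qed.

Lemma is_derive_translate (R : realType) (f : R -> R) (c t l : R) :
  is_derive (t + c) (1 : R) f l -> is_derive t (1 : R) (fun s => f (s + c)) l.
Proof.
move=> df; have := @is_derive_shift R t 1 c => ds.
by have := @is_derive1_comp R f (shift c) t l 1 df ds; rewrite mulr1.
Qed.

(** The energy sum_i (X i j)^2 of a solution starting at the origin satisfies
    u' <= 2 K u, so e^(- 2 K t) u is nonincreasing. *)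
Lemma linear_ode_unique0 (R : realType) (m p : nat) (A : 'M[R]_m)
    (X : R -> 'M[R]_(m, p)) :
  (forall t : R, 0 <= t -> forall i j,
     is_derive t (1 : R) (fun s => X s i j) ((A *m X t) i j)) ->
  X 0 = 0 -> forall t : R, 0 <= t -> X t = 0.
Proof.
move=> dX X00 t t0; apply/matrixP => i j; rewrite mxE.
pose u s := \sum_l X s l j ^+ 2.
pose u' s := \sum_l 2 * X s l j * (A *m X s) l j.
pose K := \sum_l \sum_h `|A l h|.
have u_ge0 s : 0 <= u s by apply: sumr_ge0 => l _; exact: sqr_ge0.
have le_u s l : X s l j ^+ 2 <= u s.
  by rewrite /u (bigD1 l)//= lerDl sumr_ge0// => h _; exact: sqr_ge0.
have du (s : R) : 0 <= s -> is_derive s (1 : R) u (u' s).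
  move=> s0; apply: is_derive_sumr => l.
  have dl := dX s s0 l j.
  by apply: is_derive_eq; rewrite /= /GRing.scale/=; ring.
have u'K s : u' s <= 2 * K * u s.
  rewrite /u' -mulrA /K mulr_suml mulr_sumr.
  apply: ler_sum => l _; rewrite mxE -mulrA ler_wpM2l//.
  rewrite mulr_sumr mulr_suml; apply: ler_sum => h _.
  rewrite (le_trans (ler_norm _))// normrM normrM mulrCA ler_wpM2l//.
  have := le_u s l; have := le_u s h; rewrite -normrM ler_norml.
  have := sqr_ge0 (X s l j - X s h j); have := sqr_ge0 (X s l j + X s h j).
  by rewrite !expr2; nra.
have := @derive_ge0_nondecreasing R (fun s => - (expR (- (2 * K * s)) * u s))
  (fun s => expR (- (2 * K * s)) * (2 * K * u s - u' s)).
move=> /(_ _ _ 0 t (lexx 0) t0) H.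
suff : expR (- (2 * K * t)) * u t <= 0.
  rewrite pmulr_rle0 ?expR_gt0// => ut.
  apply/eqP; rewrite -[_ == 0](@sqrf_eq0 R) eq_le sqr_ge0 andbT.
  exact: le_trans (le_u t i) ut.
rewrite -[leRHS]oppr0 lerNr -[leLHS]oppr0.
have u0 : u 0 = 0 by rewrite /u X00 big1// => l _; rewrite mxE expr0n.
move: H; rewrite u0 mulr0; apply.
- move=> s s0; have := du s s0 => ds.
  by apply: is_derive_eq; rewrite /= /GRing.scale/=; ring.
- by move=> s s0; rewrite mulr_ge0 ?expR_ge0// subr_ge0.
Qed.

Lemma linear_ode_unique (R : realType) (m p : nat) (A : 'M[R]_m)
    (X Y : R -> 'M[R]_(m, p)) :
  (forall t : R, 0 <= t -> forall i j,
     is_derive t (1 : R) (fun s => X s i j) ((A *m X t) i j)) ->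
  (forall t : R, 0 <= t -> forall i j,
     is_derive t (1 : R) (fun s => Y s i j) ((A *m Y t) i j)) ->
  X 0 = Y 0 -> forall t : R, 0 <= t -> X t = Y t.
Proof.
move=> dX dY XY0 t t0; apply/eqP; rewrite -subr_eq0; apply/eqP.
apply: (@linear_ode_unique0 _ _ _ A (fun s => X s - Y s)) => //; last first.
  by rewrite XY0 subrr.
move=> s s0 i j; rewrite mulmxBr.
have -> : (fun s => (X s - Y s) i j) = (fun s => X s i j - Y s i j).
  by apply/funext => x; rewrite !mxE.
have -> : (A *m X s - A *m Y s) i j = (A *m X s) i j - (A *m Y s) i j.
  by rewrite mxE [(- (A *m Y s)) i j]mxE.
apply: is_deriveB; [exact: dX|exact: dY].
Qed.

(** * The consensus flow *)

Section Consensus.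
Variables (R : realType) (n : nat) (E : rel 'I_n) (a : 'I_n -> 'I_n -> R).
Hypothesis hE : quasi_strongly_connected E.
Hypothesis ha : forall i j : 'I_n, E i j -> 0 < a i j.

Let wt i j : R := if E i j then a i j else 0.

Let wt_ge0 i j : 0 <= wt i j.
Proof. by rewrite /wt; case: ifP => // /ha/ltW. Qed.

Definition laplacian_flow : 'M[R]_n :=
  \matrix_(i, j) (wt i j - (i == j)%:R * \sum_l wt i l).

Local Notation G := laplacian_flow.

Lemma laplacian_flowE p (X : 'M[R]_(n, p)) i j :
  (G *m X) i j = \sum_(l | E i l) a i l * (X l j - X i j).
Proof.
rewrite mxE [RHS]big_mkcond/=.
under eq_bigr do rewrite mxE mulrBl.
rewrite sumrB [X in _ - X](bigD1 i)//= eqxx mul1r [X in _ - (_ + X)]big1 ?addr0; last first.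
  by move=> l /negbTE li; rewrite eq_sym li mul0r mul0r.
rewrite mulr_suml -sumrB; apply: eq_bigr => l _; rewrite /wt.
by case: ifP => _; [rewrite mulrBr|rewrite !mul0r subrr].
Qed.

Let c := \sum_i \sum_j wt i j.
(* c exceeds every diagonal entry of - G *)
Let M : 'M[R]_n := G + c%:M.

Let M_ge0 i j : 0 <= M i j.
Proof.
have ci : \sum_l wt i l <= c.
  by rewrite /c [leRHS](bigD1 i)//= lerDl sumr_ge0// => l _; rewrite sumr_ge0.
rewrite !mxE; case: eqVneq => [<-|_]; last by rewrite mul0r subr0 addr0.
by rewrite mul1r mulr1n; have := wt_ge0 i i; move: ci; lra.
Qed.

Let M_edge i j : i != j -> M i j = wt i j.
Proof. by move=> /negbTE ij; rewrite !mxE ij mul0r subr0 addr0. Qed.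


(** The flow of the consensus equation is the rescaling by e^(- c t) of the
    flow of the nonnegative matrix M = G + c, which is nonnegative. *)
Lemma consensus_flow_exists : exists Phi : R -> 'M[R]_n,
  [/\ Phi 0 = 1%:M,
      forall t : R, 0 <= t -> forall i j,
        is_derive t (1 : R) (fun s => Phi s i j) ((G *m Phi t) i j),
      forall t : R, 0 <= t -> forall i j, 0 <= Phi t i j
    & exists r, forall t : R, 0 < t -> forall i, 0 < Phi t i r].
Proof.
have cM (t : R) : 0 <= t -> forall i j,
    {for t, continuous (fun s : R => (fun=> M) s i j)}.
  by move=> _ i j; exact: cvg_cst.
have [Psi [P0 dP Pge0]] := linear_ode_exists 1%:M cM.
have {}Pge0 : forall t : R, 0 <= t -> forall i j, 0 <= Psi t i j.
  apply: Pge0 => [t _ i j|i j]; first exact: M_ge0.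
  by rewrite mxE; case: (i == j).
have P'ge0 (t : R) : 0 <= t -> forall i j, 0 <= (M *m Psi t) i j.
  move=> t0 i j; rewrite mxE sumr_ge0// => l _.
  by rewrite mulr_ge0 ?M_ge0 ?Pge0.
exists (fun t => expR (- (c * t)) *: Psi t); split.
- by rewrite mulr0 oppr0 expR0 scale1r.
- move=> t t0 i j; have dt := dP t t0 i j.
  have -> : (fun s => (expR (- (c * s)) *: Psi s) i j) =
     (fun s => expR (- (c * s)) * Psi s i j).
    by apply/funext => s; rewrite mxE.
  apply: is_derive_eq; rewrite /= /GRing.scale/=.
  rewrite -scalemxAr [RHS]mxE /M mulmxDl mul_scalar_mx mxE [(c *: Psi t) i j]mxE.
  by ring.
- by move=> t t0 i j; rewrite mxE mulr_ge0 ?expR_ge0 ?Pge0.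
have [r hr] := hE; exists r => t t0 i.
rewrite mxE mulr_gt0 ?expR_gt0//.
have /connectP[p] := hr i.
elim: p i t t0 => [|j p IH] i t t0 /=.
  move=> _ ->; apply: (@lt_le_trans _ _ 1) => //.
  have := @derive_ge0_nondecreasing R (fun s => Psi s i i) _
    (fun s s0 => dP s s0 i i) (fun s s0 => P'ge0 s s0 i i) 0 t (lexx _) (ltW t0).
  by rewrite P0 mxE eqxx.
move=> /andP[Eij pj] rl; have {}IH s s0 := IH j s s0 pj rl.
have [<-|ij] := eqVneq j i; first exact: IH.
have t2 : 0 < t / 2 by rewrite divr_gt0.
have tt : t / 2 < t by rewrite ltr_pdivrMr// ltr_pMr// ltr1n.
have [||s] := @MVT R (fun s => Psi s i r) (fun s => (M *m Psi s) i r) (t / 2) t tt.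
- by move=> s; rewrite in_itv/= => /andP[ts _]; apply: dP; rewrite ltW// (lt_trans t2).
- apply: continuous_in_subspaceT => s; rewrite inE/= in_itv/= => /andP[ts _].
  by apply: is_derive_continuous; apply: dP; rewrite (le_trans (ltW t2)).
rewrite in_itv/= => /andP[ts _] e.
have s0 : 0 < s by exact: lt_trans ts.
rewrite -(subrK (Psi (t / 2) i r) (Psi t i r)) e ltr_wpDr ?Pge0 ?(ltW t2)//.
rewrite mulr_gt0 ?subr_gt0// mxE (bigD1 j)//= ltr_wpDr//.
  by rewrite sumr_ge0// => l _; rewrite mulr_ge0 ?M_ge0 ?Pge0 ?(ltW s0).
by rewrite mulr_gt0 ?IH// M_edge 1?eq_sym// /wt Eij ha.
Qed.

(** Since the column of Phi 1 at the root is at least delta, each unit of time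
    shrinks the interval spanned by the agents by the factor 1 - delta. *)
Theorem consensus_flow : exists (Phi : R -> 'M[R]_n) (q : 'I_n -> R),
  [/\ Phi 0 = 1%:M,
      forall t : R, 0 <= t -> forall i j,
        is_derive t (1 : R) (fun s => Phi s i j) ((G *m Phi t) i j),
      forall t : R, 0 <= t -> forall i j, 0 <= Phi t i j,
      forall t : R, 0 <= t -> forall i, \sum_j Phi t i j = 1
    & forall i j, Phi t i j @[t --> +oo] --> q j].
Proof.
have [Phi [P0 dP Pge0 [r Pr]]] := consensus_flow_exists.
have row1 (t : R) : 0 <= t -> forall i, \sum_j Phi t i j = 1.
  move=> t0 i.
  have := @linear_ode_unique R n 1 G (fun t => Phi t *m const_mx 1)
    (fun=> const_mx 1) _ _ _ t t0.
  have dPhi1 (s : R) : 0 <= s -> forall i (j : 'I_1), is_derive s (1 : R)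
      (fun s => (Phi s *m (const_mx 1 : 'cV_n)) i j)
      ((G *m (Phi s *m const_mx 1)) i j).
    move=> s0 i' j; rewrite mulmxA mxE.
    have -> : (fun s => (Phi s *m (const_mx 1 : 'cV_n)) i' j) =
              (fun s => \sum_l Phi s i' l).
      by apply/funext => x; rewrite mxE; apply: eq_bigr => l _; rewrite mxE mulr1.
    apply: is_derive_sumr => l; rewrite [const_mx 1 l j]mxE mulr1; exact: dP.
  move=> /(_ dPhi1) H.
  have := congr1 (fun N : 'cV_n => N i ord0) (H _ _).
  rewrite !mxE; under eq_bigr do rewrite mxE mulr1.
  apply; last by rewrite P0 mul1mx.
  move=> s s0 i' j; rewrite laplacian_flowE big1; last first.
    by move=> l _; rewrite !mxE subrr mulr0.
  have -> : (fun _ : R => (const_mx 1 : 'cV[R]_n) i' j) = fun=> 1.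
    by apply/funext => x; rewrite mxE.
  exact: is_derive_cst.
have semi (s t : R) : 0 <= s -> 0 <= t -> Phi (s + t) = Phi s *m Phi t.
  move=> s0 t0.
  apply: (@linear_ode_unique R n n G (fun s => Phi (s + t)) (fun s => Phi s *m Phi t)) => //.
  - move=> x x0 i j; apply: (@is_derive_translate R (fun s => Phi s i j)).
    by apply: dP; rewrite addr_ge0.
  - move=> x x0 i j; rewrite mulmxA mxE.
    have -> : (fun s => (Phi s *m Phi t) i j) =
              (fun s => \sum_l Phi s i l * Phi t l j).
      by apply/funext => y; rewrite mxE.
    apply: is_derive_sumr => l; have dl := dP x x0 i l.
    by apply: is_derive_eq; rewrite /= /GRing.scale/=; ring.
  - by rewrite P0 mul1mx add0r.
have hull (s t lo hi : R) j : 0 <= s -> 0 <= t ->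
    (forall i, lo <= Phi t i j <= hi) -> forall i, lo <= Phi (s + t) i j <= hi.
  move=> s0 t0 H i; rewrite semi// mxE -[lo]mul1r -[hi]mul1r -(row1 s s0 i).
  rewrite !mulr_suml; apply/andP; split; apply: ler_sum => l _;
    by apply: ler_wpM2l; rewrite ?Pge0//; case/andP: (H l).
have [dl dl0 dlP] : exists2 dl : R, 0 < dl & forall i, dl <= Phi 1 i r.
  exists (\big[Num.min/1]_i Phi 1 i r).
    by apply/bigmin_gtP; split => // i _; exact: Pr.
  by move=> i; exact: bigmin_le.
have dl1 : dl <= 1.
  rewrite (le_trans (dlP r))// -[leRHS](row1 1 ler01 r) (bigD1 r)//= lerDl sumr_ge0//.
  by move=> l _; exact: Pge0.
have shrink (mj : nat * 'I_n) : exists I : R * R, I.2 - I.1 <= (1 - dl) ^+ mj.1 /\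
    forall i, I.1 <= Phi mj.1%:R i mj.2 <= I.2.
  case: mj => m j /=; elim: m => [|m [[lo hi] /= [hl HI]]].
    exists (0, 1); split; first by rewrite subr0 expr0.
    by move=> i /=; rewrite P0 mxE; case: (i == j); rewrite ?lexx ?ler01.
  pose x := Phi m%:R r j.
  exists (lo + dl * (x - lo), hi - dl * (hi - x)); split => /=.
    rewrite exprS.
    have -> : hi - dl * (hi - x) - (lo + dl * (x - lo)) = (1 - dl) * (hi - lo).
      by ring.
    by rewrite ler_wpM2l// subr_ge0.
  move=> i; rewrite -natr1 [m%:R + 1]addrC semi// mxE.
  have centre b : (\sum_l Phi 1 i l * Phi m%:R l j) - b =
      \sum_l Phi 1 i l * (Phi m%:R l j - b).
    under [RHS]eq_bigr do rewrite mulrBr.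
    by rewrite sumrB -mulr_suml row1// mul1r.
  have Lo : dl * (x - lo) <= (\sum_l Phi 1 i l * Phi m%:R l j) - lo.
    rewrite centre (bigD1 r)//= -[leLHS]addr0 lerD//.
      by rewrite ler_wpM2r ?dlP// subr_ge0; case/andP: (HI r).
    rewrite sumr_ge0// => l _; rewrite mulr_ge0 ?Pge0// subr_ge0.
    by case/andP: (HI l).
  have Hi : dl * (hi - x) <= hi - (\sum_l Phi 1 i l * Phi m%:R l j).
    rewrite -[leRHS]opprB centre -sumrN (bigD1 r)//= -[leLHS]addr0 lerD//.
      rewrite -mulrN opprB ler_wpM2r ?dlP// subr_ge0.
      by case/andP: (HI r).
    rewrite sumr_ge0// => l _; rewrite -mulrN opprB mulr_ge0 ?Pge0// subr_ge0.
    by case/andP: (HI l).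
  by apply/andP; split; [move: Lo|move: Hi]; lra.
have [I HI] := choice shrink.
have inI (t : R) m j i : m%:R <= t -> (I (m, j)).1 <= Phi t i j <= (I (m, j)).2.
  move=> mt; rewrite -(subrK m%:R t); apply: hull => //; first by rewrite subr_ge0.
  by case: (HI (m, j)).
have crossI m m' j : (I (m, j)).1 <= (I (m', j)).2.
  have mM : m%:R <= (maxn m m')%:R :> R by rewrite ler_nat leq_maxl.
  have m'M : m'%:R <= (maxn m m')%:R :> R by rewrite ler_nat leq_maxr.
  have /andP[A _] := inI _ m j r mM; have /andP[_ B] := inI _ m' j r m'M.
  exact: le_trans A B.
pose q j := sup (range (fun m => (I (m, j)).1)).
have qI m j : (I (m, j)).1 <= q j <= (I (m, j)).2.
  apply/andP; split.
    apply: ub_le_sup; last by exists m.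
    by exists (I (0%N, j)).2 => _ [m' _ <-].
  by apply: ge_sup; [exists (I (0%N, j)).1, 0%N|move=> _ [m' _ <-]].
exists Phi, q; split => // i j.
apply/cvgrPdist_le => /= e e0.
have : (1 - dl) ^+ m @[m --> \oo] --> (0 : R).
  by apply: cvg_expr; rewrite ger0_norm ?subr_ge0// ltrBlDr ltrDl.
move=> /cvgrPdist_le/(_ e e0)[m _ /(_ m (leqnn m))] /=.
rewrite sub0r normrN ger0_norm ?exprn_ge0 ?subr_ge0// => me.
near=> t.
have mt : m%:R <= t by near: t; apply: nbhs_pinfty_ge; rewrite num_real.
have := inI t m j i mt; have := qI m j; have := (HI (m, j)).1; rewrite /=.
by move=> H1 /andP[H2 H3] /andP[H4 H5]; rewrite ler_norml; move: me; lra.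
Unshelve. all: by end_near. Qed.

End Consensus.

(** * QR factorization *)

Section TriangularFactors.
Variable R : realType.

Definition full_rank (d k : nat) (Z : 'M[R]_(d, k)) :=
  forall v : 'cV[R]_k, Z *m v = 0 -> v = 0.

Lemma upper_pos_unitmx (k : nat) (T : 'M[R]_k) : upper_pos T -> T \in unitmx.
Proof.
move=> [T0 Tp]; rewrite -unitmx_tr unitmxE det_trig; last first.
  by apply/is_trig_mxP => i j ij; rewrite mxE T0.
by rewrite unitfE prodf_seq_neq0; apply/allP => i _; rewrite /= mxE gt_eqF.
Qed.

Lemma full_rank_unitmx (k : nat) (T : 'M[R]_k) : full_rank T <-> T \in unitmx.
Proof.
split=> [fT|uT v]; last by move=> /(congr1 (mulmx (invmx T))); rewrite mulKmx// mulmx0.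
rewrite unitmxE unitfE -det_tr; apply/negP => /det0P[v v0 vT].
move/negP: v0; apply; apply/eqP; rewrite -[v]trmxK (fT (v^T)) ?trmx0//.
by rewrite -[T]trmxK -trmx_mul vT trmx0.
Qed.

Lemma full_rank_mul (d k l : nat) (Q : 'M[R]_(d, k)) (T : 'M[R]_(k, l)) :
  full_rank Q -> full_rank T -> full_rank (Q *m T).
Proof. by move=> fQ fT v; rewrite -mulmxA => /fQ /fT. Qed.

Lemma sqr_norm_eq0 (d : nat) (v : 'cV[R]_d) : v^T *m v = 0 -> v = 0.
Proof.
move=> /(congr1 (fun M : 'M[R]_(1, 1) => M 0 0)); rewrite !mxE => /eqP.
rewrite psumr_eq0 => [/allP H|i _]; last by rewrite mxE -expr2 sqr_ge0.
apply/matrixP => i j; rewrite ord1 mxE.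
by have := H i (mem_index_enum _); rewrite mxE -expr2 sqrf_eq0 => /eqP.
Qed.

(** v^T Z^T Z v = 0 forces Z v = 0. This turns full rank into the nonvanishing of a
    determinant, hence into an open condition. *)
Lemma gram_unitmx (d k : nat) (Z : 'M[R]_(d, k)) :
  full_rank Z <-> Z^T *m Z \in unitmx.
Proof.
split=> [fZ|/full_rank_unitmx fZ v Zv]; last by apply: fZ; rewrite -mulmxA Zv mulmx0.
apply/full_rank_unitmx => v ZZv; apply: fZ; apply: sqr_norm_eq0.
by rewrite trmx_mul -mulmxA (mulmxA (Z^T)) ZZv mulmx0.
Qed.

Lemma full_rank_orthonormal (d k : nat) (Q : 'M[R]_(d, k)) :
  Q^T *m Q = 1%:M -> full_rank Q.
Proof. by move=> QQ; apply/gram_unitmx; rewrite QQ unitmx1. Qed.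

(** Row i of T is determined by the rows above it: entry (i, j) of T^T T is
    T i i * T i j plus terms from these rows. *)
Lemma cholesky_unique (k : nat) (T T' : 'M[R]_k) :
  upper_pos T -> upper_pos T' -> T^T *m T = T'^T *m T' -> T = T'.
Proof.
move=> [T0 Tp] [T'0 T'p] TT; apply/matrixP => i; move: {2}i.+1 (ltnSn i) => m.
elim: m i => // m IH i im.
have E (S : 'M[R]_k) j : (forall i j : 'I_k, (j < i)%N -> S i j = 0) ->
    (S^T *m S) i j = S i i * S i j + \sum_(l : 'I_k | (l < i)%N) S l i * S l j.
  move=> S0; rewrite mxE (bigD1 i)//= mxE; congr (_ + _).
  rewrite big_mkcond [RHS]big_mkcond/=; apply: eq_bigr => l _.
  rewrite mxE -val_eqE/=; case: ltngtP => //= il.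
  by rewrite S0// mul0r.
have prod j : T i i * T i j = T' i i * T' i j.
  have := congr1 (fun M : 'M[R]_(k, k) => M i j) TT; rewrite !E//.
  rewrite (eq_bigr (fun l => T' l i * T' l j)) => [/addIr//|l li].
  by rewrite !IH// (leq_trans li).
have diag : T i i = T' i i.
  apply/eqP; rewrite -(@eqrXn2 _ 2) ?ltW//; first by rewrite !expr2 prod.
by move=> j; have := prod j; rewrite diag => /mulfI; apply; rewrite gt_eqF.
Qed.

Lemma qr_unique (d k : nat) (Q Q' : 'M[R]_(d, k)) (T T' : 'M[R]_k) :
  Q^T *m Q = 1%:M -> Q'^T *m Q' = 1%:M -> upper_pos T -> upper_pos T' ->
  Q *m T = Q' *m T' -> Q = Q' /\ T = T'.
Proof.
move=> QQ QQ' uT uT' e.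
have gram (P : 'M[R]_(d, k)) (S : 'M[R]_k) :
    P^T *m P = 1%:M -> (P *m S)^T *m (P *m S) = S^T *m S.
  by move=> PP; rewrite trmx_mul mulmxA -(mulmxA _ (P^T)) PP mulmx1.
have TT : T = T'.
  by apply: cholesky_unique => //; rewrite -(gram _ _ QQ) e gram.
split=> //; move: e; rewrite TT => /(congr1 (mulmx^~ (invmx T'))).
by rewrite !mulmxK// upper_pos_unitmx.
Qed.

Section GramSchmidt.
Variables (X : Type) (D : set X) (P : (X -> R) -> Prop).
Hypothesis Pcst : forall c, P (fun=> c).
Hypothesis PD : forall f g, P f -> P g -> P (fun x => f x + g x).
Hypothesis PM : forall f g, P f -> P g -> P (fun x => f x * g x).
Hypothesis Pnormalize : forall f g, P f -> P g -> (forall x, D x -> 0 < g x) ->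
  P (fun x => f x / Num.sqrt (g x)).

Let Pmx (p q : nat) (Z : X -> 'M[R]_(p, q)) := forall i j, P (fun x => Z x i j).

Let Pext f g : P f -> f =1 g -> P g.
Proof. by move=> Pf /funext <-. Qed.

Let Psum (I : finType) (f : I -> X -> R) :
  (forall i, P (f i)) -> P (fun x => \sum_i f i x).
Proof.
move=> Pf; elim: index_enum => [|i s IH].
  by under eq_fun do rewrite big_nil.
by under eq_fun do rewrite big_cons; apply: PD.
Qed.

Let Pmul p q r (Y : X -> 'M[R]_(p, q)) (Z : X -> 'M[R]_(q, r)) :
  Pmx Y -> Pmx Z -> Pmx (fun x => Y x *m Z x).
Proof.
by move=> PY PZ i j; under eq_fun do rewrite mxE; apply: Psum => l; apply: PM.
Qed.

Let Ptr p q (Z : X -> 'M[R]_(p, q)) : Pmx Z -> Pmx (fun x => (Z x)^T).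
Proof. by move=> PZ i j; under eq_fun do rewrite mxE; apply: PZ. Qed.

(** The factors inherit every regularity property P that is stable under the
    operations of the algorithm: sums, products and division by the norm of a
    nonzero vector. *)
Lemma gram_schmidt (d k : nat) (Z : X -> 'M[R]_(d, k)) :
  (forall i j, P (fun x => Z x i j)) -> (forall x, D x -> full_rank (Z x)) ->
  exists (Q : X -> 'M[R]_(d, k)) (T : X -> 'M[R]_k),
    [/\ forall i j, P (fun x => Q x i j), forall i j, P (fun x => T x i j)
      & forall x, D x ->
          [/\ Z x = Q x *m T x, (Q x)^T *m Q x = 1%:M & upper_pos (T x)]].
Proof.
elim: k Z => [|k IH] Z PZ fZ.
  exists Z, (fun=> 0); split=> [//|i j|x _]; first by case: i.
  split; last by split=> -[].
    by apply/matrixP => i [].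
  by apply/matrixP => -[].
pose z x : 'cV[R]_d := lsubmx (Z x : 'M[R]_(d, 1 + k)).
pose Y x : 'M[R]_(d, k) := rsubmx (Z x : 'M[R]_(d, 1 + k)).
have ZE x : Z x = row_mx (z x) (Y x) by rewrite hsubmxK.
have fZ' x : D x -> @full_rank d (1 + k) (row_mx (z x) (Y x)).
  by move=> Dx; have := fZ x Dx; rewrite ZE.
have Pz : Pmx z by move=> i j; under eq_fun do rewrite mxE; apply: PZ.
have PY : Pmx Y by move=> i j; under eq_fun do rewrite mxE; apply: PZ.
pose nn x := ((z x)^T *m z x) 0 0.
have Pnn : P nn by apply: Pmul => //; exact: Ptr.
have nnp x : D x -> 0 < nn x.
  move=> Dx; rewrite lt_def; apply/andP; split; last first.
    by rewrite /nn mxE sumr_ge0// => i _; rewrite mxE -expr2 sqr_ge0.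
  apply/eqP => nn0; have /sqr_norm_eq0 z0 : (z x)^T *m z x = 0.
    by apply/matrixP => i j; rewrite !ord1 [RHS]mxE.
  have := fZ' x Dx (col_mx 1%:M 0).
  rewrite mul_row_col mulmx1 mulmx0 addr0 => /(_ z0).
  move=> /(congr1 (fun v : 'cV[R]_(1 + k) => v (lshift k 0) 0)).
  by rewrite col_mxEu !mxE => /eqP; rewrite oner_eq0.
pose nz x := Num.sqrt (nn x).
have nzp x : D x -> 0 < nz x by move=> Dx; rewrite sqrtr_gt0 nnp.
pose q x : 'cV[R]_d := (nz x)^-1 *: z x.
have Pq : Pmx q.
  move=> i j; under eq_fun do rewrite mxE mulrC.
  exact: Pnormalize.
have qq x : D x -> (q x)^T *m q x = 1%:M.
  move=> Dx; rewrite [q x]/q linearZ/= [in LHS]linearZ/= -scalemxAl scalerA.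
  apply/matrixP => i j; rewrite !ord1 mxE -/(nn x) -invfM -expr2 sqr_sqrtr ?ltW ?nnp//.
  by rewrite mulVf ?mxE// gt_eqF// nnp.
have zE x : D x -> z x = q x *m (nz x)%:M.
  move=> Dx; rewrite /q mul_mx_scalar scalerA divff ?scale1r// gt_eqF//.
  exact: nzp.
pose W x := Y x - q x *m ((q x)^T *m Y x).
have PqY : Pmx (fun x => (q x)^T *m Y x) by apply: Pmul => //; exact: Ptr.
have PW : Pmx W.
  move=> i j; rewrite (_ : (fun x => W x i j) =
    fun x => Y x i j + (-1) * (q x *m ((q x)^T *m Y x)) i j).
    by apply: PD => //; apply: PM => //; apply: Pmul.
  by apply/funext => x; rewrite mulN1r /W mxE [X in _ + X]mxE.
have fW x : D x -> full_rank (W x).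
  move=> Dx v Wv; pose c := (q x)^T *m Y x *m v.
  have YE : Y x *m v = q x *m c.
    apply/eqP; rewrite -subr_eq0 -Wv /W mulmxBl /c !mulmxA; exact/eqP.
  have := fZ' x Dx (col_mx (- ((nz x)^-1 *: c)) v).
  rewrite mul_row_col zE// -mulmxA YE -mulmxDr mul_scalar_mx scalerN scalerA.
  rewrite divff ?gt_eqF ?nzp// scale1r addNr mulmx0 => /(_ erefl).
  by move=> /(congr1 (fun w : 'cV_(1 + k) => dsubmx w)); rewrite col_mxKd linear0.
have qW x : D x -> (q x)^T *m W x = 0.
  by move=> Dx; rewrite /W mulmxBr [(q x)^T *m (q x *m _)]mulmxA qq// mul1mx subrr.
have [Q [T [PQ PT QT]]] := IH W PW fW.
exists (fun x => row_mx (q x) (Q x)).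
exists (fun x => block_mx (nz x)%:M ((q x)^T *m Y x) 0 (T x)).
split.
- move=> i j; case: (split_ordP (j : 'I_(1 + k))) => [j' ->|j' ->].
    by apply: (Pext (Pq i j')) => x; exact/esym/row_mxEl.
  by apply: (Pext (PQ i j')) => x; exact/esym/row_mxEr.
- move=> i j; case: (split_ordP (i : 'I_(1 + k))) => [i' ->|i' ->];
    case: (split_ordP (j : 'I_(1 + k))) => [j' ->|j' ->].
  + apply: (@Pext (fun x => nn x / Num.sqrt (nn x))); first exact: Pnormalize.
    move=> x; transitivity (nz x); last first.
      by apply/esym; apply: etrans (block_mxEul _ _ _ _ _ _) _; rewrite !ord1 mxE.
    rewrite /nz; have [n0|n0] := leP (nn x) 0.
      by rewrite ler0_sqrtr// invr0 mulr0.
    by rewrite -{1}(sqr_sqrtr (ltW n0)) expr2 mulfK// gt_eqF// sqrtr_gt0.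
  + by apply: (Pext (PqY i' j')) => x; exact/esym/block_mxEur.
  + apply: (Pext (Pcst 0)) => x; apply/esym.
    by apply: etrans (block_mxEdl _ _ _ _ _ _) _; rewrite mxE.
  + by apply: (Pext (PT i' j')) => x; exact/esym/block_mxEdr.
move=> x Dx; have [WE QQ [T0 Tp]] := QT x Dx.
have qQ : (q x)^T *m Q x = 0.
  have := qW x Dx; rewrite WE mulmxA => /(congr1 (mulmx^~ (invmx (T x)))).
  by rewrite mul0mx mulmxK// upper_pos_unitmx.
split.
- have E : row_mx (z x) (Y x) = row_mx (q x) (Q x) *m
      block_mx (nz x)%:M ((q x)^T *m Y x) 0 (T x).
    rewrite mul_row_block mulmx0 addr0 -zE//; congr row_mx.
    by rewrite -WE /W addrC subrK.
  exact: etrans (ZE x) E.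
- have E : (row_mx (q x) (Q x))^T *m row_mx (q x) (Q x) = 1%:M.
    rewrite tr_row_mx mul_col_row qq// QQ qQ -[(Q x)^T *m q x]trmxK.
    by rewrite trmx_mul trmxK qQ trmx0 -scalar_mx_block.
  exact: E.
- split=> i.
    move=> j; case: (split_ordP (i : 'I_(1 + k))) => [i' ->|i' ->];
      case: (split_ordP (j : 'I_(1 + k))) => [j' ->|j' ->] /=.
    + by rewrite !ord1.
    + by rewrite ord1 /=.
    + by move=> _; apply: etrans (block_mxEdl _ _ _ _ _ _) _; rewrite mxE.
    + rewrite !add1n ltnS => /T0 <-; exact: block_mxEdr.
  case: (split_ordP (i : 'I_(1 + k))) => [i' ->|i' ->].
    have -> : block_mx (nz x)%:M ((q x)^T *m Y x) 0 (T x) (lshift k i') (lshift k i') = nz x.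
      by rewrite block_mxEul !ord1 mxE.
    exact: nzp.
  by have := Tp i'; rewrite -(block_mxEdr (nz x)%:M ((q x)^T *m Y x) 0 (T x)).
Qed.

End GramSchmidt.

End TriangularFactors.

(** * Completing orthonormal columns to a rotation *)

Section Rotations.
Variables (R : realType) (d k : nat).
Hypothesis kd : (k < d)%N.

Local Notation I := (Itop R d k).

Lemma tr_Itop_mul : I^T *m I = 1%:M.
Proof.
by rewrite tr_pid_mx mul_pid_mx minnn (minn_idPr (ltnW kd)) pid_mx_1.
Qed.

Lemma mul_Itop (p : nat) (M : 'M[R]_(p, d)) i j :
  (M *m I) i j = M i (widen_ord (ltnW kd) j).
Proof.
rewrite mxE (bigD1 (widen_ord (ltnW kd) j))//= [X in _ + X]big1 ?addr0.
  by rewrite mxE/= eqxx ltn_ord mulr1.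
move=> l lj; rewrite mxE; case: eqP => [e|_]; last by rewrite mulr0.
by move: lj; rewrite -val_eqE/= e eqxx.
Qed.

Lemma tr_Itop_mulE (p : nat) (M : 'M[R]_(d, p)) i j :
  (I^T *m M) i j = M (widen_ord (ltnW kd) i) j.
Proof. by rewrite -[I^T *m M]trmxK trmx_mul trmxK mxE mul_Itop mxE. Qed.

Lemma Itop_mulE (p : nat) (M : 'M[R]_(k, p)) i j :
  (I *m M) (widen_ord (ltnW kd) i) j = M i j.
Proof. by rewrite -tr_Itop_mulE mulmxA tr_Itop_mul mul1mx. Qed.

Lemma Itop_mul0 (p : nat) (M : 'M[R]_(k, p)) (i : 'I_d) j :
  (k <= i)%N -> (I *m M) i j = 0.
Proof.
move=> ki; rewrite mxE big1// => l _; rewrite mxE ltnNge ki andbF.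
by rewrite mul0r.
Qed.

(* the identity with its last diagonal entry negated *)
Let flip : 'M[R]_d := diag_mx (\row_j (-1) ^+ (j.+1 == d)).

Let flip_sqr : flip^T *m flip = 1%:M.
Proof.
rewrite tr_diag_mx mulmx_diag -[1%:M]/(1%:M) -diag_const_mx; congr diag_mx.
by apply/rowP => j; rewrite !mxE -expr2 sqrr_sign.
Qed.

Let flip_Itop : flip *m I = I.
Proof.
apply/matrixP => i j; rewrite mul_diag_mx !mxE.
have [->|_] := eqVneq (val i) (val j); last by rewrite mulr0.
by rewrite (ltn_eqF (leq_ltn_trans (ltn_ord j) kd)) mul1r.
Qed.

Let det_flip : \det flip = -1.
Proof.
rewrite det_diag; have dp : (d.-1 < d)%N by rewrite prednK// (leq_ltn_trans _ kd).
rewrite (bigD1 (Ordinal dp))//= mxE/= prednK ?(leq_ltn_trans _ kd)// eqxx expr1.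
rewrite big1 ?mulr1// => i id; rewrite mxE.
case: eqP => //= e; move: id; rewrite -val_eqE/=; case/eqP.
exact: (congr1 predn e).
Qed.

(** The last column does not belong to the first k, so its sign adjusts the
    determinant. *)
Lemma SO_orthogonal (Q : 'M[R]_d) : Q^T *m Q = 1%:M ->
  exists2 Q', SO Q' & Q' *m I = Q *m I.
Proof.
move=> QQ; have : \det Q ^+ 2 = 1.
  by rewrite expr2 -{1}det_tr -det_mulmx QQ det1.
move=> /eqP; rewrite sqrf_eq1 => /orP[] /eqP dQ; first by exists Q.
exists (Q *m flip); last by rewrite -mulmxA flip_Itop.
split; last by rewrite det_mulmx dQ det_flip mulrNN mulr1.
by rewrite trmx_mul mulmxA -(mulmxA _ (Q^T)) QQ mulmx1 flip_sqr.
Qed.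

Lemma orthonormal_SO (Q : 'M[R]_d) : SO Q -> (Q *m I)^T *m (Q *m I) = 1%:M.
Proof.
move=> [QQ _].
by rewrite trmx_mul mulmxA -(mulmxA _ (Q^T)) QQ mulmx1 tr_Itop_mul.
Qed.

Lemma qr_exists (p q : nat) (Z : 'M[R]_(p, q)) : full_rank Z ->
  exists (Q : 'M[R]_(p, q)) (T : 'M[R]_q),
    [/\ Z = Q *m T, Q^T *m Q = 1%:M & upper_pos T].
Proof.
move=> fZ.
have [||||||Q [T [_ _ /(_ tt Logic.I)]]] := @gram_schmidt R unit setT (fun=> True) _ _ _ _
  p q (fun=> Z) _ _ => //.
by exists (Q tt), (T tt).
Qed.

(** Some invertible matrix has these first k columns; the orthogonal factor of
    its factorization keeps them, since they are already orthonormal, and the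
    sign of its last column, which is not among them, is free. *)
Lemma orthonormal_completion (Q : 'M[R]_(d, k)) : Q^T *m Q = 1%:M ->
  exists2 Q', SO Q' & Q' *m I = Q.
Proof.
move=> QQ.
have rk : \rank (Q^T) = k.
  by apply/eqP; apply/row_freeP; exists Q.
pose C := (col_ebase (Q^T))^T.
have uC : C \in unitmx by rewrite unitmx_tr col_ebase_unit.
pose N := (row_ebase (Q^T))^T.
have uN : N \in unitmx by rewrite unitmx_tr row_ebase_unit.
have QE : Q = N *m I *m C.
  rewrite -[Q]trmxK -[in LHS](mulmx_ebase (Q^T)) rk !trmx_mul tr_pid_mx.
  by rewrite mulmxA.
pose B (S : 'M[R]_k) := I *m S *m I^T + (1%:M - I *m I^T).
have BI S : B S *m I = I *m S.
  by rewrite mulmxDl mulmxBl mul1mx -!mulmxA tr_Itop_mul !mulmx1 subrr addr0.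
have uB : B C \in unitmx.
  have : B C *m B (invmx C) = 1%:M.
    rewrite {2}/B mulmxDr mulmxBr mulmx1 !mulmxA BI -(mulmxA I C) mulmxV// mulmx1.
    by rewrite /B [X in _ + (X - _)]addrC addrK addrC subrK.
  by case/mulmx1_unit.
have fM : full_rank (N *m B C).
  by apply: full_rank_mul; apply/full_rank_unitmx.
have [Q1 [T [ME Q1Q1 [T0 Tp]]]] := qr_exists fM.
have TI : T *m I = I *m (I^T *m T *m I).
  apply/matrixP => i j.
  have [ik|ki] := ltnP i k.
    have -> : i = widen_ord (ltnW kd) (Ordinal ik) by exact/val_inj.
    by rewrite Itop_mulE -mulmxA tr_Itop_mulE.
  by rewrite Itop_mul0// mul_Itop T0//= (leq_trans _ ki).
have [Q2 SQ2 Q2I] := SO_orthogonal Q1Q1; exists Q2 => //.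
rewrite Q2I.
have [||||//] := @qr_unique R d k (Q1 *m I) Q (I^T *m T *m I) 1%:M _ QQ.
- by rewrite trmx_mul mulmxA -(mulmxA _ (Q1^T)) Q1Q1 mulmx1 tr_Itop_mul.
- split=> [i j ji|i]; last by rewrite -mulmxA tr_Itop_mulE mul_Itop.
  by rewrite -mulmxA tr_Itop_mulE mul_Itop T0.
- split=> [i j ji|i]; last by rewrite mxE eqxx.
  by rewrite mxE -val_eqE/= gtn_eqF.
- by rewrite -mulmxA -TI mulmxA -ME -mulmxA BI mulmx1 mulmxA -QE.
Qed.

End Rotations.

(** * Lipschitz dependence of the QR factors *)

Lemma le_mx_norm (R : realType) (p q : nat) (M : 'M[R]_(p, q)) i j :
  `|M i j| <= `|M|.
Proof.
rewrite [leRHS]/Num.Def.normr/= mx_normrE.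
exact: (le_bigmax _ (fun ij : 'I_p * 'I_q => `|M ij.1 ij.2|) (i, j)).
Qed.

Lemma mx_norm_le (R : realType) (p q : nat) (M : 'M[R]_(p, q)) (c : R) :
  0 <= c -> (forall i j, `|M i j| <= c) -> `|M| <= c.
Proof.
move=> c0 H; rewrite [leLHS]/Num.Def.normr/= mx_normrE.
by apply: bigmax_le => // i _.
Qed.

Section LocallyLipschitz.
Variables (R : realType) (V : normedModType R) (x0 : V).

Definition loc_lipschitz (f : V -> R) := exists C r : R, [/\ 0 <= C, 0 < r &
  forall x y, `|x - x0| < r -> `|y - x0| < r -> `|f x - f y| <= C * `|x - y|].

Lemma loc_lipschitz_cst c : loc_lipschitz (fun=> c).
Proof. by exists 0, 1; split=> // x y _ _; rewrite subrr normr0 mul0r. Qed.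

Lemma loc_lipschitzD f g : loc_lipschitz f -> loc_lipschitz g ->
  loc_lipschitz (fun x => f x + g x).
Proof.
move=> [C [r [C0 r0 Hf]]] [C' [r' [C'0 r'0 Hg]]].
exists (C + C'), (Num.min r r'); split; rewrite ?addr_ge0 ?lt_min ?r0//.
move=> x y; rewrite !lt_min => /andP[xr xr'] /andP[yr yr'].
rewrite opprD addrACA mulrDl (le_trans (ler_normD _ _))// lerD ?Hf ?Hg//.
Qed.

Lemma loc_lipschitz_bounded f : loc_lipschitz f -> forall e : R, 0 < e ->
  exists r : R, [/\ 0 < r & forall x, `|x - x0| < r -> `|f x - f x0| <= e].
Proof.
move=> [C [r [C0 r0 Hf]]] e e0.
have C1 : 0 < C + 1 by rewrite ltr_wpDl.
exists (Num.min r (e / (C + 1))); split; first by rewrite lt_min r0 divr_gt0.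
move=> x; rewrite lt_min => /andP[xr xe].
apply: le_trans (Hf x x0 xr _) _; first by rewrite subrr normr0.
move: xe; rewrite ltr_pdivlMr// => xe.
by have := normr_ge0 (x - x0); nra.
Qed.

Lemma loc_lipschitzM f g : loc_lipschitz f -> loc_lipschitz g ->
  loc_lipschitz (fun x => f x * g x).
Proof.
move=> Lf Lg.
have [rf [rf0 Bf]] := loc_lipschitz_bounded Lf ltr01.
have [rg [rg0 Bg]] := loc_lipschitz_bounded Lg ltr01.
move: Lf Lg => [C [r [C0 r0 Hf]]] [C' [r' [C'0 r'0 Hg]]].
exists (C * (`|g x0| + 1) + (`|f x0| + 1) * C').
exists (Num.min (Num.min r r') (Num.min rf rg)); split.
- by rewrite addr_ge0// mulr_ge0// addr_ge0.
- by rewrite !lt_min r0 r'0 rf0.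
move=> x y; rewrite !lt_min => /andP[/andP[xr xr'] /andP[xf xg]].
move=> /andP[/andP[yr yr'] /andP[yf yg]].
have nb (a b : R) : `|a - b| <= 1 -> `|a| <= `|b| + 1.
  by move=> ab; rewrite -{1}(subrK b a) (le_trans (ler_normD _ _))// addrC lerD2l.
have -> : f x * g x - f y * g y = (f x - f y) * g x + f y * (g x - g y) by ring.
rewrite [leRHS]mulrDl (le_trans (ler_normD _ _))// !normrM lerD//.
  rewrite mulrAC ler_pM//; first exact: Hf.
  exact/nb/Bg.
by rewrite -mulrA ler_pM//; [exact/nb/Bf|exact: Hg].
Qed.

Lemma sqrtr_inv_lipschitz (m u v : R) : 0 < m -> m <= u -> m <= v ->
  `|(Num.sqrt u)^-1 - (Num.sqrt v)^-1| <= (m * Num.sqrt m)^-1 * `|u - v|.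
Proof.
move=> m0 mu mv.
have sm : 0 < Num.sqrt m by rewrite sqrtr_gt0.
have su : Num.sqrt m <= Num.sqrt u by rewrite ler_wsqrtr.
have sv : Num.sqrt m <= Num.sqrt v by rewrite ler_wsqrtr.
have u0 : 0 < Num.sqrt u by exact: lt_le_trans su.
have v0 : 0 < Num.sqrt v by exact: lt_le_trans sv.
have uE := sqr_sqrtr (ltW (lt_le_trans m0 mu)).
have vE := sqr_sqrtr (ltW (lt_le_trans m0 mv)).
have mE := sqr_sqrtr (ltW m0).
move: uE vE mE sm su sv u0 v0.
set x := Num.sqrt u; set y := Num.sqrt v; set z := Num.sqrt m.
move=> <- <- <- z0 zx zy xp yp.
have -> : x^-1 - y^-1 = - ((x * y)^-1 * (x - y)) by field; rewrite !gt_eqF.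
rewrite subr_sqr normrN !normrM [leLHS]mulrC [leRHS]mulrCA ler_wpM2l//.
rewrite (gtr0_norm (addr_gt0 xp yp)) normfV (gtr0_norm (mulr_gt0 xp yp)).
rewrite [leRHS]mulrC ler_pdivlMr ?mulr_gt0 ?exprn_gt0// [leLHS]mulrC ler_pdivrMr ?mulr_gt0//.
have zz : z * z <= x * y by rewrite ler_pM// ltW.
have zxy : z <= x + y by rewrite -[z]addr0 lerD// ltW.
by rewrite expr2 mulrC ler_pM// ?mulr_ge0// ltW.
Qed.

(** Near x0 the function g stays above g x0 / 2, where the inverse square root is
    Lipschitz. *)
Lemma loc_lipschitz_normalize f g : loc_lipschitz f -> loc_lipschitz g ->
  0 < g x0 -> loc_lipschitz (fun x => f x / Num.sqrt (g x)).
Proof.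
move=> Lf Lg g0; apply: loc_lipschitzM => //.
have g2 : 0 < g x0 / 2 by rewrite divr_gt0.
have [rg [rg0 Bg]] := loc_lipschitz_bounded Lg g2.
move: Lg => [C [r [C0 r0 Hg]]].
exists ((g x0 / 2 * Num.sqrt (g x0 / 2))^-1 * C), (Num.min r rg); split.
- by rewrite mulr_ge0// invr_ge0 mulr_ge0 ?sqrtr_ge0// ltW.
- by rewrite lt_min r0.
move=> x y; rewrite !lt_min => /andP[xr xg] /andP[yr yg].
have low z : `|z - x0| < rg -> g x0 / 2 <= g z.
  by move=> /Bg; rewrite ler_norml => /andP[+ _]; lra.
apply: le_trans (sqrtr_inv_lipschitz g2 (low x xg) (low y yg)) _.
rewrite -[leRHS]mulrA ler_wpM2l ?Hg// invr_ge0 mulr_ge0 ?sqrtr_ge0// ltW//.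
Qed.

End LocallyLipschitz.

Section QRContinuity.
Variables (R : realType) (d k : nat).

Definition is_qr (Z Q : 'M[R]_(d, k)) (T : 'M[R]_k) :=
  [/\ Z = Q *m T, Q^T *m Q = 1%:M & upper_pos T].

Lemma is_qr_unique Z Q T Q' T' : is_qr Z Q T -> is_qr Z Q' T' ->
  Q = Q' /\ T = T'.
Proof. by move=> [e QQ uT] [e' QQ' uT']; apply: qr_unique => //; rewrite -e. Qed.

Lemma is_qr_full_rank Z Q T : is_qr Z Q T -> full_rank Z.
Proof.
move=> [-> QQ uT]; apply: full_rank_mul; first exact: full_rank_orthonormal.
by apply/full_rank_unitmx; exact: upper_pos_unitmx.
Qed.

Lemma coord_loc_lipschitz p q (M : 'M[R]_(p, q)) i j :
  loc_lipschitz M (fun N : 'M[R]_(p, q) => N i j).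
Proof.
exists 1, 1; split=> // x y _ _; rewrite mul1r.
by have := le_mx_norm (x - y) i j; rewrite !mxE.
Qed.

(** Gram-Schmidt in the class of functions of Z that are Lipschitz near Z0. Being
    unique, any factors agree with the ones it computes. *)
Lemma qr_lipschitz (Z0 : 'M[R]_(d, k)) : full_rank Z0 ->
  exists C r : R, [/\ 0 <= C, 0 < r & forall Z Z' Q T Q' T',
    is_qr Z Q T -> is_qr Z' Q' T' -> `|Z - Z0| < r -> `|Z' - Z0| < r ->
    `|Q - Q'| <= C * `|Z - Z'| /\ `|T - T'| <= C * `|Z - Z'|].
Proof.
move=> f0.
have [||||||Q [T [LQ LT QT]]] := @gram_schmidt R 'M[R]_(d, k)
  [set Z | full_rank Z] (loc_lipschitz Z0) _ _ _ _ d k id _ _.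
- exact: loc_lipschitz_cst.
- exact: loc_lipschitzD.
- exact: loc_lipschitzM.
- by move=> f g Lf Lg fg; apply: loc_lipschitz_normalize => //; exact: fg.
- by move=> i j; exact: coord_loc_lipschitz.
- by [].
have unif p q (F : 'M[R]_(d, k) -> 'M[R]_(p, q)) :
    (forall i j, loc_lipschitz Z0 (fun Z => F Z i j)) ->
    exists C r : R, [/\ 0 <= C, 0 < r & forall Z Z',
      `|Z - Z0| < r -> `|Z' - Z0| < r -> `|F Z - F Z'| <= C * `|Z - Z'|].
  move=> LF.
  have /choice[C HC] : forall ij : 'I_p * 'I_q, exists Cr : R * R,
      [/\ 0 <= Cr.1, 0 < Cr.2 & forall Z Z', `|Z - Z0| < Cr.2 ->
        `|Z' - Z0| < Cr.2 -> `|F Z ij.1 ij.2 - F Z' ij.1 ij.2| <= Cr.1 * `|Z - Z'|].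
    by move=> [i j]; have [c [r H]] := LF i j; exists (c, r).
  exists (\sum_ij (C ij).1), (\big[Num.min/1]_ij (C ij).2); split.
  - by rewrite sumr_ge0// => ij _; case: (HC ij).
  - by apply/bigmin_gtP; split=> // ij _; case: (HC ij).
  move=> Z Z' Zr Z'r; apply: mx_norm_le => [|i j].
    by rewrite mulr_ge0// sumr_ge0// => ij _; case: (HC ij).
  have [c0 r0 H] := HC (i, j).
  have le_r : \big[Num.min/1]_ij (C ij).2 <= (C (i, j)).2 by exact: bigmin_le.
  rewrite !mxE (le_trans (H _ _ (lt_le_trans Zr le_r) (lt_le_trans Z'r le_r)))//.
  rewrite ler_wpM2r// (bigD1 (i, j))//= lerDl sumr_ge0// => ij _.
  by case: (HC ij).
have [C [r [C0 r0 H]]] := unif _ _ _ LQ.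
have [C' [r' [C'0 r'0 H']]] := unif _ _ _ LT.
exists (C + C'), (Num.min r r'); split; rewrite ?addr_ge0 ?lt_min ?r0//.
move=> Z Z' Q1 T1 Q2 T2 qr1 qr2; rewrite !lt_min => /andP[Zr Zr'] /andP[Z'r Z'r'].
have [-> ->] := is_qr_unique qr1 (QT Z (is_qr_full_rank qr1)).
have [-> ->] := is_qr_unique qr2 (QT Z' (is_qr_full_rank qr2)).
by split; [apply: le_trans (H _ _ Zr Z'r) _|apply: le_trans (H' _ _ Zr' Z'r') _];
  rewrite ler_wpM2r// ?lerDl ?lerDr.
Qed.

End QRContinuity.

(** * Matrix-valued curves *)

Section MatrixCalculus.
Variable R : realType.

Lemma is_derive_mxP (p q : nat) (F : R -> 'M[R]_(p, q)) (F' : 'M[R]_(p, q))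
    (t : R) :
  is_derive t (1 : R) F F' <->
  forall i j, is_derive t (1 : R) (fun s => F s i j) (F' i j).
Proof.
split=> [[dF <-] i j|H].
  split; first exact: (derivable_mxP F t 1).1.
  by rewrite derive_mx// mxE.
have dF : derivable F t 1 by apply/derivable_mxP => i j; case: (H i j).
split=> //; apply/matrixP => i j; rewrite derive_mx// mxE.
by case: (H i j).
Qed.

Lemma is_derive_mulmx (p q r : nat) (F : R -> 'M[R]_(p, q))
    (G : R -> 'M[R]_(q, r)) F' G' (t : R) :
  is_derive t (1 : R) F F' -> is_derive t (1 : R) G G' ->
  is_derive t (1 : R) (fun s => F s *m G s) (F' *m G t + F t *m G').
Proof.
move=> /is_derive_mxP dF /is_derive_mxP dG; apply/is_derive_mxP => i j.
have -> : (fun s => (F s *m G s) i j) = fun s => \sum_l F s i l * G s l j.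
  by apply/funext => s; rewrite mxE.
rewrite !mxE -big_split/=; apply: is_derive_sumr => l.
have dFl := dF i l; have dGl := dG l j.
by apply: is_derive_eq; rewrite /GRing.scale/=; ring.
Qed.

Lemma is_derive_mulmxr (p q r : nat) (F : R -> 'M[R]_(p, q))
    (M : 'M[R]_(q, r)) F' (t : R) :
  is_derive t (1 : R) F F' -> is_derive t (1 : R) (fun s => F s *m M) (F' *m M).
Proof.
move=> dF; have := is_derive_mulmx dF (is_derive_cst M t 1).
by rewrite mulmx0 addr0.
Qed.

Lemma is_derive_trmx (p q : nat) (F : R -> 'M[R]_(p, q)) F' (t : R) :
  is_derive t (1 : R) F F' -> is_derive t (1 : R) (fun s => (F s)^T) F'^T.
Proof.
move=> /is_derive_mxP dF; apply/is_derive_mxP => i j.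
by under eq_fun do rewrite mxE; rewrite mxE.
Qed.

Lemma derive_mx_eq0_cst (p q : nat) (F : R -> 'M[R]_(p, q)) :
  (forall t : R, 0 <= t -> is_derive t (1 : R) F 0) ->
  forall t : R, 0 <= t -> F t = F 0.
Proof.
move=> dF t t0; apply/matrixP => i j.
apply: (@derive_eq0_cst R (fun s => F s i j)) => // s s0.
by have /is_derive_mxP/(_ i j) := dF s s0; rewrite mxE.
Qed.

(** A two-sided derivative is determined by the values to the right. *)
Lemma is_derive_right_unique (f g : R -> R) (t a b : R) :
  is_derive t (1 : R) f a -> is_derive t (1 : R) g b ->
  (forall s, t <= s -> f s = g s) -> a = b.
Proof.
move=> df dg fg; apply/eqP; rewrite -subr_eq0; apply/eqP.
have [dh hE] := is_deriveB df dg.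
rewrite -hE.
have : h^-1 *: ((f - g) (h *: 1 + t) - (f - g) t) @[h --> 0^'] --> 'D_1 (f - g) t.
  exact: dh.
move=> /cvg_dnbhs_at_right H.
apply: (cvg_unique _ H) => //.
apply: cvg_near_cst; near=> h.
rewrite !fctE !fg ?subrr ?scaler0// lerDr /GRing.scale/= mulr1 ltW//.
Unshelve. all: by end_near. Qed.
End MatrixCalculus.

(** * The closed loop as a linear consensus equation *)

Section ControlAlgebra.
Variables (R : realType) (d k : nat).
Hypothesis kd : (k < d)%N.

Local Notation I := (Itop R d k).

Definition upper (T : 'M[R]_k) := forall i j : 'I_k, (j < i)%N -> T i j = 0.

Lemma upper_mul (S T : 'M[R]_k) : upper S -> upper T -> upper (S *m T).
Proof.
move=> uS uT i j ji; rewrite mxE big1// => l _.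
have [li|il] := ltnP l i; first by rewrite uS// mul0r.
by rewrite uT ?mulr0// (leq_trans ji).
Qed.

Lemma upper_inv (T : 'M[R]_k) : upper_pos T -> upper (invmx T).
Proof.
move=> uT i; move: {2}(k - i)%N (leqnn (k - i)) => m.
elim: m i => [|m IH] i im j ji.
  by move: im; rewrite leqn0 subn_eq0 leqNgt ltn_ord.
have := congr1 (fun M : 'M[R]_k => M i j) (mulmxV (upper_pos_unitmx uT)).
rewrite [in RHS]mxE -val_eqE/= gtn_eqF// mxE (bigD1 i)//= big1 => [|l li].
  move=> /eqP; rewrite addr0 mulf_eq0 gt_eqF ?(uT.2 i)//=.
  by move/eqP.
have [il|il] := ltnP i l; last first.
  by rewrite (uT.1 i l) ?mul0r// ltn_neqAle li il.
rewrite (IH l) ?mulr0 ?(ltn_trans ji)//.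
by rewrite -ltnS (leq_trans _ im)// ltn_sub2l.
Qed.

(** The upper triangular matrix N with R' = N R: the upper part of W = [I, 0] V plus
    the part that U moves above the diagonal. *)
Definition gain (W : 'M[R]_k) : 'M[R]_k := W - low W + (low W)^T.

Lemma gain_upper W : upper (gain W).
Proof.
move=> i j ji; rewrite !mxE ji subrr add0r ltnNge ltnW//.
Qed.

Lemma skew_low (K : 'M[R]_k) : K^T = - K -> K = low K - (low K)^T.
Proof.
move=> sK; apply/matrixP => i j; rewrite !mxE.
have e i' j' : K j' i' = - K i' j'.
  by have := congr1 (fun M : 'M[R]_k => M i' j') sK; rewrite !mxE.
have [ji|ij|ij] := ltngtP j i; first by rewrite subr0.
  by rewrite (e i j) sub0r opprK.
have -> : j = i by exact/val_inj.
by have := e i i; lra.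
Qed.

Lemma tr_Itop_low (V : 'M[R]_(d, k)) : I^T *m low V = low (I^T *m V).
Proof.
by apply/matrixP => i j; rewrite (tr_Itop_mulE kd) !mxE; case: ifP => // _;
  have := tr_Itop_mulE kd V i j; rewrite mxE => ->.
Qed.

(** Below row k nothing remains: all of these entries are strictly lower. *)
Lemma sub_lowE (V : 'M[R]_(d, k)) :
  V - low V = I *m (I^T *m V - low (I^T *m V)).
Proof.
apply/matrixP => i j; have [ik|ki] := ltnP i k.
  have -> : i = widen_ord (ltnW kd) (Ordinal ik) by exact/val_inj.
  rewrite (Itop_mulE kd) -tr_Itop_low -mulmxBr (tr_Itop_mulE kd).
  by [].
rewrite Itop_mul0// !mxE (leq_trans (ltn_ord j) ki) subrr//.
Qed.

(** The strictly lower part of V cancels, so that V - U has only top rows and these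
    are upper triangular. *)
Lemma input_Itop (V : 'M[R]_(d, k)) :
  V - input V *m I = I *m gain (I^T *m V).
Proof.
rewrite /input mulmxBl -mulmxA tr_Itop_mul// mulmx1 opprB addrA addrAC.
rewrite sub_lowE /gain [RHS]mulmxDr; congr (_ + _).
by rewrite trmx_mul trmxK -mulmxA -tr_Itop_low trmx_mul trmxK.
Qed.

Lemma up_Itop_upper (N : 'M[R]_k) : upper N -> up (I *m N) = N.
Proof.
move=> uN; apply/matrixP => i j; rewrite mxE mulmxA tr_Itop_mul// mul1mx.
by case: leqP => // /uN.
Qed.

(** On an upper triangular state the truncation in the equation for the R_i is
    no truncation at all. *)
Lemma up_ctrl (V : 'M[R]_(d, k)) (T : 'M[R]_k) : upper T ->
  up ((V - input V *m I) *m T) = gain (I^T *m V) *m T.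
Proof.
move=> uT; rewrite input_Itop -mulmxA up_Itop_upper//.
by apply: upper_mul => //; exact: gain_upper.
Qed.

End ControlAlgebra.

Section ClosedLoopFlow.
Variables (R : realType) (n d k : nat) (E : rel 'I_n) (a : 'I_n -> 'I_n -> R).
Hypothesis kd : (k < d)%N.
Local Notation I := (Itop R d k).

Lemma mulmx_Vctrl (Q : 'I_n -> 'M[R]_d) (T : 'I_n -> 'M[R]_k) (i : 'I_n) :
  Q i *m (Q i)^T = 1%:M -> T i \in unitmx ->
  Q i *m Vctrl E a Q T i *m T i =
    \sum_(j | E i j) a i j *: (Q j *m I *m T j - Q i *m I *m T i).
Proof.
move=> QQ uT; rewrite /Vctrl mulmx_sumr mulmx_suml; apply: eq_bigr => j _.
rewrite -scalemxAr -scalemxAl; congr (_ *: _).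
rewrite mulmxBr mulmxBl !mulmxA QQ mul1mx -!mulmxA mulVmx// mulmx1.
by rewrite !mulmxA.
Qed.

Definition consensus_derivative (Z : 'I_n -> 'M[R]_(d, k)) i :=
  \sum_(j | E i j) a i j *: (Z j - Z i).

Lemma consensus_solution (Phi : R -> 'M[R]_n)
    (Z : R -> 'I_n -> 'M[R]_(d, k)) :
  Phi 0 = 1%:M ->
  (forall t : R, 0 <= t -> forall i j, is_derive t (1 : R)
     (fun s => Phi s i j) ((laplacian_flow E a *m Phi t) i j)) ->
  (forall t : R, 0 <= t -> forall i, is_derive t (1 : R) (fun s => Z s i)
     (consensus_derivative (Z t) i)) ->
  forall t : R, 0 <= t -> forall i, Z t i = \sum_j Phi t i j *: Z 0 j.
Proof.
move=> P0 dP dZ t t0 i; apply/matrixP => x y.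
pose col (s : R) : 'cV[R]_n := \col_j Z s j x y.
suff H : col t = Phi t *m col 0.
  have := congr1 (fun M : 'cV[R]_n => M i 0) H; rewrite !mxE summxE => ->.
  by apply: eq_bigr => j _; rewrite !mxE.
apply: (@linear_ode_unique R n 1 (laplacian_flow E a) col
  (fun s => Phi s *m col 0)) => //.
- move=> s s0 j z; rewrite laplacian_flowE ord1.
  under eq_fun do rewrite mxE.
  have /is_derive_mxP/(_ x y) := dZ s s0 j; rewrite summxE.
  by under eq_bigr do rewrite !mxE; under [in X in _ -> X]eq_bigr do rewrite !mxE.
- move=> s s0 j z; rewrite mulmxA mxE.
  have -> : (fun s => (Phi s *m col 0) j z) =
            (fun s => \sum_l Phi s j l * col 0 l z).
    by apply/funext => u; rewrite mxE.
  apply: is_derive_sumr => l; have dl := dP s s0 j l.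
  by apply: is_derive_eq; rewrite /= /GRing.scale/=; ring.
- by rewrite P0 mul1mx.
Qed.

(** The products Z_i = Q_i(t, k) R_i(t, k) solve the linear consensus equation:
    Q U [I 0]^T R + Q [I 0]^T up ((V - U) R) = Q V R. *)
Lemma closed_loop_consensus (Q : R -> 'I_n -> 'M[R]_d) (T : R -> 'I_n -> 'M[R]_k) :
  closed_loop E a Q T ->
  (forall t : R, 0 <= t -> forall i, upper_pos (T t i)) ->
  forall t : R, 0 <= t -> forall i,
    is_derive t (1 : R) (fun s => Q s i *m I *m T s i)
      (consensus_derivative (fun j => Q t j *m I *m T t j) i).
Proof.
move=> [SQ0 uT0 CL] uT.
have QQ (t : R) : 0 <= t -> forall i, Q t i *m (Q t i)^T = 1%:M.
  move=> t0 i.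
  have := @derive_mx_eq0_cst R d d (fun s => Q s i *m (Q s i)^T) _ t t0.
  have [/mulmx1C -> _] := SQ0 i; apply => s s0.
  have [_ _ dQ] := CL s s0 i.
  have := is_derive_mulmx dQ (is_derive_trmx dQ).
  rewrite trmx_mul input_so mulNmx mulmxN -!mulmxA subrr; exact.
move=> t t0 i; have [uTi dT dQ] := CL t t0 i.
have := is_derive_mulmx (is_derive_mulmxr I dQ) dT.
rewrite up_ctrl//; last exact: (uT t t0 i).1.
rewrite -[Q t i *m I *m (_ *m _)]mulmxA [I *m (_ *m _)]mulmxA -input_Itop//.
set V := Vctrl _ _ _ _ _; move: (input V) => U.
rewrite mulmxBl mulmxBr !mulmxA addrC subrK mulmx_Vctrl//.
exact: QQ.
Qed.

End ClosedLoopFlow.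

(** * Continuously differentiable curves *)

Section ContinuousMatrices.
Variables (R : realType) (t : R).

Definition mx_continuous_at (p q : nat) (F : R -> 'M[R]_(p, q)) :=
  forall i j, F s i j @[s --> t] --> F t i j.

Lemma mx_continuous_mul p q r (F : R -> 'M[R]_(p, q)) (G : R -> 'M[R]_(q, r)) :
  mx_continuous_at F -> mx_continuous_at G ->
  mx_continuous_at (fun s => F s *m G s).
Proof.
move=> cF cG i j; under eq_fun do rewrite mxE; rewrite mxE; apply: cvg_sumr => l _.
by apply: cvgM; [exact: cF|exact: cG].
Qed.

Lemma mx_continuousD p q (F G : R -> 'M[R]_(p, q)) :
  mx_continuous_at F -> mx_continuous_at G ->
  mx_continuous_at (fun s => F s + G s).
Proof.
move=> cF cG i j; under eq_fun do rewrite mxE; rewrite mxE.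
by apply: cvgD; [exact: cF|exact: cG].
Qed.

Lemma mx_continuousN p q (F : R -> 'M[R]_(p, q)) :
  mx_continuous_at F -> mx_continuous_at (fun s => - F s).
Proof.
by move=> cF i j; under eq_fun do rewrite mxE; rewrite mxE; apply: cvgN; exact: cF.
Qed.

Lemma mx_continuous_tr p q (F : R -> 'M[R]_(p, q)) :
  mx_continuous_at F -> mx_continuous_at (fun s => (F s)^T).
Proof.
by move=> cF i j; under eq_fun do rewrite mxE; rewrite mxE; exact: cF.
Qed.

Lemma mx_continuous_low p q (F : R -> 'M[R]_(p, q)) :
  mx_continuous_at F -> mx_continuous_at (fun s => low (F s)).
Proof.
move=> cF i j; under eq_fun do rewrite mxE; rewrite mxE; case: ifP => _; first exact: cF.
exact: cvg_cst.
Qed.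

Lemma det_continuous p (F : R -> 'M[R]_p) :
  mx_continuous_at F -> {for t, continuous (fun s => \det (F s))}.
Proof.
move=> cF; apply: cvg_sumr => s _; apply: cvgM; first exact: cvg_cst.
by apply: cvg_big => [|i _]; [exact: mul_continuous|exact: cF].
Qed.

End ContinuousMatrices.

Section C1Functions.
Variable R : realType.

(** Derivatives are two-sided also at 0, as in the closed-loop equations. *)
Definition C1 (f : R -> R) := exists f' : R -> R, forall t : R, 0 <= t ->
  is_derive t (1 : R) f (f' t) /\ {for t, continuous f'}.

Lemma C1_cst c : C1 (fun=> c).
Proof.
exists (fun=> 0) => t _; split; last exact: cvg_cst.
exact: is_derive_cst.
Qed.

Lemma C1D f g : C1 f -> C1 g -> C1 (fun x => f x + g x).
Proof.
move=> [f' Hf] [g' Hg]; exists (fun x => f' x + g' x) => t t0.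
have [df cf] := Hf t t0; have [dg cg] := Hg t t0.
by split; [exact: is_deriveD|exact: cvgD].
Qed.

Lemma C1M f g : C1 f -> C1 g -> C1 (fun x => f x * g x).
Proof.
move=> [f' Hf] [g' Hg]; exists (fun x => f' x * g x + f x * g' x) => t t0.
have [df cf] := Hf t t0; have [dg cg] := Hg t t0; split.
  by apply: is_derive_eq; rewrite /GRing.scale/=; ring.
have cf0 := is_derive_continuous df; have cg0 := is_derive_continuous dg.
by apply: cvgD; apply: cvgM.
Qed.

Lemma C1_normalize f g : C1 f -> C1 g -> (forall x : R, 0 <= x -> 0 < g x) ->
  C1 (fun x => f x / Num.sqrt (g x)).
Proof.
move=> Cf [g' Hg] g0; apply: C1M => //.
exists (fun x => - (2 * (g x * Num.sqrt (g x)))^-1 * g' x) => t t0.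
have [dg cg] := Hg t t0; have gt0 := g0 t t0.
have st0 : Num.sqrt (g t) != 0 by rewrite gt_eqF// sqrtr_gt0.
have ds : is_derive t (1 : R) (fun x => Num.sqrt (g x))
    ((2 * Num.sqrt (g t))^-1 * g' t).
  by have := @is_derive1_comp R Num.sqrt g t _ _ (is_derive1_sqrt gt0) dg.
split.
  case: ds => ds sE; split; first exact: derivableV.
  rewrite deriveV// sE /GRing.scale/=; move: (sqr_sqrtr (ltW gt0)) st0.
  by move: (Num.sqrt (g t)) => s <- s0; field.
have cg0 := is_derive_continuous dg; have cs0 := is_derive_continuous ds.
apply: cvgM => //; apply: cvgN; apply: cvgV.
  by rewrite mulf_neq0// mulf_neq0// gt_eqF.
by apply: cvgM; [exact: cvg_cst|exact: cvgM].
Qed.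

End C1Functions.

(** * Moving frames *)

Section Tracking.
Variables (R : realType) (d k : nat).
Hypothesis kd : (k < d)%N.
Local Notation I := (Itop R d k).

(** The determinant is continuous with values in {-1, 1}. *)
Lemma det_orthogonal_path (Q : R -> 'M[R]_d) :
  (forall t : R, 0 <= t -> mx_continuous_at t Q) ->
  (forall t : R, 0 <= t -> (Q t)^T *m Q t = 1%:M) ->
  \det (Q 0) = 1 -> forall t : R, 0 <= t -> \det (Q t) = 1.
Proof.
move=> cQ QQ d0 t t0.
have sq (s : R) : 0 <= s -> \det (Q s) ^+ 2 = 1.
  by move=> s0; rewrite expr2 -{1}det_tr -det_mulmx QQ// det1.
have /eqP := sq t t0; rewrite sqrf_eq1 => /orP[/eqP//|/eqP dt].
have [||s] := @IVT R (fun s => \det (Q s)) 0 t 0 t0.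
- apply: continuous_in_subspaceT => s; rewrite inE/= in_itv/= => /andP[s0 _].
  by apply: det_continuous; exact: cQ.
- by rewrite d0 dt ge_min le_max lerN10 ler01 orbT.
rewrite in_itv/= => /andP[s0 _] ds.
by have /eqP := sq s s0; rewrite ds expr0n/= eq_sym oner_eq0.
Qed.

Lemma derive_upper (T : R -> 'M[R]_k) (T' : 'M[R]_k) (t : R) :
  0 <= t -> is_derive t (1 : R) T T' ->
  (forall s : R, 0 <= s -> upper (T s)) -> upper T'.
Proof.
move=> t0 /is_derive_mxP dT uT i j ji.
have dc : is_derive t (1 : R) (fun=> (0 : R)) 0 by exact: is_derive_cst.
apply: (is_derive_right_unique (dT i j) dc) => s ts.
by rewrite uT// (le_trans t0).
Qed.

(** The orthonormal factor Qh of a curve Z moves with the skew matrix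
    A = B Qh^T - Qh B^T, where B = Qh' + Qh (low K)^T and K = Qh^T Qh'. Solving
    Q' = A Q extends Qh to a moving frame Q, and A Q = Q U for the input U
    computed from Z' in this frame. *)
Lemma frame_tracking (Z Z' : R -> 'M[R]_(d, k)) (Q0 : 'M[R]_d) (T0 : 'M[R]_k) :
  (forall t : R, 0 <= t ->
     is_derive t (1 : R) Z (Z' t) /\ mx_continuous_at t Z') ->
  (forall t : R, 0 <= t -> full_rank (Z t)) ->
  SO Q0 -> is_qr (Z 0) (Q0 *m I) T0 ->
  exists (Q : R -> 'M[R]_d) (T : R -> 'M[R]_k),
    [/\ Q 0 = Q0, T 0 = T0
      & forall t : R, 0 <= t ->
        [/\ SO (Q t), is_qr (Z t) (Q t *m I) (T t)
          & forall V, Q t *m V *m T t = Z' t ->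
              is_derive t (1 : R) T (up ((V - input V *m I) *m T t))
              /\ is_derive t (1 : R) Q (Q t *m input V)]].
Proof.
move=> dZ fZ SQ0 qr0.
have [||||||Qh [T [CQ CT QT]]] := @gram_schmidt R R [set t | 0 <= t] (@C1 R)
  _ _ _ _ d k Z _ _.
- exact: C1_cst.
- exact: C1D.
- exact: C1M.
- exact: C1_normalize.
- move=> i j; exists (fun t => Z' t i j) => t t0; have [dt ct] := dZ t t0.
  by have /is_derive_mxP dij := dt; split; [exact: dij|exact: ct].
- exact: fZ.
have deriv p q (F : R -> 'M[R]_(p, q)) : (forall i j, C1 (fun x => F x i j)) ->
    exists F' : R -> 'M[R]_(p, q), forall t : R, 0 <= t ->
      is_derive t (1 : R) F (F' t) /\ mx_continuous_at t F'.
  move=> CF.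
  have /choice[f Hf] : forall ij : 'I_p * 'I_q, exists f' : R -> R,
      forall t : R, 0 <= t -> is_derive t (1 : R) (fun x => F x ij.1 ij.2) (f' t)
        /\ {for t, continuous f'}.
    by move=> [i j]; exact: CF.
  exists (fun t => \matrix_(i, j) f (i, j) t) => t t0; split.
    by apply/is_derive_mxP => i j; rewrite mxE; case: (Hf (i, j) t t0).
  move=> i j; under eq_fun do rewrite mxE; rewrite mxE.
  by case: (Hf (i, j) t t0).
have [Qh' dQh] := deriv _ _ _ CQ; have [T' dT] := deriv _ _ _ CT.
have [Qh0 T00] := is_qr_unique (QT 0 (lexx _)) qr0.
pose K t := (Qh t)^T *m Qh' t.
pose B t := Qh' t + Qh t *m (low (K t))^T.
pose A t := B t *m (Qh t)^T - Qh t *m (B t)^T.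
have cQh (t : R) : 0 <= t -> mx_continuous_at t Qh.
  move=> t0 i j; have [/is_derive_mxP/(_ i j)/is_derive_continuous H _] := dQh t t0.
  exact: H.
have cB (t : R) : 0 <= t -> mx_continuous_at t B.
  move=> t0; have c1 := cQh t t0; have [_ c2] := dQh t t0.
  apply: mx_continuousD => //; apply: mx_continuous_mul => //.
  apply: mx_continuous_tr; apply: mx_continuous_low; apply: mx_continuous_mul => //.
  exact: mx_continuous_tr.
have cA (t : R) : 0 <= t -> forall i j, {for t, continuous (fun s => A s i j)}.
  move=> t0 i j; apply: (_ : mx_continuous_at t A).
  have c1 := cQh t t0; have c2 := cB t t0.
  apply: mx_continuousD; first by apply: mx_continuous_mul => //; exact: mx_continuous_tr.
  apply: mx_continuousN; apply: mx_continuous_mul => //; exact: mx_continuous_tr.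
have [Q [QQ0 dQ _]] := linear_ode_exists Q0 cA.
have {}dQ (t : R) : 0 <= t -> is_derive t (1 : R) Q (A t *m Q t).
  by move=> t0; apply/is_derive_mxP; exact: dQ.
have skewA t : (A t)^T = - A t.
  by rewrite /A linearB/= !trmx_mul !trmxK opprB.
have QQ (t : R) : 0 <= t -> (Q t)^T *m Q t = 1%:M.
  move=> t0; have := @derive_mx_eq0_cst R d d (fun s => (Q s)^T *m Q s) _ t t0.
  rewrite QQ0 SQ0.1; apply => s s0.
  have := is_derive_mulmx (is_derive_trmx (dQ s s0)) (dQ s s0).
  by rewrite trmx_mul skewA mulmxN mulNmx mulmxA addNr.
have skewK (t : R) : 0 <= t -> (K t)^T = - K t.
  move=> t0; apply/eqP; rewrite -addr_eq0; apply/eqP.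
  have [d1 _] := dQh t t0.
  have d2 := is_derive_mulmx (is_derive_trmx d1) d1.
  apply/matrixP => i j; rewrite [RHS]mxE.
  have dc : is_derive t (1 : R) (fun=> (1%:M : 'M[R]_k) i j) 0 by exact: is_derive_cst.
  have /is_derive_mxP/(_ i j) d3 := d2.
  have := is_derive_right_unique d3 dc; rewrite /K trmx_mul trmxK; apply => s ts.
  by have [_ -> _] := QT s (le_trans t0 ts).
have KE (t : R) (t0 : 0 <= t) := skew_low (skewK t t0).
have BQ (t : R) : 0 <= t -> (B t)^T *m Qh t = (low (K t))^T.
  move=> t0; have [_ qq _] := QT t t0.
  rewrite /B linearD/= trmx_mul trmxK mulmxDl -mulmxA qq mulmx1.
  have -> : (Qh' t)^T *m Qh t = (K t)^T by rewrite /K trmx_mul trmxK.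
  by rewrite skewK// [in - K t]KE// opprB subrK.
have AQh (t : R) : 0 <= t -> A t *m Qh t = Qh' t.
  move=> t0; have [_ qq _] := QT t t0.
  by rewrite /A mulmxBl -!mulmxA qq mulmx1 BQ// /B addrK.
have QQh (t : R) : 0 <= t -> Qh t = Q t *m I.
  move=> t0; have := @derive_mx_eq0_cst R d k (fun s => (Q s)^T *m Qh s) _ t t0.
  rewrite QQ0 Qh0 mulmxA SQ0.1 mul1mx => H.
  have <- : (Q t)^T *m Qh t = I; last by rewrite mulmxA (mulmx1C (QQ t t0)) mul1mx.
  apply: H => s s0; have [d1 _] := dQh s s0.
  have := is_derive_mulmx (is_derive_trmx (dQ s s0)) d1.
  by rewrite trmx_mul skewA mulmxN mulNmx -mulmxA AQh// addNr.
exists Q, T; split=> // t t0.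
have [ZE qq uT] := QT t t0.
split.
- split; first exact: QQ.
  apply: (@det_orthogonal_path Q) => //; last by rewrite QQ0 SQ0.2.
  move=> s s0 i j; have /is_derive_mxP/(_ i j)/is_derive_continuous H := dQ s s0.
  exact: H.
- by rewrite -QQh//; split.
move=> V QVT.
have [d1 _] := dQh t t0; have [dTt _] := dT t t0; have [dZt _] := dZ t t0.
have uTt := upper_pos_unitmx uT.
have [N NT uN] : exists2 N, N *m T t = T' t & upper N.
  exists (T' t *m invmx (T t)); first by rewrite mulmxKV.
  apply: upper_mul; last exact: upper_inv.
  apply: derive_upper dTt _ => // s s0; by have [_ _ []] := QT s s0.
have Z'E : Z' t = Qh' t *m T t + Qh t *m T' t.
  apply/matrixP => i j.
  have /is_derive_mxP/(_ i j) e1 := dZt.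
  have /is_derive_mxP/(_ i j) e2 := is_derive_mulmx d1 dTt.
  apply: (is_derive_right_unique e1 e2) => s ts.
  by have [-> _ _] := QT s (le_trans t0 ts).
have QV : Q t *m V = Qh' t + Qh t *m N.
  have := congr1 (mulmx^~ (invmx (T t))) QVT.
  by rewrite mulmxK// => ->; rewrite Z'E -NT mulmxA -mulmxDl mulmxK.
have W : I^T *m V = K t + N.
  have -> : I^T *m V = (Q t *m I)^T *m (Q t *m V).
    by rewrite trmx_mul -!mulmxA (mulmxA _ (Q t)) QQ// mul1mx.
  by rewrite QV -QQh// mulmxDr mulmxA qq mul1mx.
have lowN : low N = 0.
  by apply/matrixP => i j; rewrite [LHS]mxE [RHS]mxE; case: ifP => // ji; exact: uN.
have lowD (M1 M2 : 'M[R]_k) : low (M1 + M2) = low M1 + low M2.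
  by apply/matrixP => i j; rewrite !mxE; case: ifP => // _; rewrite addr0.
have lowW : low (I^T *m V) = low (K t) by rewrite W lowD lowN addr0.
have KlowE : K t - low (K t) = - (low (K t))^T by rewrite {1}KE// addrAC subrr sub0r.
split.
  rewrite up_ctrl//; last exact: uT.1.
  have -> : gain (I^T *m V) = N; last by rewrite NT.
  by rewrite /gain lowW W [K t + N]addrC -[N + K t - _]addrA KlowE subrK.
have QlowV : Q t *m low V = B t.
  have -> : low V = V - I *m (I^T *m V - low (I^T *m V)).
    by rewrite -sub_lowE// opprB addrC subrK.
  rewrite mulmxBr QV mulmxA -QQh// lowW W [K t + N - _]addrAC KlowE mulmxDr opprD.
  by rewrite mulmxN opprK addrA addrAC addrK.
have -> : Q t *m input V = A t *m Q t; last exact: dQ.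
have IE : I^T = (Qh t)^T *m Q t.
  by rewrite QQh// trmx_mul -mulmxA QQ// mulmx1.
have lowVE : low V = (Q t)^T *m B t by rewrite -QlowV mulmxA QQ// mul1mx.
rewrite /input mulmxBr mulmxA QlowV trmx_mul trmxK mulmxA -QQh//.
rewrite lowVE trmx_mul trmxK IE /A mulmxBl -!mulmxA.
by [].
Qed.

End Tracking.

(** * Initial points of full synchronization *)

Section MatrixConvergence.
Variables (R : realType) (S : Type) (F : set_system S).
Context {FF : Filter F}.

Lemma cvg_mxP (p q : nat) (M : S -> 'M[R]_(p, q)) (L : 'M[R]_(p, q)) :
  M @ F --> L <-> forall i j, M x i j @[x --> F] --> L i j.
Proof.
split=> [/cvgrPdist_le ML i j|ML].
  apply/cvgrPdist_le => e e0; apply: filterS (ML e e0) => x; apply: le_trans.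
  by have := le_mx_norm (L - M x) i j; rewrite !mxE.
apply/cvgrPdist_le => e e0.
have : \forall x \near F, forall ij : 'I_p * 'I_q,
    `|L ij.1 ij.2 - M x ij.1 ij.2| <= e.
  by apply: filter_forall => ij; have /cvgrPdist_le := ML ij.1 ij.2; exact.
apply: filterS => x H; apply: mx_norm_le => [|i j]; first exact: ltW.
by rewrite !mxE; exact: (H (i, j)).
Qed.

Lemma cvg_mulmx (p q r : nat) (M : S -> 'M[R]_(p, q)) (N : S -> 'M[R]_(q, r))
    (A : 'M[R]_(p, q)) (B : 'M[R]_(q, r)) :
  M @ F --> A -> N @ F --> B -> (fun x => M x *m N x) @ F --> A *m B.
Proof.
move=> /cvg_mxP cM /cvg_mxP cN; apply/cvg_mxP => i j.
under eq_fun do rewrite mxE; rewrite mxE; apply: cvg_sumr => l _.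
by apply: cvgM; [exact: cM|exact: cN].
Qed.

End MatrixConvergence.

Section Characterization.
Variables (R : realType) (n d k : nat) (E : rel 'I_n) (a : 'I_n -> 'I_n -> R).
Hypothesis kd : (k < d)%N.
Hypothesis hE : quasi_strongly_connected E.
Local Notation I := (Itop R d k).

Definition factor (p : ambient R n d k) (i : 'I_n) : 'M[R]_(d, k) :=
  submxcol p.1 i *m submxcol p.2 i.

(** Every d x k matrix with orthonormal columns extends to a rotation, since
    k < d; so D_QR consists of the QR factors of n-tuples of full-rank matrices. *)
Lemma D_QRP (p : ambient R n d k) : D_QR p <->
  forall i, is_qr (factor p i) (submxcol p.1 i) (submxcol p.2 i).
Proof.
split=> [[SQ uT] i|H].
  split=> //; have [Q SQi ->] := SQ i; exact: orthonormal_SO.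
split=> i; last by have [_ _] := H i.
have [_ QQ _] := H i; have [Q SQ QI] := orthonormal_completion kd QQ.
by exists Q.
Qed.

Variables (Phi : R -> 'M[R]_n) (q : 'I_n -> R).
Hypothesis Phi0 : Phi 0 = 1%:M.
Hypothesis dPhi : forall t : R, 0 <= t -> forall i j, is_derive t (1 : R)
  (fun s => Phi s i j) ((laplacian_flow E a *m Phi t) i j).
Hypothesis cPhi : forall i j, Phi t i j @[t --> +oo] --> q j.

Definition flow (Z : 'I_n -> 'M[R]_(d, k)) (t : R) i := \sum_j Phi t i j *: Z j.

(** These conditions on the products Z_j = Q_j R_j characterize D_QR_full inside
    D_QR. *)
Definition regular (Z : 'I_n -> 'M[R]_(d, k)) :=
  (forall t : R, 0 <= t -> forall i, full_rank (flow Z t i)) /\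
  full_rank (\sum_j q j *: Z j).

Lemma flow0 Z i : flow Z 0 i = Z i.
Proof.
rewrite /flow Phi0 (bigD1 i)//= mxE eqxx scale1r big1 ?addr0// => j ji.
by rewrite mxE eq_sym (negbTE ji) scale0r.
Qed.

Lemma flow_entry Z t i x y : flow Z t i x y = \sum_j Phi t i j * Z j x y.
Proof. by rewrite summxE; apply: eq_bigr => j _; rewrite mxE. Qed.

Lemma cvg_flow Z i : (fun t => flow Z t i) @ +oo --> \sum_j q j *: Z j.
Proof.
apply/cvg_mxP => x y; under eq_fun do rewrite flow_entry; rewrite summxE.
apply: cvg_sumr => j _; rewrite mxE; apply: cvgM; [exact: cPhi|exact: cvg_cst].
Qed.

Lemma consensus_derivative_entry (Z : 'I_n -> 'M[R]_(d, k)) i x y :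
  consensus_derivative E a Z i x y = \sum_(j | E i j) a i j * (Z j x y - Z i x y).
Proof. by rewrite summxE; apply: eq_bigr => j _; rewrite !mxE. Qed.

Lemma flow_derive (Z : 'I_n -> 'M[R]_(d, k)) (t : R) : 0 <= t -> forall i,
  is_derive t (1 : R) (fun s => flow Z s i) (consensus_derivative E a (flow Z t) i).
Proof.
move=> t0 i; apply/is_derive_mxP => x y.
under eq_fun do rewrite flow_entry.
pose X : 'cV[R]_n := \col_j Z j x y.
have -> : consensus_derivative E a (flow Z t) i x y =
    \sum_j (laplacian_flow E a *m Phi t) i j * Z j x y.
  transitivity ((laplacian_flow E a *m (Phi t *m X)) i 0).
    rewrite laplacian_flowE consensus_derivative_entry; apply: eq_bigr => j _.
    by rewrite !flow_entry !mxE; congr (_ * (_ - _)); apply: eq_bigr => l _; rewrite mxE.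
  by rewrite mulmxA mxE; apply: eq_bigr => j _; rewrite [X in _ * X = _]mxE.
apply: is_derive_sumr => j; have dj := dPhi t0 i j.
by apply: is_derive_eq; rewrite /= /GRing.scale/=; ring.
Qed.

(** The products of a solution follow the consensus flow, so that their ranks, and
    the rank of their limit, are those of the combinations. *)
Lemma D_QR_full_regular p : D_QR_full E a p -> regular (factor p).
Proof.
move=> [Dp Fp]; have [SQ _] := Dp.
have /choice[Q0 HQ0] : forall i, exists Qi : 'M[R]_d,
    SO Qi /\ Qi *m I = submxcol p.1 i.
  by move=> i; have [Qi] := SQ i; exists Qi.
have [Q [T [CL QQ0 TT0 DQT [Qb [Tb [SQb uTb cQT]]]]]] :=
  Fp Q0 (fun i => (HQ0 i).1) (fun i => (HQ0 i).2).
have qrt (t : R) : 0 <= t -> forall i,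
    is_qr (Q t i *m I *m T t i) (Q t i *m I) (T t i).
  move=> /DQT/D_QRP H i; have := H i.
  by rewrite /factor /state/= !mxcolK.
have uT (t : R) : 0 <= t -> forall i, upper_pos (T t i).
  by move=> t0 i; case: (qrt t t0 i).
have flowE (t : R) : 0 <= t -> forall i, Q t i *m I *m T t i = flow (factor p) t i.
  move=> t0 i.
  rewrite (consensus_solution Phi0 dPhi (closed_loop_consensus kd CL uT) t0).
  by apply: eq_bigr => j _; rewrite QQ0 TT0 (HQ0 j).2.
split=> [t t0 i|]; first by rewrite -flowE//; exact: is_qr_full_rank (qrt t t0 i).
have [r _] := hE; have [cQ cT] := cQT r.
have <- : Qb *m I *m Tb = \sum_j q j *: factor p j.
  have c1 : (fun t => Q t r *m I *m T t r) @ +oo --> Qb *m I *m Tb.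
    exact: cvg_mulmx.
  have c2 := @cvg_flow (factor p) r.
  have c3 : (fun t => flow (factor p) t r) @ +oo --> Qb *m I *m Tb.
    apply: cvg_trans c1; apply: near_eq_cvg; near=> t.
    rewrite flowE//; near: t; apply: nbhs_pinfty_ge; exact: num_real.
  exact: (cvg_unique (@norm_hausdorff _ _) c3 c2).
apply: full_rank_mul; last exact/full_rank_unitmx.
by apply: full_rank_orthonormal; exact: orthonormal_SO.
Unshelve. all: by end_near. Qed.

(** Each agent follows its own moving frame; the inputs agree with those of the
    closed loop because the Z_i solve the consensus equation. The factors converge
    because they depend continuously on Z_i(t), whose limit has full rank. *)
Lemma regular_D_QR_full p : D_QR p -> regular (factor p) -> D_QR_full E a p.
Proof.
move=> Dp [ft fq]; split=> // Q0 SQ0 Q0I.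
have qrp := (D_QRP p).1 Dp.
pose Z := factor p.
pose Z' t i := consensus_derivative E a (flow Z t) i.
have cZ' (t : R) : 0 <= t -> forall i, mx_continuous_at t (Z'^~ i).
  move=> t0 i x y; rewrite /Z'.
  under eq_fun do rewrite consensus_derivative_entry.
  rewrite consensus_derivative_entry; apply: cvg_sumr => j _.
  have cf l : flow Z s l x y @[s --> t] --> flow Z t l x y.
    have /is_derive_mxP/(_ x y)/is_derive_continuous := flow_derive Z t0 l.
    exact.
  by apply: cvgM; [exact: cvg_cst|apply: cvgB].
have /choice[QT HQT] : forall i, exists QT : (R -> 'M[R]_d) * (R -> 'M[R]_k),
    [/\ QT.1 0 = Q0 i, QT.2 0 = submxcol p.2 i
      & forall t : R, 0 <= t ->
        [/\ SO (QT.1 t), is_qr (flow Z t i) (QT.1 t *m I) (QT.2 t)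
          & forall V, QT.1 t *m V *m QT.2 t = Z' t i ->
              is_derive t (1 : R) QT.2 (up ((V - input V *m I) *m QT.2 t))
              /\ is_derive t (1 : R) QT.1 (QT.1 t *m input V)]].
  move=> i; have [||||Q [T H]] := @frame_tracking R d k kd
    (fun t => flow Z t i) (Z'^~ i) (Q0 i) (submxcol p.2 i).
  - by move=> t t0; split; [exact: flow_derive|exact: cZ'].
  - by move=> t t0; exact: ft.
  - exact: SQ0.
  - by rewrite flow0 Q0I; exact: qrp.
  - by exists (Q, T).
pose Q t i := (QT i).1 t; pose T t i := (QT i).2 t.
have qrt (t : R) : 0 <= t -> forall i, is_qr (flow Z t i) (Q t i *m I) (T t i).
  by move=> t0 i; have [_ _ /(_ t t0)[]] := HQT i.
have SQt (t : R) : 0 <= t -> forall i, SO (Q t i).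
  by move=> t0 i; have [_ _ /(_ t t0)[]] := HQT i.
have uT (t : R) : 0 <= t -> forall i, T t i \in unitmx.
  by move=> t0 i; have [_ _ /upper_pos_unitmx] := qrt t t0 i.
exists Q, T; split.
- split=> [i|i|t t0 i V U]; [exact: SQt|by have [_ _] := qrt 0 (lexx _) i|].
  have [_ _ /(_ t t0)[_ _ /(_ V)]] := HQT i.
  have -> : (QT i).1 t *m V *m (QT i).2 t = Z' t i.
    rewrite /V mulmx_Vctrl//; [|by have [/mulmx1C] := SQt t t0 i|exact: uT].
    rewrite /Z' /consensus_derivative; apply: eq_bigr => j _.
    by have [-> _ _] := qrt t t0 j; have [-> _ _] := qrt t t0 i.
  by move=> /(_ erefl)[dT dQ]; split=> //; exact: uT.
- by move=> i; have [] := HQT i.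
- by move=> i; have [] := HQT i.
- move=> t t0; apply/D_QRP => i; rewrite /factor /state/= !mxcolK.
  by have [_ QQ uTi] := qrt t t0 i; split.
have [Qh [Tb qrb]] := qr_exists fq.
have [Qb SQb QbI] : exists2 Qb, SO Qb & Qb *m I = Qh.
  by case: qrb => _ QQ _; exact: orthonormal_completion.
exists Qb, Tb; split=> //; first by case: qrb => _ _ /upper_pos_unitmx.
move=> i; rewrite QbI.
have [C [r [C0 r0 HC]]] := qr_lipschitz fq.
have C1 : 0 < C + 1 by rewrite ltr_wpDl.
have cZ := @cvg_flow Z i.
have small (e : R) : 0 < e -> \forall t \near +oo,
    `|Qh - Q t i *m I| <= e /\ `|Tb - T t i| <= e.
  move=> e0; near=> t.
  have t0 : 0 <= t by near: t; apply: nbhs_pinfty_ge; exact: num_real.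
  have Zr : `|(\sum_j q j *: Z j) - flow Z t i| < r.
    by near: t; apply: cvgr_dist_lt.
  have Ze : `|(\sum_j q j *: Z j) - flow Z t i| <= e / (C + 1).
    by near: t; apply: cvgr_dist_le => //; rewrite divr_gt0.
  have Ce : C * `|(\sum_j q j *: Z j) - flow Z t i| <= e.
    move: Ze; rewrite ler_pdivlMr// => Ze.
    by have := normr_ge0 ((\sum_j q j *: Z j) - flow Z t i); nra.
  have [||H1 H2] := HC _ _ _ _ _ _ qrb (qrt t t0 i).
  - by rewrite subrr normr0.
  - by rewrite distrC.
  by split; [apply: le_trans H1 _|apply: le_trans H2 _].
by split; apply/cvgrPdist_le => e e0; apply: filterS (small e e0) => t [].
Unshelve. all: by end_near. Qed.

End Characterization.

(** * Sets parametrized by few coordinates *)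

Section Cells.
Variable R : realType.

Definition cell (L h x : R) : nat := Num.truncn ((x + L) / h).

Lemma cell_close (L h x y : R) : 0 < h -> `|x| <= L -> `|y| <= L ->
  cell L h x = cell L h y -> `|x - y| <= h.
Proof.
rewrite !ler_norml => h0 /andP[Lx _] /andP[Ly _]; rewrite /cell => e.
have X0 : 0 <= (x + L) / h by apply: divr_ge0; [lra|exact: ltW].
have Y0 : 0 <= (y + L) / h by apply: divr_ge0; [lra|exact: ltW].
have := truncn_itv X0; have := truncn_itv Y0; rewrite -e -natr1.
move=> /andP[+ +] /andP[]; rewrite !ler_pdivlMr// !ltr_pdivrMr//.
by move: (_%:R) => N; lra.
Qed.

Lemma cell_lt (L h x : R) (q : nat) : 0 < h -> `|x| <= L -> 2 * L < q%:R * h ->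
  (cell L h x < q)%N.
Proof.
rewrite ler_norml => h0 /andP[Lx xL] Lq; rewrite /cell truncn_lt_nat.
  by rewrite ltr_pdivrMr//; lra.
by apply: divr_ge0; [lra|exact: ltW].
Qed.

(** A set of dimension #|J| < #|I| cannot fill a cube of R^I: the p^#|I| points
    of a fine grid of mesh e would have parameters that are pairwise separated
    by a multiple of e, but there is only room for O(p^#|J|) of these. *)
Lemma lipschitz_not_cube (F I J : finType) (L C delta : R) (z0 : I -> R)
    (Rel : (I -> R) -> F -> (J -> R) -> Prop) :
  (#|J| < #|I|)%N -> 0 < delta ->
  (forall z, (forall i, `|z i - z0 i| <= delta) -> exists f y, Rel z f y) ->
  (forall z f y, Rel z f y -> forall j, `|y j| <= L) ->
  (forall z z' f y y' (e : R), 0 <= e -> Rel z f y -> Rel z' f y' ->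
     (forall j, `|y j - y' j| <= e) -> forall i, `|z i - z' i| <= C * e) ->
  False.
Proof.
move=> JI delta0 cube bnd lip.
pose C' := `|C| + 1; have C'0 : 0 < C' by rewrite ltr_wpDl.
pose M := (Num.truncn (2 * L * C' / delta)).+2.
pose p := (#|F| * M ^ #|J|).+1.
have p0 : 0 < p%:R :> R by rewrite ltr0n.
pose mesh := delta / p%:R; have mesh0 : 0 < mesh by rewrite divr_gt0.
pose h := mesh / C'; have h0 : 0 < h by rewrite divr_gt0.
have grid (g : {ffun I -> 'I_p}) : exists fy : F * (J -> R),
    Rel (fun i => z0 i + mesh * (g i)%:R) fy.1 fy.2.
  have [|f [y H]] := cube (fun i => z0 i + mesh * (g i)%:R); last by exists (f, y).
  move=> i; rewrite addrC addKr ger0_norm; last by rewrite mulr_ge0// ltW.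
  rewrite /mesh mulrAC ler_pdivrMr// ler_wpM2l ?(ltW delta0)// ler_nat ltnW//.
have [fy Hfy] := choice grid.
have room : 2 * L < (M * p)%:R * h.
  rewrite natrM -mulrA /h /mesh [p%:R * _]mulrC.
  have -> : delta / p%:R / C' * p%:R = delta / C' by field; rewrite !gt_eqF.
  rewrite mulrA ltr_pdivlMr// -ltr_pdivrMr//.
  by apply: lt_trans (truncnS_gt _) _; rewrite ltr_nat.
have cl g j : (cell L h ((fy g).2 j) < M * p)%N.
  by apply: cell_lt => //; exact: bnd (Hfy g) _.
pose code (g : {ffun I -> 'I_p}) : F * {ffun J -> 'I_(M * p)} :=
  ((fy g).1, [ffun j => Ordinal (cl g j)]).
have code_inj : injective code.
  move=> g g' [ef /ffunP ec]; apply/ffunP => i; apply/val_inj => /=.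
  have close j : `|(fy g).2 j - (fy g').2 j| <= h.
    apply: (@cell_close L) => //; [exact: bnd (Hfy g) _|exact: bnd (Hfy g') _|].
    by have := ec j; rewrite !ffunE => /(congr1 val).
  have H2 := Hfy g'; rewrite -ef in H2.
  have := lip _ _ _ _ _ _ (ltW h0) (Hfy g) H2 close i.
  have -> : z0 i + mesh * (g i)%:R - (z0 i + mesh * (g' i)%:R) =
    mesh * ((g i)%:R - (g' i)%:R) by ring.
  rewrite normrM gtr0_norm// => H.
  have Ch : C * h < mesh.
    apply: (@le_lt_trans _ _ (`|C| * h)); first by rewrite ler_wpM2r ?ler_norm ?ltW.
    by rewrite /h mulrCA gtr_pMr// ltr_pdivrMr// mul1r ltrDl.
  have := le_lt_trans H Ch; rewrite gtr_pMr//.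
  have [->//|ne] := eqVneq (g i : nat) (g' i).
  rewrite ltNge => /negP; case.
  case: ltngtP ne => // gg _.
    rewrite distrC -natrB ?(ltnW gg)// ger0_norm// -[1]/(1%:R) ler_nat subn_gt0//.
  by rewrite -natrB ?(ltnW gg)// ger0_norm// -[1]/(1%:R) ler_nat subn_gt0.
have := leq_card code code_inj.
rewrite card_prod !card_ffun !card_ord expnMn mulnA leqNgt; apply/negP; rewrite negbK.
rewrite -(subnK JI) -addSnnS expnD ltn_mul2r expn_gt0/=.
apply: (@leq_trans (p ^ 1)); first by rewrite expn1.
by rewrite leq_pexp2l.
Qed.

End Cells.

Section NullSets.
Variables (R : realType) (m : nat).
Implicit Types A B : set 'rV[R]_m.

Lemma lebesgue_null_sub A B : A `<=` B -> lebesgue_null B -> lebesgue_null A.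
Proof.
move=> AB nB e e0; have [J [l [h [lh cov vol]]]] := nB e e0.
by exists J, l, h; split=> //; apply: subset_trans cov.
Qed.

Lemma lebesgue_null_bigcup (A : nat -> set 'rV[R]_m) :
  (forall i, lebesgue_null (A i)) -> lebesgue_null (\bigcup_i A i).
Proof.
move=> nA e e0.
have /choice[f Hf] : forall i : nat,
    exists f : (set nat) * (nat -> 'rV[R]_m) * (nat -> 'rV[R]_m),
    [/\ forall j, f.1.1 j -> forall x : 'I_m, f.1.2 j 0 x <= f.2 j 0 x,
        A i `<=` \bigcup_(j in f.1.1) box (f.1.2 j) (f.2 j)
      & (\esum_(j in f.1.1) (\prod_(x < m) (f.2 j 0 x - f.1.2 j 0 x))%:E
          <= (e / (2 ^ i.+1)%:R)%:E)%E].
  move=> i; have [|J [l [h H]]] := nA i (e / (2 ^ i.+1)%:R).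
    by rewrite divr_gt0// ltr0n expn_gt0.
  by exists (J, l, h).
pose S := [set: nat] `*`` (fun i => (f i).1.1).
pose dec (x : nat) : nat * nat := odflt (0%N, 0%N) (unpickle x).
have decK : cancel pickle dec by move=> x; rewrite /dec pickleK.
exists (pickle @` S), (fun x => (f (dec x).1).1.2 (dec x).2),
  (fun x => (f (dec x).1).2 (dec x).2); split.
- move=> _ [[i j] [_ /= Jj] <-] x; rewrite decK/=.
  by have [+ _ _] := Hf i; apply.
- move=> x [i _ Aix]; have [_ + _] := Hf i => /(_ x Aix)[j Jj bx].
  by exists (pickle (i, j)); [exists (i, j)|rewrite decK].
rewrite (esum_image S pickle); last by move=> x y _ _; exact: (can_inj decK).
under eq_esum do rewrite decK.
rewrite -(@esum_esum R nat nat setT (fun i => (f i).1.1)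
  (fun i j => (\prod_(x < m) ((f i).2 j 0 x - (f i).1.2 j 0 x))%:E)); last first.
  move=> i j _ Jj; rewrite lee_fin prodr_ge0// => x _; rewrite subr_ge0.
  by have [+ _ _] := Hf i; apply.
apply: (@le_trans _ _ (\esum_(i in [set: nat]) (e / (2 ^ i.+1)%:R)%:E)%E).
  by apply: le_esum => i _; have [_ _] := Hf i.
rewrite -nneseries_esumT; first by apply: epsilon_trick0; exact: ltW.
by move=> i; rewrite lee_fin divr_ge0// ltW.
Qed.

Lemma lebesgue_null0 : lebesgue_null (set0 : set 'rV[R]_m).
Proof.
move=> e e0; exists set0, (fun=> 0), (fun=> 0); split=> //.
by rewrite esum_set0 lee_fin ltW.
Qed.

Lemma lebesgue_null_countable (T : countType) (A : T -> set 'rV[R]_m) :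
  (forall i, lebesgue_null (A i)) -> lebesgue_null (\bigcup_i A i).
Proof.
move=> nA.
pose B i := if unpickle i is Some t then A t else set0.
apply: (@lebesgue_null_sub _ (\bigcup_i B i)).
  by move=> x [t _ At]; exists (pickle t) => //; rewrite /B pickleK.
apply: lebesgue_null_bigcup => i; rewrite /B; case: unpickle => [t|]//.
exact: lebesgue_null0.
Qed.

(** A set of dimension #|J| < m is covered by O(p^#|J|) cubes of side O(1/p). *)
Lemma lipschitz_null (J : finType) (A : set 'rV[R]_m) (L C : R)
    (Rel : 'rV[R]_m -> (J -> R) -> Prop) :
  (#|J| < m)%N ->
  (forall x, A x -> exists y, Rel x y) ->
  (forall x y, Rel x y -> forall j, `|y j| <= L) ->
  (forall x x' y y' (e : R), 0 <= e -> Rel x y -> Rel x' y' ->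
     (forall j, `|y j - y' j| <= e) -> forall i, `|x 0 i - x' 0 i| <= C * e) ->
  lebesgue_null A.
Proof.
move=> Jm par bnd lip e e0.
have /choice[y Hy] : forall x : 'rV[R]_m, exists y : J -> R, A x -> Rel x y.
  move=> x; have [/par[y H]|nA] := pselect (A x); first by exists y.
  by exists (fun=> 0).
have [L' L'0 LL'] : exists2 L', 0 < L' & L <= L'.
  by exists (`|L| + 1); [rewrite ltr_wpDl|rewrite ler_wpDr// ler_norm].
have [C' C'0 CC'] : exists2 C', 0 < C' & C <= C'.
  by exists (`|C| + 1); [rewrite ltr_wpDl|rewrite ler_wpDr// ler_norm].
pose K := 2 ^+ #|J| * (4 * L' * C') ^+ m.
have K0 : 0 <= K by rewrite mulr_ge0 ?exprn_ge0// !mulr_ge0// ltW.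
have [p p_gt0 pK] : exists2 p : nat, (0 < p)%N & K / e <= p%:R.
  by exists (Num.truncn (K / e)).+1 => //; apply: ltW; exact: truncnS_gt.
have p0 : 0 < p%:R :> R by rewrite ltr0n.
pose h := 2 * L' / p%:R; have h0 : 0 < h by rewrite divr_gt0// mulr_gt0.
have bnd' x j : A x -> `|y x j| <= L'.
  by move=> /Hy/bnd H; exact: le_trans (H j) LL'.
have cl x j : A x -> (cell L' h (y x j) < p.+1)%N.
  move=> Ax; apply: cell_lt => //; first exact: bnd'.
  rewrite -[p.+1%:R]natr1 [ltRHS]mulrDl mul1r (_ : p%:R * h = 2 * L') ?ltrDl//.
  by rewrite /h; field; rewrite gt_eqF.
pose code x : {ffun J -> 'I_p.+1} := [ffun j => inord (cell L' h (y x j))].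
have /choice[c Hc] : forall k : {ffun J -> 'I_p.+1}, exists x : 'rV[R]_m,
    forall x', A x' -> code x' = k -> A x /\ code x = k.
  move=> k; have [[x Hx]|nx] := pselect (exists x, A x /\ code x = k).
    by exists x.
  by exists 0 => x' Ax' kx'; case: nx; exists x'.
pose q := #|{ffun J -> 'I_p.+1}|.
pose ctr (i : nat) : 'rV[R]_m :=
  if insub i is Some k then c (enum_val (k : 'I_q)) else 0.
exists `I_q, (fun i => \row_x (ctr i 0 x - C' * h)), (fun i => \row_x (ctr i 0 x + C' * h)).
split.
- by move=> j _ i; rewrite !mxE lerD2l ge0_cp// mulr_ge0// ltW.
- move=> x Ax; exists (enum_rank (code x)); first exact: ltn_ord.
  move=> i; rewrite !mxE /ctr valK enum_rankK.
  have [Ac cc] := Hc (code x) x Ax erefl.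
  have close j : `|y x j - y (c (code x)) j| <= h.
    apply: (@cell_close R L') => //; [exact: bnd'|exact: bnd'|].
    have := congr1 (fun f : {ffun J -> 'I_p.+1} => val (f j)) cc.
    by rewrite !ffunE /= !inordK ?cl.
  have := lip _ _ _ _ _ (ltW h0) (Hy _ Ax) (Hy _ Ac) close i.
  have : C * h <= C' * h.
    by rewrite ler_wpM2r// ltW.
  by rewrite ler_norml; lra.
under eq_esum => i _.
  rewrite (eq_bigr (fun=> 2 * C' * h)); last by move=> x _; rewrite !mxE; ring.
  rewrite prodr_const card_ord; over.
rewrite esum_fset; last 2 first.
- exact: finite_II.
- by move=> i _; rewrite lee_fin exprn_ge0// !mulr_ge0// ltW.
rewrite -fsbig_ord/= sumEFin lee_fin sumr_const card_ord.
rewrite /q card_ffun card_ord.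
have -> : 2 * C' * h = 4 * L' * C' / p%:R.
  by rewrite /h; field; rewrite gt_eqF.
rewrite expr_div_n -[leLHS]mulr_natr.
apply: (@le_trans _ _ ((4 * L' * C') ^+ m / p%:R ^+ m * (2 * p%:R) ^+ #|J|)).
  apply: ler_wpM2l.
    by rewrite divr_ge0 ?exprn_ge0// !mulr_ge0// ltW.
  by rewrite natrX lerXn2r ?nnegrE ?mulr_ge0// -natrM ler_nat mul2n -addnn -addn1 leq_add2l.
have pm : p%:R ^+ #|J| / p%:R ^+ m <= p%:R^-1 :> R.
  rewrite -(subnK Jm) -addSnnS exprD exprS.
  rewrite invfM mulrCA divff ?mulr1 ?expf_neq0 ?gt_eqF//.
  rewrite invfM ger_pMr ?invr_gt0// invf_le1 ?exprn_gt0//.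
  by rewrite exprn_ege1// ler1n.
have -> : (4 * L' * C') ^+ m / p%:R ^+ m * (2 * p%:R) ^+ #|J| =
    K * (p%:R ^+ #|J| / p%:R ^+ m).
  by rewrite [(2 * _) ^+ _]exprMn /K; ring.
apply: le_trans (ler_wpM2l K0 pm) _.
by rewrite ler_pdivrMr// mulrC -ler_pdivrMr.
Qed.

(** Boxes with rational data form a countable base, so nullity is local. *)
Lemma lebesgue_null_local A :
  (forall x, A x -> exists2 r : R, 0 < r &
     lebesgue_null (A `&` [set y | `|y - x| < r])) ->
  lebesgue_null A.
Proof.
move=> loc.
pose B (ce : 'rV[rat]_m * nat) : set 'rV[R]_m :=
  [set y | A y /\ forall i, `|y 0 i - ratr (ce.1 0 i)| < ce.2.+1%:R^-1].
pose B' ce := if `[< lebesgue_null (B ce) >] then B ce else set0.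
apply: (@lebesgue_null_sub _ (\bigcup_ce B' ce)); last first.
  apply: lebesgue_null_countable => ce; rewrite /B'.
  by case: asboolP => // _; exact: lebesgue_null0.
move=> x Ax; have [r r0 nr] := loc x Ax.
have [N [u [uE u0 ur]]] : exists N u, [/\ u = N.+1%:R^-1 :> R, 0 < u & 2 * u < r].
  exists (Num.truncn (2 / r)), (Num.truncn (2 / r)).+1%:R^-1; split=> //.
  rewrite ltr_pdivrMr// mulrC -ltr_pdivrMr//; exact: truncnS_gt.
have /choice[c Hc] : forall i : 'I_m, exists c : rat, `|x 0 i - ratr c| < u.
  move=> i.
  have lt_itv : x 0 i - u < x 0 i + u by lra.
  have [c] := rat_in_itvoo lt_itv.
  by rewrite in_itv/= => /andP[c1 c2]; exists c; rewrite ltr_norml; lra.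
have Bx : B (\row_i c i, N) x by split=> // i; rewrite mxE -uE.
exists (\row_i c i, N) => //; rewrite /B'; case: asboolP => //; case.
apply: lebesgue_null_sub nr => y [Ay By]; split=> //=.
apply: le_lt_trans ur; apply: mx_norm_le => [|j i]; first by rewrite mulr_ge0// ltW.
rewrite ord1 mxE [(- x) 0 i]mxE.
by have := By i; have := Hc i; rewrite !mxE/= -uE !ltr_norml ler_norml; lra.
Qed.

End NullSets.

(** * Rank deficiency along a curve of weights *)

Section RankDeficiency.
Variables (R : realType) (n d k : nat).
Hypothesis kd : (k < d)%N.

Definition comb (c : 'I_n -> R) (Z : 'I_n -> 'M[R]_(d, k)) := \sum_j c j *: Z j.

(** A kernel vector is scaled so that its largest coordinate is 1. *)
Lemma rank_deficientP (Z : 'M[R]_(d, k)) : ~ full_rank Z ->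
  exists (s : 'I_k) (v : 'cV[R]_k),
    [/\ Z *m v = 0, v s 0 = 1 & forall r, `|v r 0| <= 1].
Proof.
move=> /existsNP[v /not_implyP[Zv /eqP v0]].
have [r0 vr0] : exists r, v r 0 != 0.
  apply/existsP; apply: contraNT v0 => /existsPn H; apply/eqP/colP => r.
  by rewrite mxE; apply/eqP; have := H r; rewrite negbK.
have [s smax] : exists s, forall r, `|v r 0| <= `|v s 0|.
  have := @arg_maxP _ _ _ r0 xpredT (fun r => `|v r 0|) isT.
  by case=> s _ H; exists s => r; exact: H.
have vs0 : v s 0 != 0.
  by rewrite -normr_gt0 (lt_le_trans _ (smax r0))// normr_gt0.
exists s, ((v s 0)^-1 *: v); split.
- by rewrite -scalemxAr Zv scaler0.
- by rewrite mxE mulVf.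
- by move=> r; rewrite mxE normrM normfV mulrC ler_pdivrMr ?normr_gt0// mul1r.
Qed.

Variables (c : R -> 'I_n -> R) (K : R).
Hypothesis c_ge0 : forall t : R, 0 <= t -> forall i, 0 <= c t i.
Hypothesis c_sum : forall t : R, 0 <= t -> \sum_i c t i = 1.
Hypothesis K_ge0 : 0 <= K.
Hypothesis c_lip : forall s t : R, 0 <= s -> 0 <= t -> forall i,
  `|c s i - c t i| <= K * `|s - t|.

Definition deficient (T : R) (Z : 'I_n -> 'M[R]_(d, k)) :=
  exists2 t : R, 0 <= t <= T & ~ full_rank (comb (c t) Z).

Let Idx := ('I_n * 'I_d * 'I_k)%type.

Definition tensor_mx (z : Idx -> R) (i : 'I_n) : 'M[R]_(d, k) :=
  \matrix_(a, b) z (i, a, b).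

Variables (i0 : 'I_n) (s0 : 'I_k).

Let d_gt0 : (0 < d)%N. Proof. exact: leq_ltn_trans kd. Qed.
Let last : 'I_d := Ordinal (ltac:(by rewrite prednK) : (d.-1 < d)%N).

Lemma card_free : (#|{: {x : Idx | x != (i0, last, s0)}}| < #|{: Idx}|)%N.
Proof.
rewrite card_sig.
rewrite [X in (X < _)%N](_ : _ = #|predC1 (i0, last, s0)|); last exact: eq_card.
by rewrite cardC1 ltn_predL; apply/card_gt0P; exists (i0, last, s0).
Qed.

(** If column s of the combination depends on the others, then column s of the
    block Z_j is determined by the remaining entries, the time t and the k - 1
    coefficients v. Column s of the block has d > k entries: t and the
    coefficients are stored in the first k of these and the last one is
    constant, so that one coordinate is saved. *)
Definition chart (z : Idx -> R) (j : 'I_n) (s : 'I_k) (t : R) (v : 'cV[R]_k)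
    (x : Idx) : R :=
  if (x.1.1 == j) && (x.2 == s) then
    if insub (val x.1.2) is Some r then
      if r == s then t else v r 0
    else 0
  else z x.

(* The coordinate saved by chart depends on the piece; the swap moves it to a fixed
   place, so that all pieces share one index type. *)
Let swap (j : 'I_n) (s : 'I_k) : {perm Idx} := tperm (i0, last, s0) (j, last, s).

(** Besides the column s that is combined from the others, a piece fixes a block j
    with weight at least 1 / n, so that dividing by this weight costs a bounded
    factor. *)
Definition piece (T L : R) (z : Idx -> R) (js : 'I_n * 'I_k)
    (y : {x : Idx | x != (i0, last, s0)} -> R) : Prop :=
  exists (t : R) (v : 'cV[R]_k),
    [/\ 0 <= t <= T, n%:R^-1 <= c t js.1,
        v js.2 0 = 1 /\ (forall r, `|v r 0| <= 1),
        forall a, \sum_(x : 'I_n * 'I_k) c t x.1 * v x.2 0 * z (x.1, a, x.2) = 0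
      & (forall x, `|z x| <= L)
        /\ forall x, y x = chart z js.1 js.2 t v (swap js.1 js.2 (val x))].

Lemma deficient_piece (T L : R) (z : Idx -> R) : (forall x, `|z x| <= L) ->
  deficient T (tensor_mx z) -> exists js y, piece T L z js y.
Proof.
move=> zL [t /andP[t0 tT] /rank_deficientP[s [v [Zv vs v1]]]].
have [j cj] : exists j, n%:R^-1 <= c t j.
  apply/existsP; apply: contraT => /existsPn H.
  have : \sum_i c t i < \sum_(i < n) n%:R^-1.
    apply: ltr_sum => [|i _]; last by have := H i; rewrite -ltNge.
    by apply/hasP; exists i0 => //; exact: mem_index_enum.
  rewrite c_sum// sumr_const card_ord -[ltRHS]mulr_natr mulVf ?ltxx//.
  by rewrite pnatr_eq0 -lt0n (leq_ltn_trans _ (ltn_ord i0)).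
exists (j, s), (fun x => chart z j s t v (swap j s (val x))), t, v; split=> //.
  by rewrite t0.
move=> a; have := congr1 (fun M : 'cV[R]_d => M a 0) Zv.
rewrite [RHS]mxE /comb mulmx_suml summxE; apply: etrans.
transitivity (\sum_i \sum_b c t i * v b 0 * z (i, a, b)).
  by rewrite pair_bigA.
apply: eq_bigr => i _; rewrite -scalemxAl mxE mxE mulr_sumr; apply: eq_bigr => b _.
by rewrite mxE; ring.
Qed.

Lemma piece_bounded (T L : R) z js y : piece T L z js y ->
  forall x, `|y x| <= T + L + 1.
Proof.
move=> [t [v [/andP[t0 tT] _ [_ v1] _ [zL yE]]]] x; rewrite yE /chart.
have T0 := le_trans t0 tT.
have L0 : 0 <= L by exact: le_trans (normr_ge0 _) (zL (i0, last, s0)).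
case: ifP => _; last by have := zL (swap js.1 js.2 (val x)); lra.
case: insubP => [r _ _|_]; last by rewrite normr0 !addr_ge0.
case: ifP => _; first by rewrite ger0_norm//; lra.
by have := v1 r; lra.
Qed.

(** Subtracting the linear relations of two points of a piece expresses the
    difference of the entries in column s of block j by differences of stored
    coordinates. *)
Lemma piece_lipschitz (T L : R) z z' js y y' (e : R) : 0 <= e ->
  piece T L z js y -> piece T L z' js y' ->
  (forall x, `|y x - y' x| <= e) ->
  forall x, `|z x - z' x| <= (n%:R * (n * k)%:R * (1 + L * (1 + K)) + 1) * e.
Proof.
case: js => j s e0 [t [v [/andP[t0 tT] cj [vs v1] zv [zL yE]]]].
move=> [t' [v' [/andP[t'0 t'T] _ [v's v'1] z'v [z'L y'E]]]] /= yy'.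
rewrite /= in cj vs v's yE y'E.
have L0 : 0 <= L by exact: le_trans (normr_ge0 _) (zL (i0, last, s0)).
have chart_close x : `|chart z j s t v x - chart z' j s t' v' x| <= e.
  have [->|xl] := eqVneq x (j, last, s).
    rewrite /chart /= !eqxx/= insubN ?subrr ?normr0// -leqNgt.
    by rewrite -ltnS prednK.
  have xf : swap j s x != (i0, last, s0).
    by rewrite -(inj_eq (@perm_inj _ (swap j s))) tpermK tpermL.
  have := yy' (Sub (swap j s x) xf); rewrite yE y'E SubK.
  by rewrite /swap tpermK.
have tt' : `|t - t'| <= e.
  have := chart_close (j, widen_ord (ltnW kd) s, s).
  rewrite /chart /= !eqxx/=; case: insubP => [r _ rs|]; last by rewrite ltn_ord.
  by have -> : r = s by [exact/val_inj]; rewrite eqxx.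
have vv' r : `|v r 0 - v' r 0| <= e.
  have [->|rs] := eqVneq r s; first by rewrite vs v's subrr normr0.
  have := chart_close (j, widen_ord (ltnW kd) r, s).
  rewrite /chart /= !eqxx/=; case: insubP => [r' _ rr'|]; last by rewrite ltn_ord.
  by have -> : r' = r by [exact/val_inj]; rewrite (negbTE rs).
have c1 (u : R) i : 0 <= u -> c u i <= 1.
  move=> u0; rewrite -(c_sum u0) (bigD1 i)//= lerDl sumr_ge0// => l _.
  exact: c_ge0.
have off i a b : (i, b) != (j, s) -> `|z (i, a, b) - z' (i, a, b)| <= e.
  move=> ne; have := chart_close (i, a, b); rewrite /chart /=.
  by case: ifP => // /andP[/eqP ij /eqP bs]; move: ne; rewrite ij bs eqxx.
have cjp : 0 < c t j.
  apply: lt_le_trans cj; rewrite invr_gt0 ltr0n.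
  exact: leq_ltn_trans (ltn_ord i0).
have Ce : e <= (n%:R * (n * k)%:R * (1 + L * (1 + K)) + 1) * e.
  rewrite mulrDl mul1r lerDr mulr_ge0// !mulr_ge0// addr_ge0// mulr_ge0//.
  by rewrite addr_ge0.
move=> [[i a] b]; have [ib|ib] := eqVneq (i, b) (j, s); last first.
  by apply: le_trans Ce; exact: off.
case: ib => -> ->.
(* the difference of the two linear relations, solved for the entry *)
have key : c t j * (z (j, a, s) - z' (j, a, s)) =
    - (\sum_(x | x != (j, s)) c t x.1 * v x.2 0 * (z (x.1, a, x.2) - z' (x.1, a, x.2)))
    - \sum_x (c t x.1 * v x.2 0 - c t' x.1 * v' x.2 0) * z' (x.1, a, x.2).
  have : \sum_x (c t x.1 * v x.2 0 * (z (x.1, a, x.2) - z' (x.1, a, x.2))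
     + (c t x.1 * v x.2 0 - c t' x.1 * v' x.2 0) * z' (x.1, a, x.2)) = 0.
    transitivity (\sum_(x : 'I_n * 'I_k) c t x.1 * v x.2 0 * z (x.1, a, x.2) -
        \sum_(x : 'I_n * 'I_k) c t' x.1 * v' x.2 0 * z' (x.1, a, x.2)).
      by rewrite -sumrB; apply: eq_bigr => x _; ring.
    by rewrite zv z'v subrr.
  rewrite big_split/= (bigD1 (j, s))//= vs mulr1.
  set S1 := \sum_(x | _) _; set S2 := \sum_x _.
  by move=> S0; apply/eqP; rewrite -subr_eq0 opprD !opprK addrA; apply/eqP.
have B1 : `|\sum_(x | x != (j, s)) c t x.1 * v x.2 0 *
    (z (x.1, a, x.2) - z' (x.1, a, x.2))| <= (n * k)%:R * e.
  apply: le_trans (ler_norm_sum _ _ _) _.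
  apply: (@le_trans _ _ (\sum_(x : 'I_n * 'I_k) e)); last first.
    by rewrite sumr_const card_prod !card_ord mulr_natl.
  rewrite [leRHS](bigD1 (j, s))//= ler_wpDl//; apply: ler_sum => -[i' b'] ne /=.
  rewrite !normrM -[leRHS]mul1r ler_pM//; last exact: off.
  rewrite -[leRHS]mul1r ler_pM// ger0_norm ?c1 ?c_ge0//.
have B2 : `|\sum_x (c t x.1 * v x.2 0 - c t' x.1 * v' x.2 0) * z' (x.1, a, x.2)|
    <= (n * k)%:R * ((1 + K) * e * L).
  apply: le_trans (ler_norm_sum _ _ _) _.
  apply: (@le_trans _ _ (\sum_(x : 'I_n * 'I_k) ((1 + K) * e * L))); last first.
    by rewrite sumr_const card_prod !card_ord mulr_natl.
  apply: ler_sum => -[i' b'] _ /=; rewrite normrM ler_pM//.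
  have -> : c t i' * v b' 0 - c t' i' * v' b' 0 =
    c t i' * (v b' 0 - v' b' 0) + (c t i' - c t' i') * v' b' 0 by ring.
  rewrite [leRHS]mulrDl mul1r (le_trans (ler_normD _ _))// !normrM lerD//.
    rewrite -[leRHS]mul1r ler_pM// ger0_norm ?c1 ?c_ge0//.
  rewrite -[leRHS]mulr1 ler_pM//.
  by apply: le_trans (c_lip t0 t'0 i') _; rewrite ler_wpM2l.
have B : c t j * `|z (j, a, s) - z' (j, a, s)| <=
    (n * k)%:R * (1 + L * (1 + K)) * e.
  rewrite -(gtr0_norm cjp) -normrM key (le_trans (ler_normB _ _))// normrN.
  by apply: le_trans (lerD B1 B2) _; rewrite le_eqVlt; apply/orP; left; apply/eqP; ring.
have n0 : 0 < n%:R :> R by rewrite ltr0n; exact: leq_ltn_trans (ltn_ord i0).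
apply: (@le_trans _ _ (n%:R * ((n * k)%:R * (1 + L * (1 + K)) * e))); last first.
  by rewrite !mulrA mulrDl mul1r lerDl.
apply: le_trans (ler_wpM2l (ltW n0) B); rewrite mulrA -[leLHS]mul1r ler_wpM2r//.
by rewrite -[leLHS](mulfV (lt0r_neq0 n0)) ler_wpM2l// ltW.
Qed.

Lemma deficient_not_cube (T : R) (z0 : Idx -> R) (delta : R) : 0 < delta ->
  exists z, (forall x, `|z x - z0 x| <= delta) /\ ~ deficient T (tensor_mx z).
Proof.
move=> delta0; apply: contrapT => H.
pose L := \sum_x `|z0 x| + delta.
have zL z : (forall x, `|z x - z0 x| <= delta) -> forall x, `|z x| <= L.
  move=> zz0 x; rewrite -(subrK (z0 x) (z x)) (le_trans (ler_normD _ _))//.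
  by rewrite addrC lerD// (bigD1 x)//= lerDl sumr_ge0.
apply: (@lipschitz_not_cube R _ _ _ (T + L + 1) _ delta z0 (piece T L)
  card_free delta0).
- move=> z zz0; apply: deficient_piece; first exact: zL.
  by apply: contrapT => nd; apply: H; exists z.
- by move=> z f y Rzy; exact: piece_bounded Rzy.
- by move=> z z' f y y' e e0 R1 R2 yy'; exact: piece_lipschitz e0 R1 R2 yy'.
Qed.

Lemma deficient_null (m : nat) (T L C : R) (A : set 'rV[R]_m)
    (phi : 'rV[R]_m -> Idx -> R) :
  (#|{: Idx}| <= m)%N -> 0 <= C ->
  (forall x, A x -> forall i, `|phi x i| <= L) ->
  (forall x x' (e : R), A x -> A x' -> 0 <= e ->
     (forall i, `|phi x i - phi x' i| <= e) ->
     forall l, `|x 0 l - x' 0 l| <= C * e) ->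
  lebesgue_null (A `&` [set x | deficient T (tensor_mx (phi x))]).
Proof.
move=> Nm C0 phiL lip.
pose P (js : 'I_n * 'I_k) := [set x | A x /\ exists y, piece T L (phi x) js y].
apply: (@lebesgue_null_sub _ _ _ (\bigcup_js P js)).
  by move=> x [Ax /(deficient_piece (phiL x Ax))[js [y H]]]; exists js => //; split=> //; exists y.
apply: lebesgue_null_countable => js.
apply: (@lipschitz_null R m _ (P js) (T + L + 1)
  (C * (n%:R * (n * k)%:R * (1 + L * (1 + K)) + 1))
  (fun x y => A x /\ piece T L (phi x) js y)).
- exact: leq_trans card_free Nm.
- by move=> x [Ax [y Hy]]; exists y.
- by move=> x y [_ Hy]; exact: piece_bounded Hy.
- move=> x x' y y' e e0 [Ax Hy] [Ax' Hy'] yy' i; rewrite -mulrA; apply: lip => //.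
    have L0 : 0 <= L by exact: le_trans (normr_ge0 _) (phiL x Ax (i0, last, s0)).
    rewrite mulr_ge0// addr_ge0// !mulr_ge0// addr_ge0// mulr_ge0//.
    by rewrite addr_ge0.
  by move=> l; exact: piece_lipschitz e0 Hy Hy' yy' l.
Qed.

End RankDeficiency.

(** * Immersions are locally bi-Lipschitz *)

Lemma near_norm (R : realType) (V : normedModType R) (x0 : V) (P : V -> Prop) :
  (\forall y \near x0, P y) ->
  exists2 r : R, 0 < r & forall y, `|y - x0| < r -> P y.
Proof.
move=> /nbhs_ballP[r r0 Hr]; exists r => // y yr; apply: Hr.
by rewrite -ball_normE/= distrC.
Qed.

Section Immersions.
Variables (R : realType) (m : nat) (W : normedModType R).
Variables (f : 'rV[R]_m -> W) (U : set 'rV[R]_m) (x0 : 'rV[R]_m).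
Hypotheses (oU : open U) (Ux0 : U x0) (f1 : class_C 1 U f).

Let df x : U x -> differentiable f x. Proof. by case: f1 => + _; apply. Qed.

Lemma deriv_coord x (v : 'rV[R]_m) : U x ->
  'D_v f x = \sum_i v 0 i *: 'D_(delta_mx 0 i) f x.
Proof.
move=> Ux; rewrite deriveE; last exact: df.
rewrite {1}[v]row_sum_delta linear_sum; apply: eq_bigr => i _.
by rewrite linearZ/= deriveE//; exact: df.
Qed.

Lemma deriv_close (e : R) : 0 < e -> exists2 r : R, 0 < r &
  forall y, `|y - x0| < r -> U y /\ forall v : 'rV[R]_m,
    `|'D_v f y - 'D_v f x0| <= e * `|v|.
Proof.
move=> e0.
have e1 : 0 < e / m.+1%:R by rewrite divr_gt0.
have near1 : \forall y \near x0, U y /\ forall i : 'I_m,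
    `|'D_(delta_mx 0 i) f x0 - 'D_(delta_mx 0 i) f y| <= e / m.+1%:R.
  near=> y; split; first by near: y; exact: open_nbhs_nbhs.
  near: y; apply: filter_forall => i.
  have [_ /(_ (delta_mx 0 i)) /(_ x0 Ux0)] := f1.
  by move=> /cvgrPdist_le/(_ _ e1).
have [r r0 Hr] := near_norm near1; exists r => // y yr.
have [Uy Hy] := Hr y yr; split=> // v.
rewrite !deriv_coord// -sumrB (le_trans (ler_norm_sum _ _ _))//.
apply: (@le_trans _ _ (\sum_(i < m) (e / m.+1%:R * `|v|))).
  apply: ler_sum => i _; rewrite -scalerBr normrZ mulrC ler_pM//.
    by rewrite distrC.
  exact: le_mx_norm.
rewrite sumr_const card_ord -[leLHS]mulr_natr mulrAC ler_wpM2r//.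
by rewrite -mulrA ler_piMr ?(ltW e0)// mulrC ler_pdivrMr// mul1r ler_nat.
Unshelve. all: by end_near. Qed.

(** The mean value theorem holds for real functions only; a functional L reduces
    the claim to the function L o f on a segment. *)
Lemma mean_value_functional (L : W -> R) (e r : R) :
  (forall w w', L (w - w') = L w - L w') -> (forall (a : R) w, L (a *: w) = a * L w) ->
  (forall w, `|L w| <= `|w|) ->
  (forall y, `|y - x0| < r -> U y /\ forall v : 'rV[R]_m,
    `|'D_v f y - 'D_v f x0| <= e * `|v|) ->
  forall x x', `|x - x0| < r -> `|x' - x0| < r ->
    `|L (f x - f x' - 'D_(x - x') f x0)| <= e * `|x - x'|.
Proof.
move=> LB LZ L1 H x x' xr x'r; set v := x - x'.
pose path (s : R) := x' + s *: v.
have path_in s : 0 <= s <= 1 -> `|path s - x0| < r.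
  move=> /andP[s_ge0 s1].
  have -> : path s - x0 = (1 - s) *: (x' - x0) + s *: (x - x0).
    rewrite scalerBl scale1r -[RHS]addrA [- (s *: _) + _]addrC -scalerBr opprB addrA subrK.
    by rewrite /path addrAC.
  rewrite (le_lt_trans (ler_normD _ _))// !normrZ ger0_norm ?subr_ge0// ger0_norm//.
  apply: (@le_lt_trans _ _ (Num.max `|x' - x0| `|x - x0|)); last first.
    by rewrite gt_max x'r.
  have : `|x' - x0| <= Num.max `|x' - x0| `|x - x0| by rewrite le_max lexx.
  have : `|x - x0| <= Num.max `|x' - x0| `|x - x0| by rewrite le_max lexx orbT.
  by nra.
have dg (s : R) : 0 <= s <= 1 ->
    is_derive s (1 : R) (fun u => L (f (path u))) (L ('D_v f (path s))).
  move=> s01; have [Up _] := H _ (path_in s s01).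
  have dv : derivable f (path s) v by apply: diff_derivable; exact: df.
  have cv : L (h^-1 *: (f (h *: v + path s) - f (path s))) @[h --> 0^'] -->
      L ('D_v f (path s)).
    apply/cvgrPdist_le => eps eps0; have /cvgrPdist_le/(_ eps eps0) := dv.
    by apply: filterS => h; apply: le_trans; rewrite -LB.
  have E : (fun h : R => h^-1 *: (L (f (path (h *: 1 + s))) - L (f (path s)))) =
      (fun h => L (h^-1 *: (f (h *: v + path s) - f (path s)))).
    apply/funext => h; rewrite LZ LB /path; congr (_ * (L (f _) - _)).
    have -> : h *: (1 : R) = h by exact: mulr1.
    by rewrite scalerDl addrCA.
  apply: DeriveDef.
    by apply/cvg_ex; exists (L ('D_v f (path s))); rewrite /= E.
  by apply/cvg_lim => //=; rewrite E.
have [||s] := @MVT_segment R (fun u => L (f (path u)))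
   (fun s => L ('D_v f (path s))) 0 1 ler01.
- by move=> s; rewrite in_itv/= => /andP[s0 s1]; apply: dg; rewrite !ltW.
- apply: continuous_in_subspaceT => s; rewrite inE/= in_itv/= => s01.
  have [dd _] := dg s s01.
  by apply: differentiable_continuous; apply/derivable1_diffP.
rewrite in_itv/= => s01; rewrite /path scale1r scale0r addr0 subr0 mulr1.
have -> : x' + v = x by rewrite /v addrC subrK.
move=> E; rewrite !LB E -LB.
by apply: le_trans (L1 _) _; have [_] := H _ (path_in s s01); apply.
Qed.

(** An injective differential is bounded below on the compact unit sphere. *)
Lemma injective_diff_lower : injective ('d f x0) -> exists2 c : R, 0 < c &
  forall v : 'rV[R]_m, c * `|v| <= `|'D_v f x0|.
Proof.
move=> inj; have dx0 := df Ux0.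
have DE v : 'D_v f x0 = 'd f x0 v by rewrite deriveE.
pose S := [set v : 'rV[R]_m | `|v| = 1].
have [S0|/set0P S0] := eqVneq S set0.
  exists 1 => // v; have [->|v0] := eqVneq v 0; first by rewrite normr0 mulr0.
  have : S (`|v|^-1 *: v).
    by rewrite /S/= normrZ ger0_norm ?invr_ge0// mulVf// normr_eq0.
  by rewrite S0.
have cS : compact S.
  apply: bounded_closed_compact.
    exists 1; split; first by rewrite num_real.
    by move=> x x1 v /= ->; rewrite ltW.
  have -> : S = (fun v : 'rV[R]_m => `|v|) @^-1` [set 1] by [].
  by apply: closed_comp => [v _|]; [exact: norm_continuous|exact: closed_eq].
have cont : continuous (fun v : 'rV[R]_m => `|'d f x0 v|).
  move=> v; apply: continuous_comp; last exact: norm_continuous.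
  exact: diff_continuous.
have [v vS Hv] := @EVT_min_rV R m (fun v => `|'d f x0 v|) S S0 cS
  (continuous_subspaceT cont).
have v1 : `|v| = 1 by move: vS; rewrite inE.
have v0 : v != 0 by rewrite -normr_eq0 v1 oner_eq0.
exists `|'d f x0 v|.
  rewrite normr_gt0; apply: contra_neq v0 => dv.
  by apply: inj; rewrite dv linear0.
move=> u; rewrite DE; have [->|u0] := eqVneq u 0; first by rewrite normr0 mulr0.
have nu : 0 < `|u| by rewrite normr_gt0.
rewrite -ler_pdivlMr//.
have -> : `|'d f x0 u| / `|u| = `|'d f x0 (`|u|^-1 *: u)|.
  by rewrite linearZ/= normrZ ger0_norm ?invr_ge0// mulrC.
apply: Hv; rewrite inE /S/= normrZ ger0_norm ?invr_ge0// mulVf// gt_eqF//.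
Qed.

(** The family F of functionals computes the norm of W, so that the previous
    estimate bounds the distance of f to its differential at x0. *)
Lemma immersion_bilipschitz (F : set (W -> R)) :
  (forall L, F L -> [/\ forall w w', L (w - w') = L w - L w',
     forall (a : R) w, L (a *: w) = a * L w & forall w, `|L w| <= `|w|]) ->
  (forall w (b : R), 0 <= b -> (forall L, F L -> `|L w| <= b) -> `|w| <= b) ->
  injective ('d f x0) ->
  exists c C r : R, [/\ 0 < c, 0 <= C, 0 < r & forall x x',
    `|x - x0| < r -> `|x' - x0| < r ->
    [/\ U x, c * `|x - x'| <= `|f x - f x'| & `|f x - f x'| <= C * `|x - x'|]].
Proof.
move=> Flin Fnorm inj; have [c c0 Hc] := injective_diff_lower inj.
have c2 : 0 < c / 2 by rewrite divr_gt0.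
have [r r0 Hr] := deriv_close c2.
pose C := \sum_i `|'D_(delta_mx 0 i) f x0|.
have C0 : 0 <= C by rewrite sumr_ge0.
exists (c / 2), (C + c / 2), r; split=> //; first by rewrite addr_ge0// ltW.
move=> x x' xr x'r.
have close : `|f x - f x' - 'D_(x - x') f x0| <= c / 2 * `|x - x'|.
  apply: Fnorm => [|L FL]; first by rewrite mulr_ge0// ltW.
  by have [LB LZ L1] := Flin L FL; exact: mean_value_functional LB LZ L1 Hr _ _ xr x'r.
split; first by have [] := Hr x xr.
  have := Hc (x - x'); have := ler_normB (f x - f x') (f x - f x' - 'D_(x - x') f x0).
  by rewrite subKr; move: close; set A := `|f x - f x' - _|; lra.
have : `|'D_(x - x') f x0| <= C * `|x - x'|.
  rewrite deriv_coord// (le_trans (ler_norm_sum _ _ _))// mulr_suml.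
  by apply: ler_sum => i _; rewrite normrZ mulrC ler_wpM2l// le_mx_norm.
have := ler_normD (f x - f x' - 'D_(x - x') f x0) ('D_(x - x') f x0).
by rewrite subrK; move: close; set A := `|f x - f x' - _|; lra.
Qed.

End Immersions.

(** * Stability of full rank *)

Section FullRankOpen.
Variables (R : realType) (S : Type) (F : set_system S).
Context {FF : Filter F}.

Lemma cvg_det (k : nat) (M : S -> 'M[R]_k) (L : 'M[R]_k) :
  (forall i j, M x i j @[x --> F] --> L i j) ->
  \det (M x) @[x --> F] --> \det L.
Proof.
move=> cM; apply: cvg_sumr => s _; apply: cvgM; first exact: cvg_cst.
by apply: cvg_big => [|i _]; [exact: mul_continuous|exact: cM].
Qed.

Lemma full_rank_near (d k : nat) (M : S -> 'M[R]_(d, k)) (L : 'M[R]_(d, k)) :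
  (forall i j, M x i j @[x --> F] --> L i j) -> full_rank L ->
  \forall x \near F, full_rank (M x).
Proof.
move=> cM /gram_unitmx; rewrite unitmxE unitfE => dL.
have c : \det ((M x)^T *m M x) @[x --> F] --> \det (L^T *m L).
  apply: cvg_det => i j; under eq_fun do rewrite mxE; rewrite mxE.
  apply: cvg_sumr => l _; under eq_fun do rewrite mxE; rewrite mxE.
  by apply: cvgM; exact: cM.
have /cvgr_dist_lt/(_ `|\det (L^T *m L)|) := c.
rewrite normr_gt0 => /(_ dL); apply: filterS => x.
rewrite /= => H; apply/gram_unitmx; rewrite unitmxE unitfE.
by apply: contraTneq H => ->; rewrite subr0 ltxx.
Qed.

Lemma cvg_comb (n d k : nat) (c : S -> 'I_n -> R)
    (Z : S -> 'I_n -> 'M[R]_(d, k)) (c0 : 'I_n -> R) (Z0 : 'I_n -> 'M[R]_(d, k)) :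
  (forall j, c x j @[x --> F] --> c0 j) ->
  (forall j a b, Z x j a b @[x --> F] --> Z0 j a b) ->
  forall a b, comb (c x) (Z x) a b @[x --> F] --> comb c0 Z0 a b.
Proof.
move=> cc cZ a b; rewrite /comb; under eq_fun do rewrite summxE; rewrite summxE.
apply: cvg_sumr => j _; under eq_fun do rewrite mxE; rewrite mxE.
by apply: cvgM; [exact: cc|exact: cZ].
Qed.

End FullRankOpen.

(** Uniformity in t comes from the compactness of [0, T]. *)
Lemma not_deficient_near (R : realType) (S : Type) (F : set_system S)
    (n d k : nat) (c : R -> 'I_n -> R) (T : R)
    (Z : S -> 'I_n -> 'M[R]_(d, k)) (Z0 : 'I_n -> 'M[R]_(d, k)) : Filter F ->
  (forall t : R, 0 <= t -> forall j, c s j @[s --> t] --> c t j) ->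
  (forall j a b, Z x j a b @[x --> F] --> Z0 j a b) ->
  ~ deficient c T Z0 -> \forall x \near F, ~ deficient c T (Z x).
Proof.
move=> FF cc cZ nd.
have /compact_near_coveringP := @segment_compact R 0 T.
move=> /(_ S F (fun x t => full_rank (comb (c t) (Z x))) FF) cov.
have : \near F, `[0, T] `<=` (fun t => full_rank (comb (c t) (Z F))).
  apply: cov => t; rewrite /= in_itv/= => /andP[t0 tT].
  have ft : full_rank (comb (c t) Z0).
    by apply: contrapT => nf; apply: nd; exists t => //; rewrite t0.
  apply: (full_rank_near (F := filter_prod (nbhs t) F)
     (M := fun tx => comb (c tx.1) (Z tx.2)) _ ft).
  apply: cvg_comb => [j|j a b].
    apply: (cvg_comp (fun tx : R * S => tx.1) (fun s => c s j)); last exact: cc.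
    exact: cvg_fst.
  apply: (cvg_comp (fun tx : R * S => tx.2) (fun x => Z x j a b)); last exact: cZ.
  exact: cvg_snd.
apply: filterS => x H [t t01 nf]; apply: nf; apply: H.
by rewrite /= in_itv.
Qed.

Section Regularity.
Variables (R : realType) (n d k : nat) (E : rel 'I_n) (a : 'I_n -> 'I_n -> R).
Variables (Phi : R -> 'M[R]_n) (q : 'I_n -> R).
Hypothesis dPhi : forall t : R, 0 <= t -> forall i j, is_derive t (1 : R)
  (fun s => Phi s i j) ((laplacian_flow E a *m Phi t) i j).
Hypothesis Phi_ge0 : forall t : R, 0 <= t -> forall i j, 0 <= Phi t i j.
Hypothesis Phi_sum : forall t : R, 0 <= t -> forall i, \sum_j Phi t i j = 1.
Hypothesis cPhi : forall i j, Phi t i j @[t --> +oo] --> q j.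

(** The limit weights are adjoined as a constant curve, of index None, so that
    finite times and the limit are treated alike. *)
Definition weights (o : option 'I_n) (t : R) (j : 'I_n) : R :=
  if o is Some i then Phi t i j else q j.

Lemma weights_ge0 o (t : R) : 0 <= t -> forall j, 0 <= weights o t j.
Proof.
case: o => [i|] t0 j /=; first exact: Phi_ge0.
apply: (cvgr_to_ge (@cPhi j j)); near=> s; apply: Phi_ge0.
by near: s; apply: nbhs_pinfty_ge; exact: num_real.
Unshelve. all: by end_near. Qed.

Lemma weights_sum (i0 : 'I_n) o (t : R) : 0 <= t -> \sum_j weights o t j = 1.
Proof.
case: o => [i|] t0 /=; first exact: Phi_sum.
have c1 : \sum_j Phi s i0 j @[s --> +oo] --> \sum_j q j.
  by apply: cvg_sumr => j _; exact: cPhi.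
apply: (cvg_unique _ c1) => //; apply: cvg_near_cst; near=> s; apply: Phi_sum.
by near: s; apply: nbhs_pinfty_ge; exact: num_real.
Unshelve. all: by end_near. Qed.

Lemma weights_lipschitz : exists2 K : R, 0 <= K & forall o (s t : R),
  0 <= s -> 0 <= t -> forall j, `|weights o s j - weights o t j| <= K * `|s - t|.
Proof.
pose G := laplacian_flow E a.
pose K := \sum_i \sum_l `|G i l|.
have K0 : 0 <= K by rewrite sumr_ge0// => i _; rewrite sumr_ge0.
exists K => // -[i|] s t s0 t0 j /=; last by rewrite subrr normr0 mulr_ge0.
have P1 u : 0 <= u -> forall l h, Phi u l h <= 1.
  move=> u0 l h; rewrite -(Phi_sum u0 l) (bigD1 h)//= lerDl sumr_ge0// => x _.
  exact: Phi_ge0.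
have dK (u : R) : 0 <= u -> `|(G *m Phi u) i j| <= K.
  move=> u0; rewrite mxE (le_trans (ler_norm_sum _ _ _))//.
  rewrite /K [leRHS](bigD1 i)//= ler_wpDr ?sumr_ge0// => [l _|].
    by rewrite sumr_ge0.
  apply: ler_sum => l _; rewrite normrM -[leRHS]mulr1 ler_pM//.
  by rewrite ger0_norm ?P1 ?Phi_ge0.
have dlin (u : R) : is_derive u (1 : R) (fun x => K * x) K.
  by apply: is_derive_eq; rewrite /GRing.scale/= mulr1.
have half (x y : R) : 0 <= x -> x <= y -> `|Phi y i j - Phi x i j| <= K * (y - x).
  move=> x0 xy; rewrite mulrBr.
  exact: (@derive_dominated R (fun s => Phi s i j) _ (fun u => K * u) (fun=> K)
    (fun u u0 => dPhi u0 i j) (fun u _ => dlin u) dK).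
have [st|ts] := leP s t.
  by rewrite distrC (distrC s) (ger0_norm (_ : 0 <= t - s)) ?subr_ge0// half.
by rewrite (gtr0_norm (_ : 0 < s - t)) ?subr_gt0// half// ltW.
Qed.

Lemma weights_cvg o (t : R) : 0 <= t -> forall j,
  weights o s j @[s --> t] --> weights o t j.
Proof.
case: o => [i|] t0 j /=; last exact: cvg_cst.
have := is_derive_continuous (dPhi t0 i j); exact.
Qed.

Lemma regularP (Z : 'I_n -> 'M[R]_(d, k)) : regular Phi q Z <->
  forall o (N : nat), ~ deficient (weights o) N%:R Z.
Proof.
split=> [[ft fq] [i|] N [t /andP[t0 _]]|H].
- by apply; exact: ft.
- by apply; exact: fq.
split=> [t t0 i|]; apply: contrapT => nf.
  apply: (H (Some i) (Num.truncn t).+1); exists t => //.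
  by rewrite t0 ltW// truncnS_gt.
by apply: (H None 0%N); exists 0 => //; rewrite lexx.
Qed.

(** Near infinity the rank is controlled by the limit q, and on the remaining
    segment by compactness. *)
Lemma regular_near (S : Type) (F : set_system S) (Z : S -> 'I_n -> 'M[R]_(d, k))
    (Z0 : 'I_n -> 'M[R]_(d, k)) : Filter F ->
  (forall j x y, Z s j x y @[s --> F] --> Z0 j x y) ->
  regular Phi q Z0 -> \forall s \near F, regular Phi q (Z s).
Proof.
move=> FF cZ [ft fq].
have fq' : full_rank (comb q Z0) by [].
have tail i : exists T : R, \forall s \near F,
    forall t : R, T <= t -> full_rank (comb (Phi t i) (Z s)).
  have : \forall tx \near filter_prod +oo F, full_rank (comb (Phi tx.1 i) (Z tx.2)).
    apply: (full_rank_near _ fq'); apply: cvg_comb => [j|j x y].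
      apply: (cvg_comp (fun tx : R * S => tx.1) (fun t => Phi t i j)); last exact: cPhi.
      exact: cvg_fst.
    apply: (cvg_comp (fun tx : R * S => tx.2) (fun s => Z s j x y)); last exact: cZ.
    exact: cvg_snd.
  move=> [[A B] [/= [T [_ HT]] FB] AB]; exists (T + 1).
  apply: filterS FB => s Bs t Tt; apply: (AB (t, s)); split=> //=.
  by apply: HT; rewrite (lt_le_trans _ Tt)// ltrDl.
have /choice[T HT] := tail.
have nd i : \forall s \near F, ~ deficient (weights (Some i)) (T i) (Z s).
  apply: not_deficient_near cZ _ => [t t0 j|]; first exact: (@weights_cvg (Some i) t t0 j).
  by move=> [t /andP[t0 _]]; apply; exact: ft.
have tails : \forall s \near F, forall i (t : R), T i <= t ->
    full_rank (comb (Phi t i) (Z s)).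
  by apply: filter_forall => i; exact: HT.
have nds : \forall s \near F, forall i, ~ deficient (weights (Some i)) (T i) (Z s).
  by apply: filter_forall => i; exact: nd.
have fqs : \forall s \near F, full_rank (comb q (Z s)).
  apply: full_rank_near fq'; apply: cvg_comb => // j; exact: cvg_cst.
near=> s; split; last by near: s.
move=> t t0 i; have [Tt|tT] := leP (T i) t.
  by move: i t Tt {t0}; near: s.
apply: contrapT => nf; have : ~ deficient (weights (Some i)) (T i) (Z s).
  by move: (i); near: s.
by apply; exists t => //; rewrite t0 ltW.
Unshelve. all: by end_near. Qed.

End Regularity.

(** * The factor pairs as a submanifold *)

(* joins completeness with the norm, as the statement of Baire's theorem needs *)
HB.instance Definition _ (R : realType) (p q : nat) :=
  Uniform_isComplete.Build 'M[R]_(p, q) (@mx_complete R p q).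

Section Ambient.
Variables (R : realType) (n d k : nat).
Hypothesis kd : (k < d)%N.
Local Notation amb := (ambient R n d k).

Lemma norm_blocks_le (p q : nat) (M : 'M[R]_(\sum_(i < n) p, q)) (e : R) :
  0 <= e -> (forall i, `|submxcol M i| <= e) -> `|M| <= e.
Proof.
move=> e0 H; apply: mx_norm_le => // x y.
rewrite -[M]submxcolK mxE.
exact: le_trans (le_mx_norm _ _ _) (H _).
Qed.

Lemma submxcol_norm_le (p q : nat) (M : 'M[R]_(\sum_(i < n) p, q)) i :
  `|submxcol M i| <= `|M|.
Proof. by apply: mx_norm_le => // x y; rewrite mxE le_mx_norm. Qed.

Lemma amb_norm (p : amb) : `|p| = Num.max `|p.1| `|p.2|.
Proof. by rewrite prod_normE. Qed.

Lemma submxcolB (p q : nat) (M N : 'M[R]_(\sum_(i < n) p, q)) i :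
  submxcol (M - N) i = submxcol M i - submxcol N i.
Proof. by apply/matrixP => x y; rewrite !mxE. Qed.

Lemma factor_lipschitz (B : R) : exists2 C : R, 0 <= C & forall p p' : amb,
  `|p| <= B -> `|p'| <= B ->
  forall i, `|factor p i - factor p' i| <= C * `|p - p'|.
Proof.
exists (k%:R * (`|B| + `|B|)); first by rewrite mulr_ge0.
move=> p p'; rewrite !amb_norm !ge_max => /andP[pB1 pB2] /andP[p'B1 p'B2] i.
have N0 : 0 <= Num.max `|(p - p').1| `|(p - p').2| by rewrite le_max normr_ge0.
have C0 : 0 <= k%:R * (`|B| + `|B|) :> R by rewrite mulr_ge0.
apply: mx_norm_le => [|x y]; first exact: mulr_ge0.
have -> : (factor p i - factor p' i) x y = \sum_l
    (submxcol p.1 i x l * submxcol (p - p').2 i l y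
     + submxcol (p - p').1 i x l * submxcol p'.2 i l y).
  have FE (p1 : amb) : factor p1 i x y =
    \sum_l submxcol p1.1 i x l * submxcol p1.2 i l y by rewrite mxE.
  rewrite mxE [(- factor p' i) x y]mxE !FE -sumrB; apply: eq_bigr => l _.
  by rewrite !mxE; ring.
apply: le_trans (ler_norm_sum _ _ _) _.
rewrite -mulrA mulr_natl -[X in _ *+ X](card_ord k) -sumr_const.
apply: ler_sum => l _; rewrite mulrDl (le_trans (ler_normD _ _))// !normrM lerD//.
  rewrite ler_pM//.
    apply: le_trans (le_mx_norm _ _ _) _; apply: le_trans (submxcol_norm_le _ _) _.
    exact: le_trans pB1 (ler_norm B).
  apply: le_trans (le_mx_norm _ _ _) _; apply: le_trans (submxcol_norm_le _ _) _.
  by rewrite le_max lexx orbT.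
rewrite mulrC ler_pM//.
  apply: le_trans (le_mx_norm _ _ _) _; apply: le_trans (submxcol_norm_le _ _) _.
  exact: le_trans p'B2 (ler_norm B).
apply: le_trans (le_mx_norm _ _ _) _; apply: le_trans (submxcol_norm_le _ _) _.
by rewrite le_max lexx.
Qed.

Lemma cvg_factor (p0 : amb) i x y :
  factor p i x y @[p --> p0] --> factor p0 i x y.
Proof.
rewrite /factor; under eq_fun do rewrite mxE; rewrite mxE.
have cs (p q : nat) u v :
    continuous (fun M : 'M[R]_(\sum_(i < n) p, q) => submxcol M i u v : R).
  rewrite (_ : (fun M => _) =
    (fun M : 'M[R]_(\sum_(i < n) p, q) => M (tagnat.Rank i u) v)).
    exact: coord_continuous.
  by apply/funext => M; rewrite mxE.
apply: cvg_sumr => l _; apply: cvgM.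
  apply: (cvg_comp (fun p : amb => p.1)
    (fun M : 'M[R]_(\sum_(i < n) d, k) => submxcol M i x l)); last exact: cs.
  exact: cvg_fst.
apply: (cvg_comp (fun p : amb => p.2)
  (fun M : 'M[R]_(\sum_(i < n) k, k) => submxcol M i l y)); last exact: cs.
exact: cvg_snd.
Qed.

(** Block by block, this is the Lipschitz dependence of the QR factors. *)
Lemma D_QR_lipschitz (p0 : amb) : D_QR p0 ->
  exists C r : R, [/\ 0 <= C, 0 < r & forall p p' : amb, D_QR p -> D_QR p' ->
    (forall i, `|factor p i - factor p0 i| < r) ->
    (forall i, `|factor p' i - factor p0 i| < r) ->
    forall e : R, 0 <= e -> (forall i, `|factor p i - factor p' i| <= e) ->
    `|p - p'| <= C * e].
Proof.
move=> /(D_QRP kd) qr0.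
have /choice[Cr HCr] : forall i, exists Cr : R * R, [/\ 0 <= Cr.1, 0 < Cr.2 &
    forall Z Z' Q T Q' T', is_qr Z Q T -> is_qr Z' Q' T' ->
    `|Z - factor p0 i| < Cr.2 -> `|Z' - factor p0 i| < Cr.2 ->
    `|Q - Q'| <= Cr.1 * `|Z - Z'| /\ `|T - T'| <= Cr.1 * `|Z - Z'|].
  move=> i; have [C [r H]] := qr_lipschitz (is_qr_full_rank (qr0 i)).
  by exists (C, r).
exists (\sum_i (Cr i).1), (\big[Num.min/1]_i (Cr i).2); split.
- by rewrite sumr_ge0// => i _; case: (HCr i).
- by apply/bigmin_gtP; split=> // i _; case: (HCr i).
move=> p p' /(D_QRP kd) qr1 /(D_QRP kd) qr2 pr p'r e e0 pp'.
have step i : `|submxcol p.1 i - submxcol p'.1 i| <= (\sum_i (Cr i).1) * e /\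
    `|submxcol p.2 i - submxcol p'.2 i| <= (\sum_i (Cr i).1) * e.
  have [C0 _ H] := HCr i.
  have le_r : \big[Num.min/1]_i (Cr i).2 <= (Cr i).2 by exact: bigmin_le.
  have [H1 H2] := H _ _ _ _ _ _ (qr1 i) (qr2 i) (lt_le_trans (pr i) le_r)
    (lt_le_trans (p'r i) le_r).
  have le_C : (Cr i).1 * `|factor p i - factor p' i| <= (\sum_i (Cr i).1) * e.
    rewrite ler_pM// (bigD1 i)//= lerDl sumr_ge0// => j _.
    by case: (HCr j).
  by split; [apply: le_trans H1 _|apply: le_trans H2 _].
have Ce : 0 <= (\sum_i (Cr i).1) * e.
  by rewrite mulr_ge0// sumr_ge0// => i _; case: (HCr i).
rewrite amb_norm ge_max; apply/andP; split; apply: norm_blocks_le => // i;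
  by rewrite submxcolB; case: (step i).
Qed.

(** Full rank being open, all tuples Z near the products of p0 factor, and the
    factors stay near p0. *)
Lemma D_QR_section (p0 : amb) : D_QR p0 ->
  exists C r : R, [/\ 0 <= C, 0 < r & forall (Z : 'I_n -> 'M[R]_(d, k)) (e : R),
    0 <= e -> e < r -> (forall i, `|Z i - factor p0 i| <= e) ->
    exists p : amb, [/\ D_QR p, forall i, factor p i = Z i & `|p - p0| <= C * e]].
Proof.
move=> Dp0; have [C [r [C0 r0 H]]] := D_QR_lipschitz Dp0.
have qr0 := (D_QRP kd p0).1 Dp0.
have /choice[rho Hrho] : forall i, exists rho : R, 0 < rho /\
    forall Z : 'M[R]_(d, k), `|Z - factor p0 i| < rho -> full_rank Z.
  move=> i.
  have /near_norm[rho rho0 Hr] : \forall Z \near factor p0 i, full_rank (Z : 'M[R]_(d, k)).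
    apply: (@full_rank_near R 'M[R]_(d, k) (nbhs (factor p0 i)) _ d k id _ _
      (is_qr_full_rank (qr0 i))) => x y.
    exact: coord_continuous.
  by exists rho.
exists C, (Num.min r (\big[Num.min/1]_i rho i)); split=> //.
  by rewrite lt_min r0; apply/bigmin_gtP; split=> // i _; case: (Hrho i).
move=> Z e e0; rewrite lt_min => /andP[er erho] HZ.
have /choice[QT HQT] : forall i, exists QT : 'M[R]_(d, k) * 'M[R]_k,
    is_qr (Z i) QT.1 QT.2.
  move=> i; have [|Q [T QT]] := @qr_exists R d k (Z i); last by exists (Q, T).
  apply: (Hrho i).2; apply: le_lt_trans (HZ i) _; apply: lt_le_trans erho _.
  exact: bigmin_le.
pose p : amb := (\mxcol_i (QT i).1, \mxcol_i (QT i).2).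
have pZ i : factor p i = Z i.
  by rewrite /factor /p/= !mxcolK; have [-> _ _] := HQT i.
have Dp : D_QR p.
  by apply/(D_QRP kd) => i; rewrite pZ /p/= !mxcolK.
exists p; split=> //; apply: H => // i.
- by rewrite pZ; exact: le_lt_trans (HZ i) er.
- by rewrite subrr normr0.
- by rewrite pZ.
Qed.

End Ambient.

(** * Density *)

Section Genericity.
Variables (R : realType) (n d k : nat).
Hypothesis kd : (k < d)%N.
Variables (i0 : 'I_n) (s0 : 'I_k).
Variables (w : option 'I_n -> R -> 'I_n -> R) (K : R).
Hypothesis w_ge0 : forall o (t : R), 0 <= t -> forall j, 0 <= w o t j.
Hypothesis w_sum : forall o (t : R), 0 <= t -> \sum_j w o t j = 1.
Hypothesis K_ge0 : 0 <= K.
Hypothesis w_lip : forall o (s t : R), 0 <= s -> 0 <= t -> forall j,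
  `|w o s j - w o t j| <= K * `|s - t|.
Hypothesis w_cvg : forall o (t : R), 0 <= t -> forall j,
  w o s j @[s --> t] --> w o t j.

Local Notation amb := (ambient R n d k).
Local Notation Dqr := (@D_QR R n d k).

Definition never_deficient (Z : 'I_n -> 'M[R]_(d, k)) :=
  forall o (N : nat), ~ deficient (w o) N%:R Z.

(** Baire's theorem: each of the countably many conditions holds on an open
    dense set. *)
Lemma never_deficient_dense (Z0 : 'I_n -> 'M[R]_(d, k)) (e : R) : 0 < e ->
  exists Z, (forall i, `|Z i - Z0 i| <= e) /\ never_deficient Z.
Proof.
move=> e0.
pose F (N : nat) : set 'M[R]_(\sum_(i < n) d, k) :=
  if (unpickle N : option (option 'I_n * nat)) is Some (c, T)
  then [set M | ~ deficient (w c) T%:R (fun i => submxcol M i)] else setT.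
have coord (M : 'M[R]_(\sum_(i < n) d, k)) i x y :
    (fun N : 'M[R]_(\sum_(i < n) d, k) => submxcol N i x y : R) @ M
      --> (submxcol M i x y : R).
  rewrite (_ : (fun N => _) =
    (fun N : 'M[R]_(\sum_(i < n) d, k) => N (tagnat.Rank i x) y)).
    by rewrite [X in _ --> X]mxE; exact: coord_continuous.
  by apply/funext => N; rewrite mxE.
have FP N : open (F N) /\ dense (F N).
  rewrite /F; case: unpickle => [[c T]|]; last first.
    by split; [exact: openT|move=> O [x Ox] _; exists x].
  split.
    rewrite openE => M HM.
    apply: (@not_deficient_near R 'M[R]_(\sum_(i < n) d, k) (nbhs M) n d k (w c) T%:R
      (fun N i => submxcol N i) (fun i => submxcol M i)) => //.
    - exact: w_cvg.
    - by move=> j x y; exact: coord.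
  move=> O [M OM] oO.
  have /near_norm[r r0 Hr] : \forall N \near M, O N by exact: open_nbhs_nbhs.
  have r2 : 0 < r / 2 by rewrite divr_gt0.
  have [z [zM nd]] := deficient_not_cube kd (w_ge0 c) (w_sum c) K_ge0 (w_lip c)
    i0 s0 T%:R (fun x => submxcol M x.1.1 x.1.2 x.2) r2.
  exists (\mxcol_i tensor_mx z i); split.
    apply: Hr; apply: (@le_lt_trans _ _ (r / 2)); last by lra.
    apply: norm_blocks_le => [|i]; first exact: ltW.
    rewrite submxcolB mxcolK; apply: mx_norm_le => [|x y]; first exact: ltW.
    by have := zM (i, x, y); rewrite !mxE.
  by rewrite /= (_ : (fun i => _) = tensor_mx z)//; apply/funext => i; rewrite mxcolK.
have dF : dense (\bigcap_N F N) by exact: (@Baire R 'M[R]_(\sum_(i < n) d, k)).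
pose M0 : 'M[R]_(\sum_(i < n) d, k) := \mxcol_i Z0 i.
have [||M [BM FM]] := dF (ball M0 e).
- by exists M0; exact: ballxx.
- exact: ball_open.
exists (fun i => submxcol M i); split.
  move=> i; rewrite -[Z0 i](mxcolK (fun i => Z0 i)) -/M0 -submxcolB.
  apply: le_trans (submxcol_norm_le _ _) _.
  by move: BM; rewrite -ball_normE/= distrC => /ltW.
move=> o T; have := FM (pickle (o, T)) Logic.I.
by rewrite /F pickleK.
Qed.

Lemma D_QR_never_deficient_dense (p : amb) (r : R) : D_QR p -> 0 < r ->
  exists p', [/\ D_QR p', `|p' - p| < r & never_deficient (factor p')].
Proof.
move=> Dp r0; have [C [r1 [C0 r10 H]]] := D_QR_section kd Dp.
have C1 : 0 < C + 1 by rewrite ltr_wpDl.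
pose e := Num.min (r1 / 2) (r / (C + 1)).
have e0 : 0 < e by rewrite lt_min !divr_gt0.
have [Z [ZZ0 nd]] := never_deficient_dense (factor p) e0.
have er1 : e < r1.
  by rewrite gt_min; apply/orP; left; rewrite ltr_pdivrMr// ltr_pMr// ltr1n.
have [p' [Dp' p'Z pp']] := H Z e (ltW e0) er1 ZZ0.
exists p'; split=> //; last first.
  by rewrite (_ : factor p' = Z)//; apply/funext.
apply: le_lt_trans pp' _.
have : e <= r / (C + 1) by rewrite ge_min lexx orbT.
by rewrite ler_pdivlMr// => eC; nra.
Qed.

Lemma open_in_never_deficient (D : set amb) :
  (forall p, D p <-> Dqr p /\ never_deficient (factor p)) ->
  (forall p, never_deficient (factor p) ->
     \forall p' \near (p : amb), never_deficient (factor (p' : amb))) ->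
  open_in Dqr D.
Proof.
move=> DE near_nd; split=> [p /DE[]//|].
apply/open_subspaceP; exists [set p | never_deficient (factor p)].
  by rewrite openE => p; exact: near_nd.
by apply/seteqP; split=> p /= [H1 H2]; split=> //; [apply/DE|move/DE: H1 => []].
Qed.

(** Points outside D_QR are isolated in the subspace topology, which disposes of
    them; at a point of D_QR density produces a nearby point of the open set D. *)
Lemma nowhere_dense_deficient (D : set amb) :
  (forall p, D p <-> Dqr p /\ never_deficient (factor p)) ->
  open_in Dqr D -> nowhere_dense_in Dqr (Dqr `\` D).
Proof.
move=> DE [_ oD]; split=> [p []//|].
rewrite -subset0 => p.
have [Dp|nDp] := pselect (Dqr p); last first.
  rewrite /interior /= -[nbhs _]/(nbhs_subspace _) -nbhs_subspace_out// => H.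
  have /= := H p erefl; rewrite /closure /= => /(_ [set p]).
  rewrite -[nbhs _]/(nbhs_subspace _) -nbhs_subspace_out// => /(_ (@subset_refl _ _)).
  by move=> [q [[Dq _] /= qp]]; apply: nDp; rewrite -qp.
rewrite /interior /= -[nbhs _]/(nbhs_subspace _) -nbhs_subspace_in// => H.
have /near_norm[r r0 Hr] : \forall q \near (p : amb), Dqr q ->
  @closure (subspace Dqr) (Dqr `\` D) q by exact: H.
have [q [Dq qp nd]] := D_QR_never_deficient_dense Dp r0.
have Dq' : D q by apply/DE.
have /(_ D) := Hr q qp Dq; case; first exact: open_nbhs_nbhs.
by move=> x [[_ nDx] Dx].
Qed.

End Genericity.

(** * Measure zero *)

Section MeasureZero.
Variables (R : realType) (n d k : nat).
Hypothesis kd : (k < d)%N.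
Variables (i0 : 'I_n) (s0 : 'I_k).
Variables (w : option 'I_n -> R -> 'I_n -> R) (K : R).
Hypothesis w_ge0 : forall o (t : R), 0 <= t -> forall j, 0 <= w o t j.
Hypothesis w_sum : forall o (t : R), 0 <= t -> \sum_j w o t j = 1.
Hypothesis K_ge0 : 0 <= K.
Hypothesis w_lip : forall o (s t : R), 0 <= s -> 0 <= t -> forall j,
  `|w o s j - w o t j| <= K * `|s - t|.

Local Notation amb := (ambient R n d k).
Local Notation Dqr := (@D_QR R n d k).
Let Idx := ('I_n * 'I_d * 'I_k)%type.

Definition entries (p : amb) (x : Idx) : R := factor p x.1.1 x.1.2 x.2.

Lemma tensor_mx_entries p : tensor_mx (entries p) = factor p.
Proof. by apply/funext => i; apply/matrixP => x y; rewrite mxE. Qed.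

(** A parametrization f is bi-Lipschitz near each point, and so is its
    composition with [Q, R] |-> (Q_i R_i)_i onto R^(n d k). *)
Lemma parametrization_bilipschitz (m : nat) (U : set 'rV[R]_m)
    (f : 'rV[R]_m -> amb) (x0 : 'rV[R]_m) :
  local_param Dqr U f -> U x0 ->
  exists C L r : R, [/\ 0 <= C, 0 < r,
    forall x, `|x - x0| < r -> U x /\ forall y, `|entries (f x) y| <= L,
    forall x x' (e : R), `|x - x0| < r -> `|x' - x0| < r -> 0 <= e ->
      (forall y, `|entries (f x) y - entries (f x') y| <= e) ->
      forall l, `|x 0 l - x' 0 l| <= C * e
  & forall x x' (e : R), `|x - x0| < r -> `|x' - x0| < r -> 0 <= e ->
      (forall l, `|x 0 l - x' 0 l| <= e) ->
      forall y, `|entries (f x) y - entries (f x') y| <= C * e].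
Proof.
move=> [[oU fU] sm injd injf opn] Ux0.
pose F : set (amb -> R) := [set L |
  (exists x y, L = fun p : amb => p.1 x y) \/ (exists x y, L = fun p : amb => p.2 x y)].
have Flin L : F L -> [/\ forall p p', L (p - p') = L p - L p',
    forall (b : R) p, L (b *: p) = b * L p & forall p, `|L p| <= `|p|].
  case=> [[x [y ->]]|[x [y ->]]]; split=> [p p'|b p|p]; rewrite /= ?mxE//;
    rewrite amb_norm (le_trans (le_mx_norm _ x y))// le_max lexx ?orbT//.
have Fnorm (p : amb) (b : R) : 0 <= b -> (forall L, F L -> `|L p| <= b) -> `|p| <= b.
  move=> b0 H; rewrite amb_norm ge_max; apply/andP; split; apply: mx_norm_le => // x y.
    by apply: (H (fun p : amb => p.1 x y)); left; exists x, y.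
  by apply: (H (fun p : amb => p.2 x y)); right; exists x, y.
have [c [C [r1 [c0 C0 r10 H1]]]] :=
  immersion_bilipschitz oU Ux0 (sm 1%N) Flin Fnorm (injd x0 Ux0).
pose p0 := f x0.
have Dp0 : Dqr p0 by apply: fU; exists x0.
have [C3 [r3 [C30 r30 H3]]] := D_QR_lipschitz kd Dp0.
have [Cf Cf0 Hf] := @factor_lipschitz R n d k (`|p0| + 1).
have Cp : 0 < C + 1 by rewrite ltr_wpDl.
have Cfp : 0 < Cf * C + 1 by rewrite ltr_wpDl// mulr_ge0.
pose r := Num.min r1 (Num.min (C + 1)^-1 (r3 / (Cf * C + 1))).
have r0 : 0 < r by rewrite !lt_min r10 invr_gt0 Cp divr_gt0.
have r_r1 x : `|x - x0| < r -> `|x - x0| < r1.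
  by rewrite lt_min => /andP[].
have x0r1 : `|x0 - x0| < r1 by rewrite subrr normr0.
have near_p0 x : `|x - x0| < r -> `|f x - p0| <= C * `|x - x0|.
  by move=> /r_r1 xr; have [] := H1 x x0 xr x0r1.
have f_bnd x : `|x - x0| < r -> `|f x| <= `|p0| + 1.
  move=> xr; rewrite -(subrK p0 (f x)) (le_trans (ler_normD _ _))// addrC lerD2l.
  apply: le_trans (near_p0 x xr) _.
  move: xr; rewrite !lt_min => /and3P[_ xr _].
  have : `|x - x0| * (C + 1) < 1 by rewrite -ltr_pdivlMr// div1r.
  by have := normr_ge0 (x - x0); nra.
have p0_bnd : `|p0| <= `|p0| + 1 by rewrite lerDl.
have fac_near x : `|x - x0| < r -> forall i, `|factor (f x) i - factor p0 i| < r3.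
  move=> xr i; apply: le_lt_trans (Hf _ _ (f_bnd x xr) p0_bnd i) _.
  have := near_p0 x xr => fx.
  move: xr; rewrite !lt_min => /and3P[_ _]; rewrite ltr_pdivlMr// => xr.
  have : Cf * `|f x - p0| <= Cf * (C * `|x - x0|) by rewrite ler_wpM2l.
  by have := normr_ge0 (x - x0); nra.
exists (C3 / c + Cf * C), (\sum_i `|factor p0 i| + r3), r; split=> //.
- by rewrite addr_ge0 ?divr_ge0 ?mulr_ge0// ltW.
- move=> x xr; split; first by have [] := H1 x x0 (r_r1 x xr) x0r1.
  move=> [[i y] z]; rewrite /entries /=.
  apply: le_trans (le_mx_norm _ _ _) _.
  rewrite -(subrK (factor p0 i) (factor (f x) i)) (le_trans (ler_normD _ _))// addrC.
  rewrite lerD//; last exact/ltW/fac_near.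
  by rewrite (bigD1 i)//= lerDl sumr_ge0.
- move=> x x' e xr x'r e0 close l.
  have [Ux lo _] := H1 x x' (r_r1 x xr) (r_r1 x' x'r).
  have [Ux' _ _] := H1 x' x' (r_r1 x' x'r) (r_r1 x' x'r).
  have fxx' : `|f x - f x'| <= C3 * e.
    apply: H3 => //.
    - by apply: fU; exists x.
    - by apply: fU; exists x'.
    - exact: fac_near.
    - exact: fac_near.
    - move=> i; apply: mx_norm_le => // y z.
      by have := close (i, y, z); rewrite /entries !mxE.
  have := le_mx_norm (x - x') 0 l; rewrite !mxE => /le_trans; apply.
  apply: (@le_trans _ _ (C3 / c * e)).
    rewrite mulrAC ler_pdivlMr// mulrC; exact: le_trans lo fxx'.
  by rewrite ler_wpM2r// lerDl mulr_ge0.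
- move=> x x' e xr x'r e0 close y.
  have [_ _ up] := H1 x x' (r_r1 x xr) (r_r1 x' x'r).
  have xx' : `|x - x'| <= e.
    by apply: mx_norm_le => // j l; rewrite ord1 !mxE.
  have : `|entries (f x) y - entries (f x') y| <=
      `|factor (f x) y.1.1 - factor (f x') y.1.1|.
    have -> : entries (f x) y - entries (f x') y =
        (factor (f x) y.1.1 - factor (f x') y.1.1) y.1.2 y.2.
      by rewrite [RHS]mxE [X in _ = _ + X]mxE.
    exact: le_mx_norm.
  move=> /le_trans; apply.
  apply: le_trans (Hf _ _ (f_bnd x xr) (f_bnd x' x'r) y.1.1) _.
  apply: (@le_trans _ _ (Cf * C * e)).
    rewrite -mulrA ler_wpM2l//; apply: le_trans up _; rewrite ler_wpM2l//.
  by rewrite ler_wpM2r// lerDr divr_ge0// ltW.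
Qed.

(** The image of f contains a cube of R^(n d k) through the section of
    D_QR_section, so that m is at least n d k. *)
Lemma parametrization_dim (m : nat) (U : set 'rV[R]_m)
    (f : 'rV[R]_m -> amb) (x0 : 'rV[R]_m) :
  local_param Dqr U f -> U x0 -> (#|{: Idx}| <= m)%N.
Proof.
move=> lp Ux0; have [C [L [r [C0 r0 bnd _ up]]]] := parametrization_bilipschitz lp Ux0.
have [[oU fU] _ _ _ opn] := lp.
rewrite leqNgt; apply/negP => mN.
pose U' := ball x0 r.
have U'E x : U' x -> `|x - x0| < r by rewrite /U' -ball_normE/= distrC.
have /open_subspaceP[V oV VE] : @open (subspace Dqr) (f @` U').
  by apply: opn; [exact: ball_open|move=> x /U'E/bnd[]].
have Dp0 : Dqr (f x0) by apply: fU; exists x0.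
have Vp0 : V (f x0).
  suff : (V `&` Dqr) (f x0) by case.
  by rewrite VE; split=> //; exists x0 => //; exact: ballxx.
have /near_norm[r4 r40 Hr4] : \forall p \near f x0, V p by exact: open_nbhs_nbhs.
have [Cs [rs [Cs0 rs0 Hs]]] := D_QR_section kd Dp0.
have Cs1 : 0 < Cs + 1 by rewrite ltr_wpDl.
pose delta := Num.min (rs / 2) (r4 / (Cs + 1)).
have delta0 : 0 < delta by rewrite lt_min !divr_gt0.
have drs : delta < rs.
  by rewrite gt_min; apply/orP; left; rewrite ltr_pdivrMr// ltr_pMr// ltr1n.
have dr4 : Cs * delta < r4.
  have : delta <= r4 / (Cs + 1) by rewrite ge_min lexx orbT.
  by rewrite ler_pdivlMr// => H; nra.
have cJ : (#|{: 'I_m}| < #|{: Idx}|)%N by rewrite card_ord.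
apply: (@lipschitz_not_cube R unit _ _ (`|x0| + r) C delta (entries (f x0))
  (fun z _ y => exists2 x, U' x & (forall j, z j = entries (f x) j) /\
     forall l, y l = x 0 l) cJ delta0).
- move=> z Hz.
  have HZ i : `|tensor_mx z i - factor (f x0) i| <= delta.
    apply: mx_norm_le => [|x y]; first exact: ltW.
    by have := Hz (i, x, y); rewrite /entries !mxE.
  have [p [Dp pz pp0]] := Hs _ _ (ltW delta0) drs HZ.
  have [[x U'x fxp] _] : (f @` U' `&` Dqr) p.
    by rewrite -VE; split=> //; apply: Hr4; exact: le_lt_trans pp0 dr4.
  exists tt, (fun l => x 0 l), x => //; split=> // -[[i y] u].
  by rewrite /entries /= fxp pz mxE.
- move=> z _ y [x /U'E xr [_ yE]] j; rewrite yE.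
  apply: le_trans (le_mx_norm _ _ _) _.
  by rewrite -(subrK x0 x) (le_trans (ler_normD _ _))// addrC lerD2l ltW.
- move=> z z' _ y y' e e0 [x /U'E xr [zE yE]] [x' /U'E x'r [z'E y'E]] close j.
  by rewrite zE z'E; apply: up => // l; rewrite -yE -y'E.
Qed.

Lemma measure_zero_deficient (A : set amb) :
  (forall p, A p -> ~ never_deficient w (factor p)) -> measure_zero_in Dqr A.
Proof.
move=> nA m U f lp; apply: lebesgue_null_local => x0 [Ux0 _].
have [C [L [r [C0 r0 bnd lo _]]]] := parametrization_bilipschitz lp Ux0.
exists r => //.
pose B := [set x : 'rV[R]_m | `|x - x0| < r].
pose P (oN : option 'I_n * nat) := B `&`
  [set x | deficient (w oN.1) oN.2%:R (tensor_mx (entries (f x)))].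
apply: (@lebesgue_null_sub _ _ _ (\bigcup_oN P oN)).
  move=> x [[_ /nA]] /existsNP[c /existsNP[N /contrapT def]] Bx.
  by exists (c, N) => //; split=> //=; rewrite tensor_mx_entries.
apply: lebesgue_null_countable => -[c N].
apply: (@deficient_null R n d k kd (w c) K (w_ge0 c) (w_sum c) K_ge0 (w_lip c)
  i0 s0 m N%:R L C B (fun x => entries (f x)) (parametrization_dim lp Ux0) C0).
- by move=> x /bnd[].
- by move=> x x' e Bx Bx' e0; exact: lo.
Qed.

End MeasureZero.

(** * Conclusion *)

Theorem proposition1 (R : realType) (n d k : nat) (E : rel 'I_n)
    (a : 'I_n -> 'I_n -> R)
    (hd : (2 <= d)%N) (hk : (1 <= k <= d - 1)%N)
    (hE : quasi_strongly_connected E)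
    (ha : forall i j : 'I_n, E i j -> 0 < a i j) :
  open_in (@D_QR R n d k) (@D_QR_full R n d k E a)
  /\ measure_zero_in (@D_QR R n d k)
       (@D_QR R n d k `\` @D_QR_full R n d k E a)
  /\ nowhere_dense_in (@D_QR R n d k)
       (@D_QR R n d k `\` @D_QR_full R n d k E a).
Proof.
have [k_gt0 kd] : (0 < k)%N /\ (k < d)%N.
  case/andP: hk => k1 kd1; split=> //; apply: leq_ltn_trans kd1 _.
  by rewrite subn1 ltn_predL (ltn_trans _ hd).
have [r _] := hE; pose s0 : 'I_k := Ordinal k_gt0.
have [Phi [q [Phi0 dPhi Phi_ge0 Phi_sum cPhi]]] := consensus_flow hE ha.
pose w := weights Phi q.
have [K K0 wK] := weights_lipschitz q dPhi Phi_ge0 Phi_sum.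
have w0 o (t : R) : 0 <= t -> forall j, 0 <= w o t j by exact: weights_ge0.
have w1 o (t : R) : 0 <= t -> \sum_j w o t j = 1 by exact: weights_sum.
have wc o (t : R) : 0 <= t -> forall j, w o s j @[s --> t] --> w o t j.
  by move=> t0 j; exact: (weights_cvg dPhi).
have fullP p : D_QR_full E a p <->
    @D_QR R n d k p /\ never_deficient w (factor p).
  split=> [Fp|[Dp nd]].
    split; first by case: Fp.
    by apply/regularP; exact: (D_QR_full_regular kd hE Phi0 dPhi cPhi Fp).
  by apply: (regular_D_QR_full kd Phi0 dPhi cPhi Dp); apply/regularP.
have oF : open_in (@D_QR R n d k) (D_QR_full E a).
  apply: (open_in_never_deficient fullP) => p nd.
  have rp : regular Phi q (factor p) by apply/regularP.
  have := @regular_near R n d k E a Phi q dPhi cPhi _ (nbhs p)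
    (fun p' => factor p') (factor p) (nbhs_filter p) (fun i x y => @cvg_factor R n d k p i x y) rp.
  by apply: (@filterS _ _ (nbhs_filter p)) => p' /regularP.
split; [exact: oF|split].
  apply: (measure_zero_deficient kd r s0 w0 w1 K0 wK) => p [Dp nF] nd.
  by apply: nF; apply/fullP.
exact: (nowhere_dense_deficient kd r s0 w0 w1 K0 wK wc fullP oF).
Qed.
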